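(* Let $\Gamma=\Gamma_5$ be the Fermat curve $x^6+y^6+z^6=0$ in characteristic $5$, with automorphism group $\mathrm{PGU}_3(\mathbb{F}_{25})$, and let $Q$ and $Q'$ be distinct elements of the set $\mathcal{Q}$ of non-singular conics totally tangent to $\Gamma$. Then $Q$ and $Q'$ are adjacent in the graph $G$ if and only if $\mathrm{stab}(Q)\cap\mathrm{stab}(Q')$ is isomorphic to the alternating group $\mathfrak{A}_4$. Moreover, $Q$ and $Q'$ are in the same connected component of $G$ if and only if the subgroup $\langle\mathrm{stab}(Q),\mathrm{stab}(Q')\rangle$ of $\mathrm{PGU}_3(\mathbb{F}_{25})$ generated by the union of $\mathrm{stab}(Q)$ and $\mathrm{stab}(Q')$ is isomorphic to the alternating group $\mathfrak{A}_7$.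
   Context: Work over an algebraically closed field $k$ of characteristic $5$. $\Gamma=\Gamma_5\subset\mathbb{P}^2$ is the curve $x^6+y^6+z^6=0$; its automorphism group $\{g\in\mathrm{PGL}_3(k)\mid g(\Gamma)=\Gamma\}$ is $\mathrm{PGU}_3(\mathbb{F}_{25})$, of order $378000$. $\mathcal{P}$ denotes the set of Weierstrass points of $\Gamma$; equivalently, the set of $\mathbb{F}_{25}$-rational points of $\Gamma_5$; $|\mathcal{P}|=126$. A line of $\mathbb{P}^2$ is a special secant line of $\Gamma$ if it passes through two distinct points of $\mathcal{P}$. A non-singular conic $Q\subset\mathbb{P}^2$ is totally tangent to $\Gamma$ if $Q$ meets $\Gamma$ at six distinct points, each with intersection multiplicity $2$. $\mathcal{Q}$ denotes the set of all such conics; one has $|\mathcal{Q}|=3150$ and $Q\cap\Gamma\subset\mathcal{P}$ for $Q\in\mathcal{Q}$. For $Q\in\mathcal{Q}$, $\mathcal{S}(Q)$ is the set of the $15$ special secant lines of $\Gamma$ passing through two distinct points of $Q\cap\Gamma$. $G$ is the graph with vertex set $\mathcal{Q}$ in which distinct $Q,Q'$ are adjacent if and only if $|Q\cap Q'|=4$ and $|\mathcal{S}(Q)\cap\mathcal{S}(Q')|=3$. For an element $x$ of a set on which $\mathrm{PGU}_3(\mathbb{F}_{25})$ acts, $\mathrm{stab}(x)$ denotes its stabilizer subgroup in $\mathrm{PGU}_3(\mathbb{F}_{25})$. *)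

(* Defs.v *)
From HB Require Import structures.
From mathcomp Require Import all_boot all_order all_algebra all_fingroup.
From mathcomp Require Import all_solvable fraction.
From mathcomp Require Import mpoly.
From mathcomp Require Import boolp classical_sets functions cardinality.
From Stdlib Require Import Relation_Operators.

Set Implicit Arguments.
Unset Strict Implicit.
Unset Printing Implicit Defensive.

Import GRing.Theory.

Local Open Scope classical_set_scope.
Local Open Scope card_scope.
Local Open Scope ring_scope.
Local Open Scope quotient_scope.

(* [fingroup.repr] would otherwise shadow the quotient representative. *)
Local Notation repr := generic_quotient.repr.

Section Projective.
Variable k : fieldType.

Definition proportional (V : lmodType k) (u v : V) : bool :=
  `[< exists2 c : k, c != 0 & u = c *: v >].

Lemma proportional_refl (V : lmodType k) : reflexive (@proportional V).
Proof. by move=> u; apply/asboolP; exists 1; rewrite ?oner_neq0 ?scale1r. Qed.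

Lemma proportional_sym (V : lmodType k) : ssrbool.symmetric (@proportional V).
Proof.
move=> u v; apply/asboolP/asboolP => -[c c0 ->];
  by exists c^-1; rewrite ?invr_eq0 // scalerA mulVf // scale1r.
Qed.

Lemma proportional_trans (V : lmodType k) : transitive (@proportional V).
Proof.
move=> v u w /asboolP[c c0 ->] /asboolP[d d0 ->]; apply/asboolP.
by exists (c * d); rewrite ?mulf_neq0 // scalerA.
Qed.

Definition nzvec := {v : 'cV[k]_3 | v != 0}.

Definition nzvec_rel : rel nzvec := fun u v => proportional (val u) (val v).

Fact nzvec_rel_refl : reflexive nzvec_rel.
Proof. by move=> u; apply: proportional_refl. Qed.
Fact nzvec_rel_sym : ssrbool.symmetric nzvec_rel.
Proof. by move=> u v; apply: proportional_sym. Qed.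
Fact nzvec_rel_trans : transitive nzvec_rel.
Proof. by move=> v u w; apply: proportional_trans. Qed.

Canonical nzvec_equiv :=
  EquivRel nzvec_rel nzvec_rel_refl nzvec_rel_sym nzvec_rel_trans.

Definition P2 := {eq_quot nzvec_rel}.

Definition point (v : nzvec) : P2 := \pi v.

Lemma pointP (u v : nzvec) :
  point u = point v <-> exists2 c : k, c != 0 & val u = c *: val v.
Proof.
by split=> [/eqmodP/asboolP //|uv]; apply/eqmodP/asboolP.
Qed.

Definition GL3 := {A : 'M[k]_3 | A \in unitmx}.

Definition GL3_rel : rel GL3 := fun A B => proportional (val A) (val B).

Fact GL3_rel_refl : reflexive GL3_rel.
Proof. by move=> u; apply: proportional_refl. Qed.
Fact GL3_rel_sym : ssrbool.symmetric GL3_rel.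
Proof. by move=> u v; apply: proportional_sym. Qed.
Fact GL3_rel_trans : transitive GL3_rel.
Proof. by move=> v u w; apply: proportional_trans. Qed.

Canonical GL3_equiv := EquivRel GL3_rel GL3_rel_refl GL3_rel_sym GL3_rel_trans.

Definition PGL3 := {eq_quot GL3_rel}.

Definition mxclass (A : GL3) : PGL3 := \pi A.

Lemma mxclassP (A B : GL3) :
  mxclass A = mxclass B <-> exists2 c : k, c != 0 & val A = c *: val B.
Proof.
by split=> [/eqmodP/asboolP //|uv]; apply/eqmodP/asboolP.
Qed.

Lemma repr_mxclass (A : GL3) :
  exists2 c : k, c != 0 & val (repr (mxclass A)) = c *: val A.
Proof. by apply/mxclassP; rewrite /mxclass reprK. Qed.

Lemma repr_point (v : nzvec) :
  exists2 c : k, c != 0 & val (repr (point v)) = c *: val v.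
Proof. by apply/pointP; rewrite /point reprK. Qed.

Fact GL3_one_subproof : (1%:M : 'M[k]_3) \in unitmx.
Proof. exact: unitmx1. Qed.
Fact GL3_mul_subproof (A B : GL3) : val A *m val B \in unitmx.
Proof. by rewrite unitmx_mul (valP A) (valP B). Qed.
Fact GL3_inv_subproof (A : GL3) : invmx (val A) \in unitmx.
Proof. by rewrite unitmx_inv (valP A). Qed.

Definition GL3_one : GL3 := exist _ 1%:M GL3_one_subproof.
Definition GL3_mul (A B : GL3) : GL3 :=
  exist _ (val A *m val B) (GL3_mul_subproof A B).
Definition GL3_inv (A : GL3) : GL3 :=
  exist _ (invmx (val A)) (GL3_inv_subproof A).

Definition PGL3_one : PGL3 := mxclass GL3_one.
Definition PGL3_mul (g h : PGL3) : PGL3 := mxclass (GL3_mul (repr g) (repr h)).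
Definition PGL3_inv (g : PGL3) : PGL3 := mxclass (GL3_inv (repr g)).

Lemma PGL3_mulE (A B : GL3) :
  PGL3_mul (mxclass A) (mxclass B) = mxclass (GL3_mul A B).
Proof.
apply/mxclassP => /=.
have [c c0 ->] := repr_mxclass A; have [d d0 ->] := repr_mxclass B.
by exists (c * d); rewrite ?mulf_neq0 // -scalemxAl -scalemxAr scalerA.
Qed.

Lemma point_repr (p : P2) : point (repr p) = p.
Proof. exact: reprK. Qed.

Lemma mxclass_repr (g : PGL3) : mxclass (repr g) = g.
Proof. exact: reprK. Qed.

Fact PGL3_mulA : associative PGL3_mul.
Proof.
move=> f g h; rewrite -(mxclass_repr f) -(mxclass_repr g) -(mxclass_repr h).
rewrite !PGL3_mulE; congr mxclass; apply: val_inj => /=.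
exact: mulmxA.
Qed.

Fact PGL3_mul1 : left_id PGL3_one PGL3_mul.
Proof.
move=> g; rewrite -(mxclass_repr g) PGL3_mulE; congr mxclass.
by apply: val_inj => /=; rewrite mul1mx.
Qed.

Fact PGL3_mulr1 : right_id PGL3_one PGL3_mul.
Proof.
move=> g; rewrite -(mxclass_repr g) PGL3_mulE; congr mxclass.
by apply: val_inj => /=; rewrite mulmx1.
Qed.

Fact PGL3_mulV : left_inverse PGL3_one PGL3_inv PGL3_mul.
Proof.
move=> g; rewrite /PGL3_inv -{2}(mxclass_repr g) PGL3_mulE; congr mxclass.
by apply: val_inj => /=; rewrite mulVmx // (valP (repr g)).
Qed.

Fact PGL3_mulrV : right_inverse PGL3_one PGL3_inv PGL3_mul.
Proof.
move=> g; rewrite /PGL3_inv -{1}(mxclass_repr g) PGL3_mulE; congr mxclass.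
by apply: val_inj => /=; rewrite mulmxV // (valP (repr g)).
Qed.

HB.instance Definition _ := Choice.on PGL3.
HB.instance Definition _ := isGroup.Build PGL3
  PGL3_mulA PGL3_mul1 PGL3_mulr1 PGL3_mulV PGL3_mulrV.

Fact GL3_act_subproof (A : GL3) (v : nzvec) : val A *m val v != 0.
Proof.
apply: contra (valP v) => /eqP Av0.
by rewrite -[val v](mulKmx (valP A)) Av0 mulmx0.
Qed.

Definition GL3_act (A : GL3) (v : nzvec) : nzvec :=
  exist _ (val A *m val v) (GL3_act_subproof A v).

Definition PGL3_act (g : PGL3) (p : P2) : P2 :=
  point (GL3_act (repr g) (repr p)).

Lemma PGL3_actE (A : GL3) (v : nzvec) :
  PGL3_act (mxclass A) (point v) = point (GL3_act A v).
Proof.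
apply/pointP => /=.
have [c c0 ->] := repr_mxclass A; have [d d0 ->] := repr_point v.
by exists (c * d); rewrite ?mulf_neq0 // -scalemxAl -scalemxAr scalerA.
Qed.

Lemma PGL3_act1 (p : P2) : PGL3_act 1%g p = p.
Proof.
rewrite -{1}(point_repr p) PGL3_actE -[RHS]point_repr; congr point.
by apply: val_inj => /=; rewrite mul1mx.
Qed.

Lemma PGL3_actM (g h : PGL3) (p : P2) :
  PGL3_act (g * h)%g p = PGL3_act g (PGL3_act h p).
Proof.
rewrite -(point_repr p) -(mxclass_repr g) -(mxclass_repr h).
rewrite [(_ * _)%g]PGL3_mulE (PGL3_actE (repr h)) !PGL3_actE; congr point.
by apply: val_inj => /=; rewrite mulmxA.
Qed.

End Projective.

Section Curves.
Variable k : fieldType.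
Local Notation poly3 := {mpoly k[3]}.
Local Notation K := {fraction {mpoly k[3]}}.
Local Notation "x %:F" := (@tofrac {mpoly k[3]} x).

Definition coords (v : nzvec k) : 'I_3 -> k := fun i => val v i 0.

(* Only meaningful for homogeneous [f], where the choice of homogeneous
   coordinates of [p] does not matter; it is only used for those. *)
Definition vanishes (f : poly3) (p : P2 k) : Prop := f.@[coords (repr p)] = 0.

Definition zeros (f : poly3) : set (P2 k) := [set p | vanishes f p].

(* The local ring of the plane at [p], inside the fraction field of the
   homogeneous coordinate ring. *)
Definition local_ring (p : P2 k) : set K :=
  [set u | exists (d : nat) (a b : poly3),
     [/\ a \is d.-homog, b \is d.-homog, ~ vanishes b p & u = a%:F / b%:F]].

(* The local equations at [p] of the curve [f = 0] ([f] homogeneous). *)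
Definition local_eqn (f : poly3) (p : P2 k) : set K :=
  [set u | exists (d : nat) (b : poly3),
     [/\ f \is d.-homog, b \is d.-homog, ~ vanishes b p & u = f%:F / b%:F]].

Definition local_ideal (f g : poly3) (p : P2 k) : set K :=
  [set u | exists r s x y : K,
     [/\ local_ring p r, local_ring p s, local_eqn f p x, local_eqn g p y
       & u = r * x + s * y]].

(* dim_k (O_p / (f, g)) = n : the family [e] is a basis modulo (f, g). *)
Definition intersection_mult (f g : poly3) (p : P2 k) (n : nat) : Prop :=
  exists e : 'I_n -> K,
    (forall i, local_ring p (e i)) /\
    (forall u, local_ring p u ->
       exists! c : 'rV[k]_n,
         local_ideal f g p (u - \sum_(i < n) (c 0 i)%:MP%:F * e i)).

Definition is_line (L : set (P2 k)) : Prop :=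
  exists l : poly3, [/\ l \is 1.-homog, l != 0 & L = zeros l].

Definition nonsingular_form (q : poly3) : Prop :=
  forall v : nzvec k, q.@[coords v] = 0 ->
    exists i : 'I_3, (mderiv i q).@[coords v] != 0.

End Curves.

Section FermatSextic.
Variable k : fieldType.

Definition fermat6 : {mpoly k[3]} := \sum_(i < 3) 'X_i ^+ 6.

Definition Gamma : set (P2 k) := zeros fermat6.

(* In characteristic 5 this is PGU_3(F_25), for the Hermitian form of the Fermat
   sextic. *)
Definition aut_Gamma : set (PGL3 k) := [set g | PGL3_act g @` Gamma = Gamma].

Definition stab (Q : set (P2 k)) : set (PGL3 k) :=
  aut_Gamma `&` [set g | PGL3_act g @` Q = Q].

(* In characteristic 5, F_25 is the set of roots of 'X^25 - 'X in [k]. *)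
Definition rational_points : set (P2 k) :=
  Gamma `&` [set p | exists2 v : nzvec k,
                       p = point v & forall i, coords v i ^+ 25 = coords v i].

Definition special_secant (L : set (P2 k)) : Prop :=
  is_line L /\ exists p q, [/\ p <> q, rational_points p, rational_points q,
                               L p & L q].

Definition totally_tangent_conic (Q : set (P2 k)) : Prop :=
  exists q : {mpoly k[3]},
    [/\ q \is 2.-homog, nonsingular_form q, Q = zeros q,
        Q `&` Gamma #= `I_6
      & forall p, (Q `&` Gamma) p -> intersection_mult q fermat6 p 2].

Definition secants (Q : set (P2 k)) : set (set (P2 k)) :=
  [set L | special_secant L /\
           exists p q, [/\ p <> q, (Q `&` Gamma) p, (Q `&` Gamma) q,
                           L p & L q]].

Definition adjacent (Q Q' : set (P2 k)) : Prop :=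
  [/\ totally_tangent_conic Q, totally_tangent_conic Q', Q <> Q',
      Q `&` Q' #= `I_4 & secants Q `&` secants Q' #= `I_3].

Definition same_component : set (P2 k) -> set (P2 k) -> Prop :=
  clos_refl_sym_trans (set (P2 k)) adjacent.

End FermatSextic.

Arguments fermat6 k : clear implicits.
Arguments Gamma : clear implicits.
Arguments aut_Gamma : clear implicits.
Arguments rational_points : clear implicits.

Section Groups.
Variable G : groupType.

Definition is_subgroup (H : set G) : Prop := group_closed (mem H).

Definition subgroup_generated (A : set G) : set G := smallest is_subgroup A.

Definition isomorphic_to (gT : finGroupType) (A : {group gT}) (H : set G) :
    Prop :=
  exists f : gT -> G,
    {in A &, {morph f : x y / (x * y)%g}} /\ set_bij [set` A] H f.

End Groups.

(* Main.v *)
(* In characteristic 5 the sextic is the isotropic curve of a Hermitian form, so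
   its automorphisms are the classes of unitary matrices. A conic with matrix B
   that has contact of order 2 at six points satisfies B p ~ p^5 there (p^5 is
   taken coordinatewise), and this forces it to be a unitary image of
   x^2 + y^2 + z^2 = 0; the stabilizer of the latter is the orthogonal group
   over F_5.

   Let w be a primitive cube root of unity. The poles of the three common
   secants of an adjacent pair diagonalize both conics and the Hermitian form
   simultaneously, so the pair is a unitary image of x^2 + y^2 + z^2 and
   x^2 + w y^2 + w^2 z^2, whose stabilizers meet in the rotation group of a
   tetrahedron. Conversely, lifts of the Klein group of an A_4 inside both
   stabilizers are diagonalized by three vectors permuted by an element of
   order 3, which leads back to the same normal form.

   An explicit family of 21 conics, indexed by the pairs of elements of a set of
   seven and permuted by A_7, contains all neighbours of each of its members and
   thus a component; the stabilizer of {i, j} in A_7 is the full stabilizer of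
   the corresponding conic. Two different pair stabilizers generate A_7. In the
   other direction, if the stabilizers of Q and Q' generate a copy of A_7, they
   are subgroups of order 120, hence pair stabilizers; when the two pairs have a
   common point, some Klein group and element of order 3 move only four points
   outside both pairs, so that the conics are adjacent or equal. Disjoint pairs
   are linked through a third one. *)

From HB Require Import structures.
From mathcomp Require Import all_boot all_order all_algebra all_fingroup.
From mathcomp Require Import all_solvable.

Set Implicit Arguments.
Unset Strict Implicit.
Unset Printing Implicit Defensive.

(** * Alternating groups *)

Section AlternatingGroups.
Local Open Scope group_scope.

Section Alternating.
Variable T : finType.
Implicit Types (s t : {perm T}) (R : {group {perm T}}).

(** No intersection multiplicity is ever computed exactly. At a transversal intersection the local
    quotient has dimension at most 1, so multiplicity 2 forces tangency. Total tangency of the other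
    conics, x^2 + y^2 + z^2 = 0 included, is transported from [Q] itself along unitary substitutions
    extended to the fraction field. Identities between projective classes hold only up to a scalar,
    and removing these scalars shapes many arguments. A scalar m multiplies the Hermitian form by
    m^6, so sixth roots turn similitudes into unitary matrices. Several multipliers are shown to be
    1 by proving c^2 = c^3 = 1, the cube often coming from a determinant in dimension 3. The 21
    conics have Gram matrices over F_25, so their combinatorics is checked by computation. The pairs
    {0, 1} and {0, 2} are the normal form of an adjacent pair, and the orthogonal images of the
    second conic stay among the pairs that meet {0, 1} in one element. In the last implication the
    isomorphism with A_7 is abstract and unrelated to this family; the pair attached to a conic has
    to be recovered from the order of its stabilizer alone. *)

Lemma Alt_sub_star (x0 x1 : T) R : x0 != x1 ->
  (forall a, a != x0 -> a != x1 -> tperm x0 a * tperm x0 x1 \in R) ->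
  'Alt_T \subset R.
Proof.
move=> x01 Rg; set t1 := tperm x0 x1.
have t1K : t1 * t1 = 1 by rewrite tperm2.
have Rstar a : a != x0 -> tperm x0 a * t1 \in R.
  by move=> ax0; have [->|ax1] := eqVneq a x1; [rewrite t1K group1|apply: Rg].
(* The star transpositions [tperm x0 a] generate; the parity bookkeeping below
   multiplies odd elements by [t1] to bring them back into [R]. *)
pose P s := if odd_perm s then s * t1 \in R else s \in R.
(* [Z] collects the right multipliers that preserve [P]. It is closed under products, hence a group
   by finiteness, and it contains the star transpositions, which generate the symmetric group;
   applying its members to [P 1] gives the claim. *)
pose Z := [set s | [forall u, P u ==> P (u * s)]].
have ZP s : reflect (forall u, P u -> P (u * s)) (s \in Z).
  by rewrite inE; apply: (iffP forallP) => Zs u; apply/implyP/Zs.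
have gZ : group_set Z.
  apply/group_setP; split=> [|s t /ZP Zs /ZP Zt].
    by apply/ZP => u; rewrite mulg1.
  by apply/ZP => u Pu; rewrite mulgA; apply/Zt/Zs.
have ZT s : s \in Z.
  suff : <<[set tperm x0 y | y in T]>> \subset Group gZ.
    by rewrite gen_tperm => /subsetP->; rewrite ?inE.
  rewrite gen_subG; apply/subsetP => _ /imsetP[a _ ->].
  have [->|ax0] := eqVneq a x0; first by rewrite tperm1 group1.
  apply/ZP => u; rewrite /P odd_permM odd_tperm eq_sym ax0 addbT.
  case: (odd_perm u) => /= Ru; last by rewrite -mulgA groupM ?Rstar.
  have -> : u * tperm x0 a = (u * t1) * (tperm x0 a * t1)^-1.
    by rewrite invMg !tpermV !mulgA -(mulgA u) t1K mulg1.
  by rewrite groupM ?groupV ?Rstar.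
apply/subsetP => s; rewrite Alt_even => /negPf s_even.
by have /ZP/(_ 1) := ZT s; rewrite /P odd_perm1 group1 mul1g s_even; apply.
Qed.

Section FourPoints.
Variables p q r s : T.
Hypothesis uniq4 : uniq [:: p; q; r; s].

(** The relations proved below for these double transpositions and for the 3-cycle q -> r -> s -> q
    are those that [tetra_NF] asks of three elements of PGL_3. *)
Definition klein1 : {perm T} := tperm p q * tperm r s.
Definition klein2 : {perm T} := tperm p r * tperm q s.
Definition klein3 : {perm T} := tperm p s * tperm q r.
Definition tri3 : {perm T} := tperm q r * tperm q s.

Let neqs : ((p == q) = false) * ((p == r) = false) * ((p == s) = false) *
  ((q == r) = false) * ((q == s) = false) * ((r == s) = false) *
  ((q == p) = false) * ((r == p) = false) * ((s == p) = false) *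
  ((r == q) = false) * ((s == q) = false) * ((s == r) = false).
Proof.
move: uniq4; rewrite /= !inE !negb_or -!andbA.
case/and5P=> /negPf pq /negPf pr /negPf ps /negPf qr /andP[/negPf qs /andP[/negPf rs _]].
by do !split=> //; rewrite eq_sym.
Qed.

Let ext4 (u v : {perm T}) : u p = v p -> u q = v q -> u r = v r -> u s = v s ->
  (forall x, ((x == p) = false) * ((x == q) = false) * ((x == r) = false) *
     ((x == s) = false) -> u x = v x) -> u = v.
Proof.
move=> up uq ur us uv; apply/permP => x.
have [->//|/negPf xp] := eqVneq x p; have [->//|/negPf xq] := eqVneq x q.
have [->//|/negPf xr] := eqVneq x r; have [->//|/negPf xs] := eqVneq x s.
exact: uv.
Qed.

Ltac perm4 := apply: ext4;
  [| | | |let x := fresh "x" in let xE := fresh "xE" in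
    intros x xE; rewrite !permM ?perm1 !permE /= !xE ?eqxx ?neqs /= ?xE //];
  do 4?[rewrite !permM ?perm1 !permE /= ?eqxx ?neqs /= ?eqxx ?neqs /= ?eqxx ?neqs //].

Lemma klein1_sq : klein1 * klein1 = 1. Proof. rewrite /klein1. perm4. Qed.
Lemma klein12 : klein1 * klein2 = klein3.
Proof. rewrite /klein1 /klein2 /klein3. perm4. Qed.
Lemma klein21 : klein2 * klein1 = klein3.
Proof. rewrite /klein1 /klein2 /klein3. perm4. Qed.
Lemma tri3_cube : tri3 * tri3 * tri3 = 1.
Proof. rewrite /tri3. perm4. Qed.
Lemma klein1_tri3 : klein1 * tri3 = tri3 * klein2.
Proof. rewrite /klein1 /klein2 /tri3. perm4. Qed.
Lemma klein2_tri3 : klein2 * tri3 = tri3 * klein3.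
Proof. rewrite /klein3 /klein2 /tri3. perm4. Qed.
Lemma klein1_neq1 : klein1 != 1.
Proof.
apply/eqP => /permP/(_ p); rewrite permM perm1 tpermL tpermD ?neqs // => /eqP.
by rewrite neqs.
Qed.
Lemma klein1_Alt : klein1 \in 'Alt_T.
Proof. by rewrite Alt_even odd_permM !odd_tperm !neqs. Qed.
Lemma klein2_Alt : klein2 \in 'Alt_T.
Proof. by rewrite Alt_even odd_permM !odd_tperm !neqs. Qed.
Lemma tri3_Alt : tri3 \in 'Alt_T.
Proof. by rewrite Alt_even odd_permM !odd_tperm !neqs. Qed.

End FourPoints.
End Alternating.

(** The kernel of the action of [G] on the cosets of [X] is a normal subgroup inside the proper
    subgroup [X], so it is trivial by simplicity, and [G] embeds into the symmetric group on these
    cosets. *)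
Lemma simple_card_index_fact (gT : finGroupType) (G X : {group gT}) :
  simple G -> X \proper G -> #|G| %| #|G : X|`!.
Proof.
move=> simG /andP[sXG nsGX]; set S := rcosets X G.
have nS : [acts G, on S | 'Rs] := actsRs_rcosets X G.
have injG : 'injm (actperm <[nS]>).
  rewrite ker_actperm astab_actby setIT astabRs_rcosets.
  rewrite subG1; apply/eqP.
  have nK : G :&: gcore X G <| G.
    by rewrite (setIidPr (subset_trans (gcore_sub _ _) sXG)) gcore_normal.
  have [_ /(_ _ nK)[//|KG]] := simpleP _ simG.
  by case/negP: nsGX; rewrite -KG (subset_trans (subsetIr _ _)) ?gcore_sub.
suff SG : actperm <[nS]> @* G \subset perm.Sym S.
  have := cardSg SG; rewrite card_injm // perm.card_Sym; exact.
apply/subsetP => _ /morphimP[x Gx _ ->]; rewrite inE.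
apply/subsetP => C; rewrite inE actpermE /= /actby.
by case: (C \in S) => //; rewrite eqxx.
Qed.

Section Pairs.
Variable T : finType.
Implicit Types (s t : {perm T}) (R X : {group {perm T}}).

Lemma Alt_mapP n (u v : n.-tuple T) : uniq u -> uniq v -> n <= #|T|.-2 ->
  exists2 s, s \in 'Alt_T & map s u = v.
Proof.
move=> Uu Uv n2; have tr := ntransitive_weak n2 (Alt_trans T).
have dtuple (w : n.-tuple T) : uniq w -> w \in n.-dtuple([set: T]).
  by move=> Uw; rewrite inE Uw; apply/subsetP.
have [s As ->] := atransP2 tr (dtuple u Uu) (dtuple v Uv).
by exists s.
Qed.

Definition stab2 (a b : T) : {set {perm T}} :=
  [set s in 'Alt_T | [set s a; s b] == [set a; b]].

Lemma set2_eq (a b c d : T) : a != b ->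
  ([set c; d] == [set a; b]) = ((c == a) && (d == b)) || ((c == b) && (d == a)).
Proof.
move=> ab; apply/eqP/idP => [E|/orP[]/andP[/eqP-> /eqP->]//]; last by rewrite setUC.
have /set2P[ca|cb] : c \in [set a; b] by rewrite -E set21.
  have /set2P[bc|<-] : b \in [set c; d] by rewrite E set22.
    by rewrite bc ca eqxx in ab.
  by rewrite ca !eqxx.
have /set2P[ac|<-] : a \in [set c; d] by rewrite E set21.
  by rewrite ac cb eqxx in ab.
by rewrite cb !eqxx orbT.
Qed.

Lemma stab2E a b s : a != b -> (s \in stab2 a b) =
  (s \in 'Alt_T) && ((s a == a) && (s b == b) || (s a == b) && (s b == a)).
Proof. by move=> ab; rewrite inE set2_eq. Qed.

Hypothesis card7 : #|T| = 7.

(** The alternating group is transitive on the 21 pairs, so a stabilizer has order 2520 / 21. *)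
Lemma card_stab2 a b : a != b -> #|stab2 a b| = 120.
Proof.
move=> ab; have := card_orbit_stab 'P^* 'Alt_T [set a; b].
have -> : #|'Alt_T| = (21 * 120)%N by apply/eqP; rewrite -(eqn_pmul2l (ltn0Sn 1)) card_Alt card7.
have -> : orbit 'P^* 'Alt_T [set a; b] = [set A : {set T} | #|A| == 2].
  apply/setP => A; rewrite inE; apply/imsetP/idP => [[s _ ->]|/cards2P[c [d [cd ->]]]].
    by rewrite /= /setact card_imset ?cards2 ?ab //; apply: act_inj.
  have [|||s As [sa sb]] := @Alt_mapP _ [tuple a; b] [tuple c; d].
  - by rewrite /= inE ab.
  - by rewrite /= inE cd.
  - by rewrite card7.
  by exists s; rewrite //= /setact imsetU !imset_set1 /= !apermE sa sb.
rewrite card_draws card7 (_ : binomial 7 2 = 21) // => /eqP; rewrite eqn_pmul2l // => /eqP <-.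
apply: eq_card => s; rewrite inE [RHS]inE; congr (_ && _).
rewrite astab1_set !inE /=.
apply/eqP/subsetP => [sE x xab|sE].
  by rewrite inE -sE; move: xab; rewrite !inE => /orP[]/eqP->; rewrite apermE eqxx ?orbT.
apply/eqP; rewrite eqEcard !cards2 ab (inj_eq perm_inj) ab leqnn andbT.
by apply/subsetP => x; rewrite !inE => /orP[]/eqP->; [have := sE a|have := sE b];
  rewrite !inE eqxx ?orbT => ->.
Qed.

(** Such a subgroup would have index 3 in a point stabilizer, a copy of the simple group A_6; but
    360 does not divide 3!. *)
Lemma Alt7_card120_nofix X b : X \subset 'Alt_T -> #|X| = 120 ->
  (forall s, s \in X -> s b = b) -> False.
Proof.
move=> sXA oX fixb; pose G := ('C_('Alt_T)[b | 'P])%G.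
have isoG : G \isog 'Alt_{y | y != b} := rfd_iso b.
have oT' : #|{: {y | y != b}}| = 6.
  rewrite card_sig -[6]/(7.-1) -card7 -(cardC1 b); apply: eq_card => y.
  by rewrite !inE.
have simG : simple G by rewrite (isog_simple isoG) simple_Alt5 ?oT'.
have oG : #|G| = 360.
  by apply/eqP; rewrite (card_isog isoG) -(eqn_pmul2l (ltn0Sn 1)) card_Alt oT'.
have sXG : X \subset G.
  by apply/subsetP => s Xs; rewrite inE (subsetP sXA) //=; apply/astab1P/fixb.
have := @simple_card_index_fact _ G X simG; rewrite properEcard sXG oX oG.
by rewrite -divgS // oX oG => /(_ isT).
Qed.

(** An element of order 5 has exactly two fixed points [a] and [b], their number being 7 modulo 5
    and less than 7, and it moves the other five points in one cycle. The [X]-orbit of these five is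
    not everything, as 7 does not divide 120, and it does not miss just one point, which [X] would
    then fix. So it misses both, and [X] preserves their pair. *)
Lemma Alt7_card120 X : X \subset 'Alt_T -> #|X| = 120 ->
  exists2 ab, ab.1 != ab.2 & X :=: stab2 ab.1 ab.2.
Proof.
move=> sXA oX.
have [||c Xc oc] := @Cauchy _ 5 X; rewrite ?oX //.
have c5 : 5.-group <[c]> by rewrite /pgroup -orderE oc.
have cT : [acts <[c]>, on [set: T] | 'P] by apply/actsP => ? ? ?; rewrite !inE.
have := pgroup_fix_mod c5 cT; rewrite cardsT card7 setTI.
set F := 'Fix_('P)(<[c]>) => F2.
have FP y : reflect (c y = y) (y \in F).
  by rewrite /F afix_cycle; exact: (@afix1P _ _ _ 'P c y).
have F7 : #|F| < 7.
  rewrite ltnNge; apply/negP => F7; suff c1 : c = 1 by rewrite c1 order1 in oc.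
  apply/permP => y; rewrite perm1; apply/FP.
  by have /eqP-> : F == setT by rewrite eqEcard subsetT cardsT card7.
have /eqP/cards2P[a [b [ab FE]]] : #|F| = 2.
  by move: F2 F7; case: #|F| => [|[|[|[|[|[|[|n]]]]]]].
exists (a, b) => //=.
have [x xF] : exists x, x \notin F.
  by apply/existsP; apply: contraTT F7; rewrite negb_exists => /forallP allF;
    rewrite -leqNgt -card7 -cardsT subset_leq_card //; apply/subsetP => y _;
    have := allF y; rewrite negbK.
have orbc : orbit 'P <[c]> x = ~: F.
  apply/eqP; rewrite eqEcard cardsCs setCK FE cards2 ab card7 -FE; apply/andP; split.
    apply/subsetP => _ /imsetP[s cs ->]; rewrite inE; apply: contra xF => /FP sF.
    apply/FP; apply: (@perm_inj _ s); rewrite -[RHS]sF -!permM.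
    by case/cycleP: cs => i ->; rewrite -expgS -expgSr.
  have : #|orbit 'P <[c]> x| %| 5 by rewrite -oc dvdn_orbit.
  have : #|orbit 'P <[c]> x| != 1%N.
    apply: contra xF => /eqP/card_orbit1 o1; apply/FP/eqP; rewrite -in_set1 -o1.
    exact: (@mem_orbit _ _ _ 'P _ x c (cycle_id c)).
  by rewrite dvdn_divisors // !inE => /negPf-> /= /eqP->.
pose O := orbit 'P X x.
have sFO : ~: F \subset O by rewrite -orbc imsetS // cycle_subG.
have OX y s : s \in X -> (s y \in O) = (y \in O) by move=> Xs; rewrite -[s y]/('P%act y s) orbit_actr.
have only u v : F = [set u; v] -> u \in O -> v \notin O -> False.
  move=> Fuv uO vO; apply: (@Alt7_card120_nofix X v) => // s Xs.
  apply/eqP; apply: contraNT vO => sv; rewrite -(OX v s Xs).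
  have [->//|su] := eqVneq (s v) u.
  by apply: (subsetP sFO); rewrite Fuv !inE negb_or su sv.
have aO : a \notin O.
  apply/negP => aO; case bO : (b \in O); last by apply: (only a b); rewrite ?bO.
  have : #|O| %| 120 by rewrite -oX dvdn_orbit.
  suff -> : O = setT by rewrite cardsT card7.
  apply/setP => y; rewrite inE; have [->//|ya] := eqVneq y a; have [->//|yb] := eqVneq y b.
  by apply: (subsetP sFO); rewrite FE !inE negb_or ya yb.
have bO : b \notin O by apply/negP => bO; apply: (only b a) => //; rewrite FE setUC.
have inF y : y \notin O -> y \in [set a; b].
  by rewrite -FE => yO; apply: contraNT yO => yF; rewrite (subsetP sFO) // inE.
apply/eqP; rewrite eqEcard card_stab2 // oX leqnn andbT.
apply/subsetP => s Xs; rewrite inE (subsetP sXA) //=.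
rewrite eqEcard !cards2 ab (inj_eq perm_inj) ab leqnn andbT.
by apply/subsetP => y /set2P[]->; apply: inF; rewrite OX.
Qed.

Lemma exists_notin (l : seq T) : size l < 7 -> exists p, p \notin l.
Proof.
move=> l7; have [p pl|all_l] := pickP (fun p => p \notin l); first by exists p.
move: l7; rewrite ltnNge -card7 (leq_trans _ (card_size l)) //.
by rewrite subset_leq_card //; apply/subsetP => p _; have := all_l p; case: (p \in l).
Qed.

Lemma star_stab2 p q a x y : p != q -> a != p -> a != q ->
  p \notin [:: x; y] -> q \notin [:: x; y] -> a \notin [:: x; y] ->
  tperm p a * tperm p q \in stab2 x y.
Proof.
move=> pq ap aq; rewrite ![_ \in [:: _; _]]inE ![_ \in [:: _]]inE !negb_or => /andP[px py] /andP[qx qy] /andP[ax ay].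
by rewrite inE Alt_even odd_permM !odd_tperm pq eq_sym ap /= !permM !tpermD ?eqxx.
Qed.

(** For [p] and [q] outside the three points, the star generator at [a] fixes [x] and [y] unless [a]
    is one of them; at [y] it fixes [x] and [w]. The case of [x] needs both stabilizers. *)
Lemma Alt7_gen_meet R x y w : uniq [:: x; y; w] ->
  stab2 x y \subset R -> stab2 x w \subset R -> 'Alt_T \subset R.
Proof.
rewrite /= !inE negb_or andbT => /andP[/andP[xy xw] yw] /subsetP Rxy /subsetP Rxw.
have [p] := @exists_notin [:: x; y; w] isT; rewrite !inE !negb_or => /and3P[px py pw].
have [q] := @exists_notin [:: x; y; w; p] isT; rewrite !inE !negb_or => /and4P[qx qy qw qp].
have [r] := @exists_notin [:: x; y; p; q] isT; rewrite !inE !negb_or => /and4P[rx ry rp rq].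
have [s] := @exists_notin [:: x; y; p; q; r] isT.
rewrite !inE !negb_or => /and5P[sx sy sp sq sr].
have pq : p != q by rewrite eq_sym.
have Ry : tperm p y * tperm p q \in R.
  by apply/Rxw/star_stab2; rewrite // 1?eq_sym // !inE !negb_or ?px ?qx ?pw ?qw ?yw ?(eq_sym y x) ?xy.
apply: (Alt_sub_star pq) => a ap aq.
have [->|ax] := eqVneq a x.
  (* Conjugation by this element, which swaps [x] and [y] and fixes [p] and [q], turns the star
     generator at [y] into the one at [x]; the factor [tperm r s] only restores the parity. *)
  have Ru : tperm x y * tperm r s \in R.
    apply: Rxy; rewrite inE Alt_even odd_permM !odd_tperm xy eq_sym sr !permM tpermL tpermR /=.
    by rewrite !tpermD // setUC eqxx.
  rewrite -(groupJr _ Ru) conjMg !tpermJ !permM.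
  by rewrite tpermL (tpermD (z := q)) 1?eq_sym // !tpermD // 1?eq_sym.
have [->//|ay] := eqVneq a y.
by apply/Rxy/star_stab2; rewrite // !inE negb_or ?px ?py ?qx ?qy ?ax ?ay.
Qed.

(** For [p] and [q] off both pairs, the star generator at [a] fixes pointwise a pair that does not
    contain [a]. *)
Lemma Alt7_gen_disjoint R x y z w : uniq [:: x; y; z; w] ->
  stab2 x y \subset R -> stab2 z w \subset R -> 'Alt_T \subset R.
Proof.
rewrite /= !inE !negb_or andbT => /and3P[/and3P[xy xz xw] /andP[yz yw] zw].
move=> /subsetP Rxy /subsetP Rzw.
have [p] := @exists_notin [:: x; y; z; w] isT; rewrite !inE !negb_or => /and4P[px py pz pw].
have [q] := @exists_notin [:: x; y; z; w; p] isT.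
rewrite !inE !negb_or => /and5P[qx qy qz qw qp].
have pq : p != q by rewrite eq_sym.
apply: (Alt_sub_star pq) => a ap aq.
case axy : (a \in [:: x; y]).
  by apply/Rzw/star_stab2 => //; rewrite ?inE ?negb_or ?pz ?qz //;
    move: axy; rewrite !inE => /orP[]/eqP->; rewrite ?negb_or ?xz ?xw ?yz ?yw.
by apply/Rxy/star_stab2; rewrite ?axy // !inE negb_or ?px ?py ?qx ?qy.
Qed.

Lemma stab2C x y : stab2 x y = stab2 y x.
Proof. by apply/setP => s; rewrite inE [RHS]inE (setUC [set s x]) (setUC [set x]). Qed.

Lemma Alt7_gen_stab2 R x y z w : x != y -> z != w -> [set x; y] != [set z; w] ->
  stab2 x y \subset R -> stab2 z w \subset R -> 'Alt_T \subset R.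
Proof.
move=> xy zw; rewrite eq_sym set2_eq // => zwxy Rxy Rzw.
have meet (u v t : T) : u != v -> t != u -> t != v -> stab2 u v \subset R ->
    stab2 u t \subset R -> 'Alt_T \subset R.
  move=> uv tu tv; apply: Alt7_gen_meet.
  by rewrite /= !inE negb_or uv /= ![_ == t]eq_sym tu tv.
have [zx|zx] := eqVneq z x; last have [zy|zy] := eqVneq z y.
- move: Rzw zw zwxy; rewrite zx eqxx (negPf xy) orbF eq_sym => Rxw wx wy.
  exact: (meet x y w).
- move: Rzw zw zwxy; rewrite zy eqxx eq_sym [y == x]eq_sym (negPf xy) /= => Ryw wy wx.
  by apply: (meet y x w) => //; [rewrite eq_sym|rewrite stab2C].
have [wx|wx] := eqVneq w x.
  by move: Rzw; rewrite wx stab2C; apply: (meet x y z).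
have [wy|wy] := eqVneq w y.
  by move: Rzw Rxy; rewrite wy stab2C [stab2 x y]stab2C => Ryz Ryx;
    apply: (meet y x z) => //; rewrite eq_sym.
apply: (@Alt7_gen_disjoint R x y z w) => //.
by rewrite /= !inE !negb_or xy zw ![x == _]eq_sym ![y == _]eq_sym zx zy wx wy.
Qed.
End Pairs.

End AlternatingGroups.

From mathcomp Require Import fraction mpoly ring.
From mathcomp Require Import boolp classical_sets functions cardinality.
From Stdlib Require Import Relation_Operators.
Require Import Defs.
Import GRing.Theory.

Local Open Scope classical_set_scope.
Local Open Scope card_scope.
Local Open Scope ring_scope.

Notation i0 := (@Ordinal 3 0 isT).
Notation i1 := (@Ordinal 3 1 isT).
Notation i2 := (@Ordinal 3 2 isT).

Lemma sum3 (V : nmodType) (f : 'I_3 -> V) : \sum_i f i = f i0 + f i1 + f i2.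
Proof.
rewrite !big_ord_recl big_ord0 addr0 addrA.
by congr (f _ + f _ + f _); apply: val_inj.
Qed.

Lemma I3P (P : 'I_3 -> Prop) : P i0 -> P i1 -> P i2 -> forall i, P i.
Proof.
move=> P0 P1 P2 [[|[|[|//]]] h].
- by have -> : Ordinal h = i0 by apply: val_inj.
- by have -> : Ordinal h = i1 by apply: val_inj.
- by have -> : Ordinal h = i2 by apply: val_inj.
Qed.

(** * Projective plane and unitary matrices *)

Section Plane.
Variable k : fieldType.
Implicit Types (p q : P2 k) (A B : 'M[k]_3) (v w : 'cV[k]_3).

Definition vec p : 'cV[k]_3 := val (generic_quotient.repr p).

Lemma vec_neq0 p : vec p != 0. Proof. exact: valP (generic_quotient.repr p). Qed.

Lemma vec_inj p q c : c != 0 -> vec p = c *: vec q -> p = q.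
Proof.
move=> c0 pq; rewrite -(point_repr p) -(point_repr q).
by apply/pointP; exists c.
Qed.

Lemma point_vec v : v != 0 -> exists p, exists2 c, c != 0 & vec p = c *: v.
Proof.
move=> v0; exists (point (exist _ v v0)).
exact: (repr_point (exist _ v v0)).
Qed.

(** Total on matrices: a singular matrix goes to the identity class, a default excluded by the
    [unitmx] premises of the lemmas. *)
Definition cl A : PGL3 k := mxclass (insubd (GL3_one k) A).

Lemma val_insubd_unit A : A \in unitmx -> val (insubd (GL3_one k) A) = A.
Proof. by move=> uA; rewrite val_insubd uA. Qed.

Lemma cl_eq A B : A \in unitmx -> B \in unitmx ->
  cl A = cl B <-> exists2 c, c != 0 & A = c *: B.
Proof. by move=> uA uB; rewrite mxclassP !val_insubd_unit. Qed.

Lemma clM A B : A \in unitmx -> B \in unitmx -> cl (A *m B) = (cl A * cl B)%g.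
Proof.
move=> uA uB; rewrite [RHS]PGL3_mulE; congr mxclass; apply: val_inj.
by rewrite val_insubd_unit ?unitmx_mul ?uA //= !val_insubd_unit.
Qed.

Lemma cl1 : cl 1%:M = 1%g.
Proof.
by congr mxclass; apply: val_inj; rewrite val_insubd_unit ?unitmx1.
Qed.

Lemma clV A : A \in unitmx -> cl (invmx A) = (cl A)^-1%g.
Proof.
move=> uA; apply: (@mulgI _ (cl A)).
by rewrite mulgV -clM ?unitmx_inv // mulmxV // cl1.
Qed.

Lemma cl_surj (g : PGL3 k) : exists2 A, A \in unitmx & g = cl A.
Proof.
exists (val (generic_quotient.repr g)); first exact: valP.
by rewrite /cl valKd mxclass_repr.
Qed.

Lemma vec_act A p : A \in unitmx ->
  exists2 c, c != 0 & vec (PGL3_act (cl A) p) = c *: (A *m vec p).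
Proof.
move=> uA; rewrite -{1}(point_repr p) PGL3_actE.
have [c c0] := repr_point (GL3_act (insubd (GL3_one k) A) (generic_quotient.repr p)).
by rewrite /= val_insubd_unit //; exists c.
Qed.

Lemma PGL3_actK g : cancel (@PGL3_act k g) (PGL3_act g^-1%g).
Proof. by move=> p; rewrite -PGL3_actM mulVg PGL3_act1. Qed.

Lemma PGL3_actKV g : cancel (@PGL3_act k g^-1%g) (PGL3_act g).
Proof. by move=> p; rewrite -PGL3_actM mulgV PGL3_act1. Qed.

Definition im (g : PGL3 k) (S : set (P2 k)) := PGL3_act g @` S.

Lemma in_im g S p : im g S p <-> S (PGL3_act g^-1%g p).
Proof.
split=> [[q Sq <-]|Sp]; first by rewrite PGL3_actK.
by exists (PGL3_act g^-1%g p); rewrite ?PGL3_actKV.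
Qed.

Lemma im1 S : im 1%g S = S.
Proof. by apply/seteqP; split => p; rewrite in_im invg1 PGL3_act1. Qed.

Lemma imM g h S : im (g * h)%g S = im g (im h S).
Proof. by apply/seteqP; split => p; rewrite !in_im invMg PGL3_actM. Qed.

Lemma imK g S : im g^-1%g (im g S) = S.
Proof. by rewrite -imM mulVg im1. Qed.

Lemma imKV g S : im g (im g^-1%g S) = S.
Proof. by rewrite -imM mulgV im1. Qed.

Lemma im_inj g S S' : im g S = im g S' -> S = S'.
Proof. by move=> e; rewrite -(imK g S) e imK. Qed.

Definition conic B : set (P2 k) := [set p | (vec p)^T *m B *m vec p = 0].

Lemma conicZ c B : c != 0 -> conic (c *: B) = conic B.
Proof.
move=> c0; apply/seteqP; split=> p; rewrite /conic /= -scalemxAr -scalemxAl.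
  by move/eqP; rewrite scaler_eq0 (negPf c0) => /eqP.
by move=> ->; rewrite scaler0.
Qed.

Lemma conic_vec B p v c : c != 0 -> vec p = c *: v ->
  conic B p <-> v^T *m B *m v = 0.
Proof.
move=> c0 pv; rewrite /conic /= pv [(_ *: v)^T]linearZ /= -!scalemxAl -scalemxAr scalerA.
split=> [/eqP|->]; last by rewrite scaler0.
by rewrite scaler_eq0 mulf_eq0 (negPf c0) => /eqP.
Qed.

Lemma im_conic A B : A \in unitmx ->
  im (cl A) (conic B) = conic ((invmx A)^T *m B *m invmx A).
Proof.
move=> uA; apply/seteqP; split=> p; rewrite in_im -clV //.
all: have [c c0 pE] := @vec_act (invmx A) p (etrans (unitmx_inv A) uA).
all: by rewrite (conic_vec _ c0 pE) /conic /= trmx_mul !mulmxA.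
Qed.

Lemma mx11_eq0 (M : 'M[k]_1) : M = 0 <-> M 0 0 = 0.
Proof.
split=> [->|M0]; first by rewrite mxE.
by apply/matrixP => i j; rewrite !ord1 M0 mxE.
Qed.

Definition mx3 (s : seq (seq k)) : 'M[k]_3 := \matrix_(i, j) (nth [::] s i)`_j.
Definition cv3 (x y z : k) : 'cV[k]_3 := \col_i [:: x; y; z]`_i.

Lemma cv3E v : v = cv3 (v i0 0) (v i1 0) (v i2 0).
Proof. by apply/matrixP => i j; rewrite ord1 !mxE; elim/I3P: i. Qed.

Lemma mx3E A : A = mx3 [:: [:: A i0 i0; A i0 i1; A i0 i2];
  [:: A i1 i0; A i1 i1; A i1 i2]; [:: A i2 i0; A i2 i1; A i2 i2]].
Proof. by apply/matrixP => i j; rewrite !mxE; elim/I3P: i; elim/I3P: j. Qed.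

Lemma form3E v B w : (v^T *m B *m w) 0 0 =
  (v i0 0 * B i0 i0 + v i1 0 * B i1 i0 + v i2 0 * B i2 i0) * w i0 0
 + (v i0 0 * B i0 i1 + v i1 0 * B i1 i1 + v i2 0 * B i2 i1) * w i1 0
 + (v i0 0 * B i0 i2 + v i1 0 * B i1 i2 + v i2 0 * B i2 i2) * w i2 0.
Proof. by rewrite mxE sum3 !mxE !sum3 !mxE. Qed.

Lemma cv3_eq0 x y z : (cv3 x y z == 0) = [&& x == 0, y == 0 & z == 0].
Proof.
apply/eqP/and3P => [/matrixP E|[/eqP-> /eqP-> /eqP->]].
  by have := E i0 0; have := E i1 0; have := E i2 0; rewrite !mxE /= => -> -> ->.
by apply/matrixP => i j; rewrite !mxE; elim/I3P: i.
Qed.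

End Plane.

(** * The Hermitian form of the sextic in characteristic 5 *)

Section Char5.
Variable k : closedFieldType.
Hypothesis hk : 5%N \in [pchar k].
Implicit Types (p q : P2 k) (A B : 'M[k]_3) (v w : 'cV[k]_3).

Local Notation F := (pFrobenius_aut hk).
Local Notation "A ^f" := (map_mx F A).

Lemma n5 : 5%:R = 0 :> k. Proof. exact: pcharf0. Qed.

Lemma natmod5 n : (n %% 5)%:R = n%:R :> k.
Proof. by rewrite [in RHS](divn_eq n 5) natrD natrM n5 mulr0 add0r. Qed.

Lemma natr_neq0 n : ~~ (5 %| n)%N -> n%:R != 0 :> k.
Proof. by rewrite -(dvdn_pcharf hk). Qed.

Lemma nth_root (a : k) n : (0 < n)%N -> exists x, x ^+ n = a.
Proof.
move=> n0; have [x xE] := solve_monicpoly (fun i => if i == 0 then a else 0) n0.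
exists x; rewrite xE; case: n n0 {xE} => // n _.
rewrite big_ord_recl /= expr0 mulr1 big1 ?addr0 // => i _.
by rewrite mul0r.
Qed.

Lemma cube_root_unity : exists w : k, w ^+ 2 + w + 1 = 0.
Proof.
have [w wE] := solve_monicpoly (fun=> -1 : k) (isT : (0 < 2)%N).
exists w; rewrite wE !big_ord_recl big_ord0 /= /bump /=; ring.
Qed.

Lemma FE x : F x = x ^+ 5. Proof. by rewrite pFrobenius_autE. Qed.

Lemma mxFM m n r (A : 'M[k]_(m, n)) (B : 'M_(n, r)) : (A *m B)^f = A^f *m B^f.
Proof. exact: map_mxM. Qed.
Lemma mxFT m n (A : 'M[k]_(m, n)) : (A^T)^f = A^f^T.
Proof. by rewrite map_trmx. Qed.
Lemma mxFZ m n c (A : 'M[k]_(m, n)) : (c *: A)^f = c ^+ 5 *: A^f.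
Proof. by rewrite map_mxZ /= pFrobenius_autE. Qed.
Lemma mxF1 n : (1%:M : 'M[k]_n)^f = 1%:M.
Proof. exact: map_mx1. Qed.

(** Linear in [v] and Frobenius-semilinear in [w]; on the diagonal it is the Fermat sextic, since x
    * x^5 = x^6. Hermitian symmetry holds on vectors over F_25, not on all of [k]. *)
Definition herm (v w : 'cV[k]_3) := v^T *m w^f.

Lemma fermat_herm v : (fermat6 k).@[fun i => v i 0] = (herm v v) 0 0.
Proof.
rewrite /fermat6 /herm mxE raddf_sum; apply: eq_bigr => i _ /=.
by rewrite rmorphXn /= mevalXU !mxE /= FE -exprS.
Qed.

Lemma GammaE p : Gamma k p <-> herm (vec p) (vec p) = 0.
Proof. by rewrite mx11_eq0 -fermat_herm. Qed.

Lemma hermZ c v d w : herm (c *: v) (d *: w) = (c * d ^+ 5) *: herm v w.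
Proof.
by rewrite /herm mxFZ [(_ *: v)^T]linearZ /= -scalemxAl -scalemxAr scalerA.
Qed.

Lemma Gamma_vec p v c : c != 0 -> vec p = c *: v -> Gamma k p <-> herm v v = 0.
Proof.
move=> c0 pv; rewrite GammaE pv hermZ; split=> [/eqP|->]; last by rewrite scaler0.
by rewrite scaler_eq0 mulf_eq0 expf_eq0 (negPf c0) => /eqP.
Qed.

(** The entries of such a matrix automatically lie in F_25, see [unitary_FF]. *)
Definition unitary A := A^T *m A^f = 1%:M.

Lemma unitary_unitmx A : unitary A -> A \in unitmx.
Proof. by case/mulmx1_unit; rewrite unitmx_tr. Qed.

Lemma unitary_inv A : unitary A -> invmx A = A^f^T.
Proof.
move=> uA; have/(congr1 trmx) := uA; rewrite trmx_mul trmxK trmx1 => AA.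
by rewrite -[LHS]mul1mx -AA mulmxK ?unitary_unitmx.
Qed.

Lemma unitaryV A : unitary A -> unitary (invmx A).
Proof.
move=> uA; rewrite /unitary {1}unitary_inv // trmxK -mxFM mulmxV ?mxF1 //.
exact: unitary_unitmx.
Qed.

Lemma unitary1 : unitary 1%:M. Proof. by rewrite /unitary trmx1 mxF1 mulmx1. Qed.

Lemma unitaryM A B : unitary A -> unitary B -> unitary (A *m B).
Proof.
rewrite /unitary => uA uB.
by rewrite trmx_mul mxFM !mulmxA -(mulmxA B^T) uA mulmx1.
Qed.

Lemma herm_unitary A v w : unitary A -> herm (A *m v) (A *m w) = herm v w.
Proof.
by move=> uA; rewrite /herm trmx_mul mxFM !mulmxA -(mulmxA v^T) uA mulmx1.
Qed.

Lemma unitary_aut A : unitary A -> aut_Gamma k (cl A).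
Proof.
have main B p : unitary B -> Gamma k (PGL3_act (cl B) p) <-> Gamma k p.
  move=> uB; have [c c0 pE] := vec_act p (unitary_unitmx uB).
  by rewrite (Gamma_vec c0 pE) herm_unitary // -GammaE.
move=> uA; apply/seteqP; split=> p; rewrite -/(im _ _) in_im.
  by rewrite -clV ?unitary_unitmx // main //; apply: unitaryV.
by rewrite -clV ?unitary_unitmx // main //; apply: unitaryV.
Qed.

(* Multiplying one coordinate of a point of the curve by sixth roots of unity
   separates the monomials of the pulled back sextic. *)
Lemma herm_form_scalar H : H \in unitmx ->
  (forall v, v != 0 -> herm v v = 0 -> v^T *m H *m v^f = 0) ->
  exists2 c, c != 0 & H = c%:M.
Proof.
move=> uH HE.
have G x y z : (x != 0) || (y != 0) -> x ^+ 6 + y ^+ 6 + z ^+ 6 = 0 ->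
   (x * H i0 i0 + y * H i1 i0 + z * H i2 i0) * x ^+ 5 +
   (x * H i0 i1 + y * H i1 i1 + z * H i2 i1) * y ^+ 5 +
   (x * H i0 i2 + y * H i1 i2 + z * H i2 i2) * z ^+ 5 = 0.
  move=> xy e; have v0 : cv3 x y z != 0.
    by rewrite cv3_eq0; move: xy; do 2 case: eqP.
  have hv : herm (cv3 x y z) (cv3 x y z) = 0.
    by apply/mx11_eq0; rewrite mxE sum3 !mxE /= !FE -e; ring.
  by have /mx11_eq0 := HE _ v0 hv; rewrite form3E !mxE !FE.
have [w w3] := cube_root_unity.
have two0 : (2 : k) != 0 by rewrite natr_neq0.
have three0 : (3 : k) != 0 by rewrite natr_neq0.
have wN1 : w ^+ 2 - w != 0.
  apply: contra_neq three0 => e.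
  have -> : 3 = (3 - 2 * w) * (w ^+ 2 + w + 1) + (2 * w + 1) * (w ^+ 2 - w) by ring.
  by rewrite w3 e !mulr0 addr0.
have w5 : w ^+ 5 = w ^+ 2.
  have -> : w ^+ 5 = (w ^+ 3 - w ^+ 2) * (w ^+ 2 + w + 1) + w ^+ 2 by ring.
  by rewrite w3 mulr0 add0r.
have w6 : w ^+ 6 = 1.
  have -> : w ^+ 6 = (w ^+ 4 - w ^+ 3 + w - 1) * (w ^+ 2 + w + 1) + 1 by ring.
  by rewrite w3 mulr0 add0r.
have sep x y : x ^+ 6 + y ^+ 6 != 0 ->
    [/\ x ^+ 6 * H i0 i0 + x * y ^+ 5 * H i0 i1 + y * x ^+ 5 * H i1 i0
       + y ^+ 6 * H i1 i1 - (x ^+ 6 + y ^+ 6) * H i2 i2 = 0,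
       x ^+ 5 * H i2 i0 + y ^+ 5 * H i2 i1 = 0 & x * H i0 i2 + y * H i1 i2 = 0].
  move=> xy; have xyn0 : (x != 0) || (y != 0).
    rewrite -negb_and; apply: contra xy => /andP[/eqP-> /eqP->].
    by rewrite !expr0n addr0.
  have [z zE] := nth_root (- (x ^+ 6 + y ^+ 6)) (isT : (0 < 6)%N).
  have z0 : z != 0.
    by apply: contra_neq xy => z0; apply: oppr_inj; rewrite -zE z0 expr0n oppr0.
  pose a := x ^+ 6 * H i0 i0 + x * y ^+ 5 * H i0 i1 + y * x ^+ 5 * H i1 i0
       + y ^+ 6 * H i1 i1 + z ^+ 6 * H i2 i2.
  pose b := x ^+ 5 * H i2 i0 + y ^+ 5 * H i2 i1.
  pose c := x * H i0 i2 + y * H i1 i2.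
  have g t : t ^+ 6 = z ^+ 6 -> a + t * b + t ^+ 5 * c = 0.
    move=> tE; rewrite -(G x y t xyn0) ?tE ?zE ?subrr // /a -tE /b /c; ring.
  have g1 := g z erefl.
  have g2 : a - z * b - z ^+ 5 * c = 0 by rewrite -(g (- z)); ring.
  have g3 : a + w * (z * b) + w ^+ 2 * (z ^+ 5 * c) = 0.
    by rewrite -(g (w * z)) ?exprMn ?w5 ?w6 ?mul1r //; ring.
  have a0 : a = 0.
    apply/eqP; rewrite -(mulrI_eq0 _ (mulfI two0)); apply/eqP.
    rewrite -[RHS]addr0 -{1}g1 -g2; ring.
  have bc : z * b + z ^+ 5 * c = 0 by rewrite -[RHS]g1 a0; ring.
  have bcw : w * (z * b) + w ^+ 2 * (z ^+ 5 * c) = 0 by rewrite -[RHS]g3 a0; ring.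
  have c0 : c = 0.
    apply/eqP; rewrite -(mulrI_eq0 _ (mulfI (expf_neq0 5 z0))).
    rewrite -(mulrI_eq0 _ (mulfI wN1)); apply/eqP.
    transitivity (w * (z * b) + w ^+ 2 * (z ^+ 5 * c) - w * (z * b + z ^+ 5 * c)).
      ring.
    by rewrite bc bcw mulr0 subr0.
  split=> //; first by rewrite -[RHS]a0 /a zE mulNr.
  apply/eqP; rewrite -(mulrI_eq0 _ (mulfI z0)).
  by move: bc; rewrite c0 mulr0 addr0 => ->.
(* The points (1, 0) and (0, 1) settle the diagonal and the last row and column; (1, 1) and (1, w)
   give two independent equations for the two remaining entries. *)
have [] := sep 1 0; first by rewrite expr1n expr0n addr0 oner_neq0.
have [] := sep 0 1; first by rewrite expr1n expr0n add0r oner_neq0.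
rewrite !(expr1n, expr0n, mul0r, mul1r, mulr0, add0r, addr0) /=.
move=> h11 h21 h12 h00 h20 h02.
have [] := sep 1 1; first by rewrite expr1n.
have [] := sep 1 w; first by rewrite expr1n w6.
rewrite w5 w6 !expr1n h21 h12 h20 h02 => ew _ _ e1 _ _.
have {}h00 : H i0 i0 = H i2 i2 by apply/eqP; rewrite -subr_eq0 h00.
have {}h11 : H i1 i1 = H i2 i2 by apply/eqP; rewrite -subr_eq0 h11.
have s1 : H i0 i1 + H i1 i0 = 0 by rewrite -e1 h00 h11; ring.
have sw : w ^+ 2 * H i0 i1 + w * H i1 i0 = 0 by rewrite -ew h00 h11; ring.
have h01 : H i0 i1 = 0.
  apply/eqP; rewrite -(mulrI_eq0 _ (mulfI wN1)); apply/eqP.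
  transitivity (w ^+ 2 * H i0 i1 + w * H i1 i0 - w * (H i0 i1 + H i1 i0)); first ring.
  by rewrite s1 sw mulr0 subr0.
have h10 : H i1 i0 = 0 by rewrite -s1 h01 add0r.
have HE2 : H = (H i2 i2)%:M.
  rewrite {1}[H]mx3E; apply/matrixP; elim/I3P; elim/I3P; rewrite !mxE /=;
  by rewrite ?mulr1n ?mulr0n ?h00 ?h11 ?h01 ?h10 ?h02 ?h20 ?h12 ?h21.
exists (H i2 i2) => //; apply: contraTneq uH => h0.
by rewrite HE2 h0 -scalemx1 scale0r unitmxE det0 unitr0.
Qed.

(** The form [A^T *m A^f] vanishes on the curve, hence is a scalar matrix; a sixth root normalizes
    it, because replacing [A] by [m *: A] multiplies it by [m ^+ 6]. *)
Lemma aut_unitary g : aut_Gamma k g -> exists2 A, unitary A & g = cl A.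
Proof.
have [A uA ->] := cl_surj g => gG.
have GA p : Gamma k p -> Gamma k (PGL3_act (cl A) p).
  by move=> Gp; rewrite -gG; exists p.
have [|v v0 hv|c c0 AE] := @herm_form_scalar (A^T *m A^f).
- by rewrite unitmx_mul unitmx_tr uA map_unitmx.
- have [p [d d0 pE]] := point_vec v0.
  have [e e0 gpE] := vec_act p uA.
  have /GA : Gamma k p by apply/(Gamma_vec d0 pE).
  rewrite (Gamma_vec e0 gpE) pE -scalemxAr hermZ => /eqP.
  rewrite scaler_eq0 mulf_eq0 expf_eq0 (negPf d0) /= => /eqP.
  by rewrite /herm trmx_mul mxFM !mulmxA.
have [m mE] := nth_root c^-1 (isT : (0 < 6)%N).
have m0 : m != 0.
  by apply: contraTneq c0 => m0; rewrite negbK -invr_eq0 -mE m0 expr0n.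
exists (m *: A); last first.
  apply/cl_eq; rewrite ?unitmxZ ?unitfE //.
  by exists m^-1; rewrite ?invr_eq0 // scalerA mulVf // scale1r.
rewrite /unitary mxFZ [(_ *: A)^T]linearZ /= -scalemxAl -scalemxAr AE scalerA.
by rewrite -exprS mE -[c%:M]scalemx1 scalerA mulVf // scale1r.
Qed.

End Char5.

(** * Homogeneous polynomials and quadratic forms *)

Lemma dhomog_ind (R : comNzRingType) n (P : nat -> {mpoly R[n]} -> Prop) :
  P 0%N 1 -> (forall d, P d 0) -> (forall d a b, P d a -> P d b -> P d (a + b)) ->
  (forall d c a, P d a -> P d (c *: a)) ->
  (forall d i a, P d a -> P d.+1 ('X_i * a)) ->
  forall d a, a \is d.-homog -> P d a.
Proof.
move=> P1 P0 PD PZ PX d a /dhomogP ha.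
rewrite [a]mpolyE big_seq; elim/big_ind: _ => // [x y|m /ha <-]; first exact: PD.
apply: PZ; suff PX_e e m' : mdeg m' = e -> P e 'X_[m'] by exact: PX_e.
elim: e m' {m d ha} => [|e IH] m me.
  by move/eqP: me; rewrite mdeg_eq0 => /eqP->; rewrite mpolyX0.
have [i mi] : exists i, m i != 0%N.
  apply/existsP; apply: contra_eqT me; rewrite negb_exists => /forallP m0.
  by rewrite mdegE big1 // => i _; have := m0 i; rewrite negbK => /eqP.
have mE : m = (U_(i) + (m - U_(i)))%MM.
  by rewrite addmC submK //; apply/mnm_lepP => j; rewrite mnm1E; case: eqP => [<-|]; rewrite // lt0n.
have me' : mdeg (m - U_(i))%MM = e.
  by move: me; rewrite {1}mE mdegD mdeg1 => -[].
by rewrite mE mpolyXD; apply/PX/IH.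
Qed.

Section Homogeneous.
Variable k : fieldType.
Local Notation poly3 := {mpoly k[3]}.

Lemma dhomog_meval_scale d (a : poly3) (c : k) (v : 'I_3 -> k) :
  a \is d.-homog -> a.@[fun i => c * v i] = c ^+ d * a.@[v].
Proof.
move=> ha; elim/dhomog_ind: ha => [|d'|d' x y IHx IHy|d' e x IHx|d' i x IHx].
- by rewrite !meval1 mulr1.
- by rewrite !meval0 mulr0.
- by rewrite !mevalD IHx IHy mulrDr.
- by rewrite !mevalZ IHx mulrCA.
- by rewrite !mevalM !mevalXU IHx exprS; ring.
Qed.

Definition qpoly (B : 'M[k]_3) : poly3 := \sum_i \sum_j B i j *: ('X_i * 'X_j).

Lemma qpolyD A B : qpoly (A + B) = qpoly A + qpoly B.
Proof.
rewrite /qpoly -big_split; apply: eq_bigr => i _.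
by rewrite -big_split; apply: eq_bigr => j _; rewrite mxE scalerDl.
Qed.

Lemma qpolyZ c B : qpoly (c *: B) = c *: qpoly B.
Proof.
rewrite /qpoly scaler_sumr; apply: eq_bigr => i _.
by rewrite scaler_sumr; apply: eq_bigr => j _; rewrite mxE scalerA.
Qed.

Lemma qpolyT B : qpoly B^T = qpoly B.
Proof.
rewrite /qpoly exchange_big; apply: eq_bigr => i _; apply: eq_bigr => j _.
by rewrite mxE mulrC.
Qed.

(** The induction climbs through degrees 0 and 1, so the predicate describes all three degrees at
    once. Symmetrizing the matrix uses that 2 is invertible. *)
Lemma dhomog2_qpoly (q : poly3) : 2%:R != 0 :> k -> q \is 2.-homog ->
  exists2 B, B^T = B & q = qpoly B.
Proof.
move=> two0 hq.
pose P (d : nat) a := [/\ d = 0%N -> exists c, a = c%:MP,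
  d = 1%N -> exists l : 'I_3 -> k, a = \sum_i l i *: 'X_i &
  d = 2%N -> exists B : 'M[k]_3, a = qpoly B].
suff [_ _ /(_ erefl)[B ->]] : P 2%N q.
  exists (2^-1 *: (B + B^T)); first by rewrite linearZ linearD /= trmxK addrC.
  by rewrite qpolyZ qpolyD qpolyT -mulr2n -scaler_nat scalerA mulVf // scale1r.
apply: (@dhomog_ind _ _ P _ _ _ _ _ _ _ hq) => [|d|d x y [x0 x1 x2] [y0 y1 y2]|d c x [x0 x1 x2]|d i x [x0 x1 x2]].
- by split=> // _; exists 1; rewrite mpolyC1.
- split=> _; first by exists 0; rewrite mpolyC0.
    by exists (fun=> 0); rewrite big1 // => i _; rewrite scale0r.
  by exists 0; rewrite /qpoly big1 // => i _; rewrite big1 // => j _; rewrite mxE scale0r.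
- split=> dE.
  + have [[c ->] [c' ->]] := (x0 dE, y0 dE); exists (c + c'); by rewrite mpolyCD.
  + have [[l ->] [l' ->]] := (x1 dE, y1 dE); exists (fun i => l i + l' i).
    by rewrite -big_split; apply: eq_bigr => i _; rewrite scalerDl.
  + have [[B ->] [B' ->]] := (x2 dE, y2 dE); exists (B + B'); by rewrite qpolyD.
- split=> dE.
  + by have [e ->] := x0 dE; exists (c * e); rewrite mpolyCM mul_mpolyC.
  + have [l ->] := x1 dE; exists (fun i => c * l i).
    by rewrite scaler_sumr; apply: eq_bigr => i _; rewrite scalerA.
  + have [B ->] := x2 dE; exists (c *: B); by rewrite qpolyZ.
- split=> // -[dE].
  + have [c ->] := x0 dE; exists (fun j => if j == i then c else 0).
    rewrite (bigD1 i) //= eqxx big1 ?addr0 => [|j /negPf ->]; last by rewrite scale0r.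
    by rewrite mulrC mul_mpolyC.
  + have [l ->] := x1 dE; exists (\matrix_(u, v) if u == i then l v else 0).
    rewrite /qpoly [RHS](bigD1 i) //= [X in _ = _ + X]big1 ?addr0 => [|j /negPf ji].
      rewrite big_distrr /=; apply: eq_bigr => j _; rewrite mxE eqxx.
      by rewrite -scalerAr.
    by rewrite big1 // => v _; rewrite mxE ji scale0r.
Qed.

Lemma dhomog1_linear (l : poly3) : l \is 1.-homog ->
  exists c : 'I_3 -> k, l = \sum_i c i *: 'X_i.
Proof.
move=> hl.
pose P (d : nat) a := (d = 0%N -> exists c, a = c%:MP) /\
  (d = 1%N -> exists l : 'I_3 -> k, a = \sum_i l i *: 'X_i :> poly3).
suff [_] : P 1%N l by apply.
apply: (@dhomog_ind _ _ P _ _ _ _ _ _ _ hl) => [|d|d x y [x0 x1] [y0 y1]|d c x [x0 x1]|d i x [x0 x1]].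
- by split=> // _; exists 1; rewrite mpolyC1.
- split=> _; first by exists 0; rewrite mpolyC0.
  by exists (fun=> 0); rewrite big1 // => i _; rewrite scale0r.
- split=> dE.
  + have [[c ->] [c' ->]] := (x0 dE, y0 dE); exists (c + c'); by rewrite mpolyCD.
  + have [[c ->] [c' ->]] := (x1 dE, y1 dE); exists (fun i => c i + c' i).
    by rewrite -big_split; apply: eq_bigr => i _; rewrite scalerDl.
- split=> dE.
  + by have [e ->] := x0 dE; exists (c * e); rewrite mpolyCM mul_mpolyC.
  + have [e ->] := x1 dE; exists (fun i => c * e i).
    by rewrite scaler_sumr; apply: eq_bigr => i _; rewrite scalerA.
- split=> // -[dE].
  have [c ->] := x0 dE; exists (fun j => if j == i then c else 0).
  rewrite (bigD1 i) //= eqxx big1 ?addr0 => [|j /negPf ->]; last by rewrite scale0r.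
  by rewrite mulrC mul_mpolyC.
Qed.

Lemma dhomogXU i : ('X_i : poly3) \is 1.-homog.
Proof. by rewrite dhomogX /= mdeg1. Qed.

Lemma qpoly_homog B : qpoly B \is 2.-homog.
Proof.
apply: rpred_sum => i _; apply: rpred_sum => j _; apply: rpredZ.
exact: (@dhomogM _ _ _ 1%N _ 1%N _ (dhomogXU i) (dhomogXU j)).
Qed.

Lemma qpoly_eval B (v : 'cV[k]_3) : (qpoly B).@[fun i => v i 0] = (v^T *m B *m v) 0 0.
Proof.
rewrite form3E /qpoly !sum3 !(mevalD, mevalZ, mevalM, mevalXU); ring.
Qed.

Lemma qpoly_deriv B i (v : 'cV[k]_3) : B^T = B ->
  (mderiv i (qpoly B)).@[fun i => v i 0] = 2 * (B *m v) i 0.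
Proof.
move=> /matrixP BT; have B10 := BT i0 i1; have B20 := BT i0 i2; have B21 := BT i1 i2.
rewrite !mxE in B10 B20 B21.
have UU (j : 'I_3) : 'X_[(U_(j) - U_(j))%MM] = 1 :> poly3.
  by rewrite -mpolyX0; congr ('X_[_]); apply/mnmP => l; rewrite mnmBE subnn mnm0E.
rewrite /qpoly !sum3 !(mderivD, mderivZ, mderivM, mderivX) /=.
rewrite !mxE sum3.
rewrite !(mevalD, mevalZ, mevalM, mevalXU) !mnm1E; elim/I3P: i => /=.
all: by rewrite ?UU !meval1 ?B10 ?B20 ?B21; ring.
Qed.

Lemma zeros_qpoly B : zeros (qpoly B) = conic B.
Proof.
apply/seteqP; split=> p; rewrite /zeros /vanishes /conic /= mx11_eq0 -qpoly_eval //.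
Qed.

End Homogeneous.

Lemma sum3_uniq (V : nmodType) (f : 'I_3 -> V) (a j l : 'I_3) :
  uniq [:: a; j; l] -> \sum_i f i = f a + f j + f l.
Proof.
rewrite sum3; elim/I3P: a; elim/I3P: j; elim/I3P: l => //= _.
- by rewrite addrAC.
- by rewrite [f i1 + _]addrC.
- by rewrite [RHS]addrC addrA.
- by rewrite addrC addrA.
- by rewrite addrC [f i0 + _]addrC addrA.
Qed.

(** * Tangency from intersection multiplicity *)

Section LocalRing.
Variable k : fieldType.
Local Notation poly3 := {mpoly k[3]}.
(* Stated for an abstract field [K] containing the polynomial ring: unification
   in the concrete fraction field is prohibitively slow. *)
Variables (K : fieldType) (t : {rmorphism poly3 -> K}).
Hypothesis t_inj : injective t.
Local Notation "x %:F" := (t x).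
Implicit Types (p : P2 k) (u v : K).

Definition lring p : set K :=
  [set u | exists (d : nat) (a b : poly3),
     [/\ a \is d.-homog, b \is d.-homog, ~ vanishes b p & u = a%:F / b%:F]].
Definition leqn (f : poly3) p : set K :=
  [set u | exists (d : nat) (b : poly3),
     [/\ f \is d.-homog, b \is d.-homog, ~ vanishes b p & u = f%:F / b%:F]].
Definition lideal (f g : poly3) p : set K :=
  [set u | exists r s x y : K,
     [/\ lring p r, lring p s, leqn f p x, leqn g p y & u = r * x + s * y]].

(** The residue of a germ at [p], kept as a relation: it suffices that values exist and are
    compatible with sums, products and inverses, so no choice of fraction has to be shown
    irrelevant. *)
Definition value p u (c : k) : Prop := exists (d : nat) (a b : poly3),
  [/\ a \is d.-homog, b \is d.-homog, b.@[fun i => vec p i 0] != 0,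
      u = a%:F / b%:F & a.@[fun i => vec p i 0] = c * b.@[fun i => vec p i 0]].

Lemma local_ring_value p u : lring p u <-> exists c, value p u c.
Proof.
split=> [[d [a [b [ha hb /eqP b0 ->]]]]|[c [d [a [b [ha hb /eqP b0 -> _]]]]]].
  exists (a.@[fun i => vec p i 0] / b.@[fun i => vec p i 0]), d, a, b.
  by split=> //; rewrite mulfVK.
by exists d, a, b.
Qed.

Lemma meval_neq0 p (b : poly3) : b.@[fun i => vec p i 0] != 0 -> b%:F != 0.
Proof. apply: contra_neq => /eqP; rewrite -(rmorph0 t) (inj_eq t_inj) => /eqP->.
by rewrite meval0. Qed.

Lemma valueD p u v c e : value p u c -> value p v e -> value p (u + v) (c + e).
Proof.
move=> [d [a [b [ha hb b0 -> av]]]] [d' [a' [b' [ha' hb' b0' -> av']]]].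
exists (d + d')%N, (a * b' + a' * b), (b * b'); split.
- by rewrite rpredD // 1?[a' * b]mulrC dhomogM.
- exact: dhomogM.
- by rewrite mevalM mulf_neq0.
- by rewrite addf_div ?(meval_neq0 b0) ?(meval_neq0 b0') // -!rmorphM -rmorphD.
- by rewrite mevalD !mevalM av av'; ring.
Qed.

Lemma valueM p u v c e : value p u c -> value p v e -> value p (u * v) (c * e).
Proof.
move=> [d [a [b [ha hb b0 -> av]]]] [d' [a' [b' [ha' hb' b0' -> av']]]].
exists (d + d')%N, (a * a'), (b * b'); split; rewrite ?dhomogM //.
- by rewrite mevalM mulf_neq0.
- by rewrite mulf_div -!rmorphM.
- by rewrite !mevalM av av'; ring.
Qed.

Lemma valueC p c : value p (c%:MP%:F) c.
Proof.
exists 0%N, c%:MP, 1; split; rewrite ?dhomog1 ?meval1 ?oner_neq0 //.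
- by rewrite -[c%:MP]mulr1 mul_mpolyC rpredZ // dhomog1.
- by rewrite rmorph1 divr1.
- by rewrite mevalC mulr1.
Qed.

Lemma valueV p u c : c != 0 -> value p u c -> value p u^-1 c^-1.
Proof.
move=> c0 [d [a [b [ha hb b0 -> av]]]]; exists d, b, a; split=> //.
- by rewrite av mulf_neq0.
- by rewrite invf_div.
- by rewrite av mulKf.
Qed.

Lemma value_quot p d (a b : poly3) : a \is d.-homog -> b \is d.-homog ->
  b.@[fun i => vec p i 0] != 0 ->
  value p (a%:F / b%:F) (a.@[fun i => vec p i 0] / b.@[fun i => vec p i 0]).
Proof. by move=> ha hb b0; exists d, a, b; split=> //; rewrite mulfVK. Qed.

Section Ideal.
Variables (p : P2 k) (f g : poly3).
Local Notation O := (lring p).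
Local Notation I := (lideal f g p).

Lemma local_ringD u v : O u -> O v -> O (u + v).
Proof.
by rewrite !local_ring_value => -[c uc] [e ve]; exists (c + e); apply: valueD.
Qed.
Lemma local_ringM u v : O u -> O v -> O (u * v).
Proof.
by rewrite !local_ring_value => -[c uc] [e ve]; exists (c * e); apply: valueM.
Qed.
Lemma local_ringC c : O c%:MP%:F.
Proof. by rewrite local_ring_value; exists c; apply: valueC. Qed.

Lemma local_idealM r u : O r -> I u -> I (r * u).
Proof.
move=> Or [a [b [x [y [Oa Ob fx gy ->]]]]].
exists (r * a), (r * b), x, y; split=> //; try exact: local_ringM.
by rewrite mulrDr !mulrA.
Qed.

(** A curve has one local equation for each denominator. They differ by quotients of denominators,
    so two elements of the ideal can be written with the same [x] and [y]. The zero form is treated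
    apart because its degree is not determined. *)
Lemma local_eqn_unit (h : poly3) x x' : leqn h p x -> leqn h p x' ->
  exists2 r, O r & x' = r * x.
Proof.
move=> [d [b [hf hb /eqP b0 ->]]] [d' [b' [hf' hb' /eqP b0' ->]]].
have [->|h0] := eqVneq h 0.
  exists 0; last by rewrite rmorph0 !mul0r.
  by rewrite -(rmorph0 t) -mpolyC0; apply: local_ringC.
have dd' := dhomog_uniq h0 hf hf'; subst d'.
exists (b%:F / b'%:F); first by exists d, b, b'; split=> //; apply/eqP.
by rewrite [RHS]mulrC mulrA mulfVK ?(meval_neq0 b0).
Qed.

Lemma local_idealD u v : I u -> I v -> I (u + v).
Proof.
move=> [a [b [x [y [Oa Ob fx gy ->]]]]] [a' [b' [x' [y' [Oa' Ob' fx' gy' ->]]]]].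
have [r Or ->] := local_eqn_unit fx fx'; have [s Os ->] := local_eqn_unit gy gy'.
exists (a + a' * r), (b + b' * s), x, y; split=> //.
- by apply: local_ringD => //; apply: local_ringM.
- by apply: local_ringD => //; apply: local_ringM.
- ring.
Qed.
End Ideal.

Section Transversal.
Variables (hk : 5%N \in [pchar k]) (p : P2 k) (B : 'M[k]_3).
Hypotheses (qp : conic B p) (gp : (fermat6 k).@[fun i => vec p i 0] = 0).
Variables (a j l : 'I_3).
Hypotheses (ajl : uniq [:: a; j; l]) (pa : vec p a 0 != 0).

Local Notation v := (fun i => vec p i 0).
Local Notation I := (lideal (qpoly B) (fermat6 k) p).
(** In the affine chart where the coordinate [a] is nonzero, [x i] are the coordinate functions,
    [c i] their values at [p], [y i] the local coordinates vanishing at [p], and [beta i] is half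
    the gradient of the conic. *)
Let c i := vec p i 0 / vec p a 0.
Let cst (e : k) : K := e%:MP%:F.
Let x i : K := ('X_i)%:F / ('X_a)%:F.
Let y i := x i - cst (c i).
Let beta i := (B *m vec p) i 0 / vec p a 0.

Let sumE (V : nmodType) (f : 'I_3 -> V) : \sum_i f i = f a + f j + f l.
Proof. exact: sum3_uniq. Qed.

Lemma all_ajl (P : 'I_3 -> Prop) : P a -> P j -> P l -> forall i, P i.
Proof.
move=> Pa Pj Pl i.
have : \sum_(z : 'I_3) (z == i : nat) = 1%N by rewrite (bigD1 i) //= eqxx big1 // => z /negPf->.
by rewrite sumE; case: eqP => [<-//|_]; case: eqP => [<-//|_]; case: eqP => [<-|].
Qed.

Let Xa0 : ('X_a)%:F != 0 :> K.
Proof. by apply: (@meval_neq0 p); rewrite mevalXU. Qed.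

Let value_x i : value p (x i) (c i).
Proof.
have := @value_quot p 1 'X_i 'X_a (dhomogXU k i) (dhomogXU k a).
by rewrite !mevalXU; apply.
Qed.

Let value_y i : value p (y i) 0.
Proof.
rewrite -[0](subrr (c i)); apply: valueD => //.
by rewrite -rmorphN -mpolyCN; apply: valueC.
Qed.

Let ya : y a = 0.
Proof. by rewrite /y /x /c /cst !divff // mpolyC1 rmorph1 subrr. Qed.

Let eqn_q : leqn (qpoly B) p ((qpoly B)%:F / ('X_a ^+ 2)%:F).
Proof.
exists 2%N, ('X_a ^+ 2); split=> //; first exact: qpoly_homog.
- exact: (dhomogMn 2 (dhomogXU k a)).
- by rewrite /vanishes rmorphXn /= mevalXU; apply/eqP; rewrite expf_neq0.
Qed.

Lemma fermat6_homog : fermat6 k \is 6.-homog.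
Proof. by apply: rpred_sum => i _; exact: (dhomogMn 6 (dhomogXU k i)). Qed.

Let eqn_g : leqn (fermat6 k) p ((fermat6 k)%:F / ('X_a ^+ 6)%:F).
Proof.
exists 6%N, ('X_a ^+ 6); split=> //; first exact: fermat6_homog.
- exact: (dhomogMn 6 (dhomogXU k a)).
- by rewrite /vanishes rmorphXn /= mevalXU; apply/eqP; rewrite expf_neq0.
Qed.

Let O0 : lring p 0. Proof. by rewrite -(rmorph0 t) -mpolyC0; apply: local_ringC. Qed.
Let O1 : lring p 1. Proof. by rewrite -(rmorph1 t) -mpolyC1; apply: local_ringC. Qed.

Let I_q : I ((qpoly B)%:F / ('X_a ^+ 2)%:F).
Proof.
exists 1, 0, ((qpoly B)%:F / ('X_a ^+ 2)%:F), ((fermat6 k)%:F / ('X_a ^+ 6)%:F).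
by split=> //; rewrite mul1r mul0r addr0.
Qed.
Let I_g : I ((fermat6 k)%:F / ('X_a ^+ 6)%:F).
Proof.
exists 0, 1, ((qpoly B)%:F / ('X_a ^+ 2)%:F), ((fermat6 k)%:F / ('X_a ^+ 6)%:F).
by split=> //; rewrite mul1r mul0r add0r.
Qed.
Let I0 : I 0.
Proof. by rewrite -(mul0r ((qpoly B)%:F / ('X_a ^+ 2)%:F)); apply: local_idealM. Qed.

Let cstZ e (q : poly3) : (e *: q)%:F = cst e * q%:F.
Proof. by rewrite -mul_mpolyC rmorphM. Qed.

Let n5K : 5%:R = 0 :> K.
Proof. by rewrite -(rmorph_nat t) -(rmorph_nat (@mpolyC 3 k)) /= (pcharf0 hk) mpolyC0 rmorph0. Qed.

Let pow5 (r s : K) : (r + s) ^+ 5 = r ^+ 5 + s ^+ 5.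
Proof.
have -> : (r + s) ^+ 5 = r ^+ 5 + s ^+ 5 +
  5%:R * (r ^+ 4 * s + 2 * r ^+ 3 * s ^+ 2 + 2 * r ^+ 2 * s ^+ 3 + r * s ^+ 4) by ring.
by rewrite n5K mul0r addr0.
Qed.

Let cstD e e' : cst (e + e') = cst e + cst e'.
Proof. by rewrite /cst mpolyCD rmorphD. Qed.
Let cstM e e' : cst (e * e') = cst e * cst e'.
Proof. by rewrite /cst mpolyCM rmorphM. Qed.
Let cstX e n : cst (e ^+ n) = cst e ^+ n.
Proof. by rewrite /cst !rmorphXn. Qed.
Let cst0 : cst 0 = 0. Proof. by rewrite /cst mpolyC0 rmorph0. Qed.

Let xE i : x i = cst (c i) + y i. Proof. by rewrite /y addrC subrK. Qed.

Hypothesis BT : B^T = B.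

(** Cofactors of the [y i] in the expansions of the two equations around [p]. Their values at [p]
    are the gradients [2 * beta i] and [c i ^+ 5]: since the fifth power is additive, (c + y)^6 = (c
    + y) (c^5 + y^5) has linear term c^5 y. *)
Let m1 i : K := cst 2%:R * cst (beta i) + \sum_h cst (B i h) * y h.
Let m2 i : K := cst (c i ^+ 5) + cst (c i) * y i ^+ 4 + y i ^+ 5.

Let formc : \sum_i \sum_h cst (B i h) * (cst (c i) * cst (c h)) = 0.
Proof.
rewrite -[RHS]cst0; transitivity (cst (\sum_i \sum_h B i h * (c i * c h))).
  by rewrite !sum3 !(cstD, cstM).
congr cst; move: qp; rewrite /conic /= mx11_eq0 form3E /c !sum3 => qpE.
rewrite -[RHS](mul0r (vec p a 0 ^- 2)) -qpE; field.
exact: pa.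
Qed.

Let quadric_y : (qpoly B)%:F / ('X_a ^+ 2)%:F = \sum_i m1 i * y i.
Proof.
have -> : (qpoly B)%:F / ('X_a ^+ 2)%:F = \sum_i \sum_h cst (B i h) * (x i * x h).
  rewrite rmorphXn /= /qpoly raddf_sum mulr_suml; apply: eq_bigr => i _ /=.
  rewrite raddf_sum mulr_suml; apply: eq_bigr => h _ /=.
  by rewrite cstZ rmorphM /x mulf_div -mulrA expr2.
have betaE i : cst (beta i) = \sum_h cst (B i h) * cst (c h).
  rewrite /beta mxE !sum3 -!cstM -!cstD /c; congr cst; field; exact: pa.
apply/eqP; rewrite -subr_eq0 -[X in _ == X]formc; apply/eqP; rewrite /m1 !sum3 !betaE !sum3 !xE.
have B10 : B i1 i0 = B i0 i1 by rewrite -{1}BT mxE.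
have B20 : B i2 i0 = B i0 i2 by rewrite -{1}BT mxE.
have B21 : B i2 i1 = B i1 i2 by rewrite -{1}BT mxE.
have -> : cst 2%:R = 2 by rewrite /cst !rmorph_nat.
rewrite B10 B20 B21; ring.
Qed.

Let sextic_y : (fermat6 k)%:F / ('X_a ^+ 6)%:F = \sum_i m2 i * y i.
Proof.
have -> : (fermat6 k)%:F / ('X_a ^+ 6)%:F = \sum_i x i * (cst (c i) + y i) ^+ 5.
  rewrite rmorphXn /= /fermat6 raddf_sum mulr_suml; apply: eq_bigr => i _ /=.
  by rewrite -xE -exprS rmorphXn /x expr_div_n.
have formc6 : \sum_i cst (c i) * cst (c i) ^+ 5 = 0.
  rewrite -[RHS]cst0; transitivity (cst (\sum_i c i ^+ 6)).
    by rewrite !sum3 !(cstD, cstX); ring.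
  congr cst; move: gp; rewrite /fermat6 raddf_sum /= => gpE.
  transitivity ((\sum_i vec p i 0 ^+ 6) / vec p a 0 ^+ 6).
    by rewrite mulr_suml; apply: eq_bigr => i _; rewrite expr_div_n.
  rewrite (_ : \sum_i _ = 0) ?mul0r // -[RHS]gpE; apply: eq_bigr => i _.
  by rewrite rmorphXn /= mevalXU.
apply/eqP; rewrite -subr_eq0 -[X in _ == X]formc6; apply/eqP; rewrite !sum3 /m2 !cstX !(pow5 (cst (c _)) (y _)) !xE; ring.
Qed.

Let value_sum (f : 'I_3 -> K) (e : 'I_3 -> k) :
  (forall i, value p (f i) (e i)) -> value p (\sum_i f i) (\sum_i e i).
Proof. by move=> fe; rewrite !sum3; do 2 apply: valueD => //. Qed.

Let valueX u e n : value p u e -> value p (u ^+ n) (e ^+ n).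
Proof.
move=> ue; elim: n => [|n IH]; last by rewrite !exprS; apply: valueM.
by rewrite !expr0 -(rmorph1 t) -mpolyC1; apply: valueC.
Qed.

Let value_m1 i : value p (m1 i) (2%:R * beta i).
Proof.
rewrite -[_ * beta i]addr0 /m1; apply: valueD.
  by apply: valueM; apply: valueC.
have -> : 0 = \sum_(h < 3) B i h * 0 by rewrite big1 // => h _; rewrite mulr0.
by apply: value_sum => h; apply: valueM => //; apply: valueC.
Qed.

Let value_m2 i : value p (m2 i) (c i ^+ 5).
Proof.
have -> : c i ^+ 5 = c i ^+ 5 + c i * 0 ^+ 4 + 0 ^+ 5 by rewrite !expr0n mulr0 !addr0.
apply: valueD; last exact: valueX.
apply: valueD; first exact: valueC.
by apply: valueM; [apply: valueC|apply: valueX].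
Qed.

Let ring_value u e : value p u e -> lring p u.
Proof. by move=> ue; rewrite local_ring_value; exists e. Qed.

Let I_m1 : I (m1 j * y j + m1 l * y l).
Proof. by have := I_q; rewrite quadric_y sumE ya mulr0 add0r. Qed.
Let I_m2 : I (m2 j * y j + m2 l * y l).
Proof. by have := I_g; rewrite sextic_y sumE ya mulr0 add0r. Qed.

Let Iopp u : I u -> I (- u).
Proof.
by move=> Iu; rewrite -mulN1r; apply: local_idealM => //; rewrite -(rmorph1 t) -rmorphN -mpolyC1 -mpolyCN; apply: local_ringC.
Qed.

Section NotTangent.
Hypothesis det0 : beta j * c l ^+ 5 - beta l * c j ^+ 5 != 0.

(** Cramer's rule: the determinant [D] of the two relations between [y j] and [y l] has a nonzero
    value at [p], so it is invertible in the local ring. *)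
Let I_y i : I (y i).
Proof.
pose D := m1 j * m2 l - m1 l * m2 j.
pose d := 2%:R * beta j * c l ^+ 5 - 2%:R * beta l * c j ^+ 5.
have d0 : d != 0.
  have -> : d = 2%:R * (beta j * c l ^+ 5 - beta l * c j ^+ 5) by rewrite /d; ring.
  by rewrite mulf_neq0 // -(dvdn_pcharf hk).
have vD : value p D d.
  apply: valueD; first exact: valueM.
  rewrite -mulN1r -[- (_ * _)]mulN1r; apply: valueM; last exact: valueM.
  by rewrite -(rmorph1 t) -rmorphN -mpolyC1 -mpolyCN; apply: valueC.
have D0 : D != 0.
  have [d' [a1 [b1 [ha hb b0 DE aE]]]] := vD; rewrite DE mulf_neq0 ?invr_eq0 ?(meval_neq0 b0) //.
  by apply: (@meval_neq0 p); rewrite aE mulf_neq0.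
have OV : lring p D^-1 by apply: ring_value; apply: valueV vD.
have Dj : I (D * y j).
  have -> : D * y j = m2 l * (m1 j * y j + m1 l * y l) + m1 l * - (m2 j * y j + m2 l * y l).
    by rewrite /D; ring.
  by apply: local_idealD; apply: local_idealM => //; [exact: ring_value|exact: ring_value|exact: Iopp].
have Dl : I (D * y l).
  have -> : D * y l = m1 j * (m2 j * y j + m2 l * y l) + m2 j * - (m1 j * y j + m1 l * y l).
    by rewrite /D; ring.
  by apply: local_idealD; apply: local_idealM => //; [exact: ring_value|exact: ring_value|exact: Iopp].
elim/all_ajl: i; first by rewrite ya.
  by rewrite -(mulKf D0 (y j)); apply: local_idealM.
by rewrite -(mulKf D0 (y l)); apply: local_idealM.
Qed.

Let I_homog d (h : poly3) : h \is d.-homog -> I (h%:F / ('X_a)%:F ^+ d - cst h.@[c]).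
Proof.
pose P (d : nat) (h : poly3) :=
  h \is d.-homog /\ I (h%:F / ('X_a)%:F ^+ d - cst h.@[c]).
suff H : forall d h, h \is d.-homog -> P d h by move/H => [].
apply: dhomog_ind => {d h} [|e|e g h [hg Ig] [hh Ih]|e b g [hg Ig]|e i g [hg Ig]].
- split; first exact: dhomog1.
  by rewrite meval1 rmorph1 divr1 /cst mpolyC1 rmorph1 subrr.
- split; first exact: rpred0.
  by rewrite meval0 rmorph0 mul0r cst0 subrr.
- split; first exact: rpredD.
  have -> : (g + h)%:F / ('X_a)%:F ^+ e - cst (g + h).@[c] =
    (g%:F / ('X_a)%:F ^+ e - cst g.@[c]) + (h%:F / ('X_a)%:F ^+ e - cst h.@[c]).
    by rewrite rmorphD mevalD cstD; ring.
  exact: local_idealD.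
- split; first exact: rpredZ.
  have -> : (b *: g)%:F / ('X_a)%:F ^+ e - cst (b *: g).@[c] =
    cst b * (g%:F / ('X_a)%:F ^+ e - cst g.@[c]).
    by rewrite cstZ mevalZ cstM; ring.
  by apply: local_idealM => //; apply: local_ringC.
- split; first exact: (dhomogM (dhomogXU k i)).
  have -> : ('X_i * g)%:F / ('X_a)%:F ^+ e.+1 - cst ('X_i * g).@[c] =
    x i * (g%:F / ('X_a)%:F ^+ e - cst g.@[c]) + cst g.@[c] * y i.
    rewrite rmorphM mevalM mevalXU cstM /y /x exprS -mulf_div; ring.
  by apply: local_idealD; apply: local_idealM => //; [apply: ring_value|apply: local_ringC].
Qed.

(** Every germ is thus congruent to a constant, and the quotient has dimension at most 1. *)
Let I_value u e : value p u e -> I (u - cst e).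
Proof.
move=> [d [g [b [hg hb b0 -> gE]]]].
have Xd0 : ('X_a)%:F ^+ d != 0 :> K by rewrite expf_neq0.
have scale (h : poly3) : h \is d.-homog -> h.@[v] = vec p a 0 ^+ d * h.@[c].
  move=> hh; rewrite -(dhomog_meval_scale _ _ hh); apply: meval_eq => i.
  by rewrite /c mulrC mulfVK.
have gc : g.@[c] = e * b.@[c].
  apply: (mulfI (expf_neq0 d pa)).
  by rewrite -scale // gE scale //; ring.
have -> : g%:F / b%:F - cst e = (('X_a ^+ d)%:F / b%:F) *
   ((g%:F / ('X_a)%:F ^+ d - cst g.@[c]) + (- cst e) * (b%:F / ('X_a)%:F ^+ d - cst b.@[c])).
  rewrite gc cstM rmorphXn /=; field.
  by rewrite ?Xd0 ?Xa0 (meval_neq0 b0) ?Xd0 ?Xa0.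
apply: local_idealM.
  exists d, ('X_a ^+ d), b; split=> //; last exact/eqP.
  by have := dhomogMn d (dhomogXU k a); rewrite mul1n.
apply: local_idealD; first exact: I_homog.
apply: local_idealM; last exact: I_homog.
by rewrite /cst -rmorphN -mpolyCN; apply: local_ringC.
Qed.

Lemma not_mult2 : ~ (exists e : 'I_2 -> K,
    (forall i, lring p (e i)) /\
    (forall u, lring p u ->
       exists! c : 'rV[k]_2, I (u - \sum_(i < 2) ((c 0 i)%:MP)%:F * e i))).
Proof.
move=> [e [Oe ue]].
have /local_ring_value[e0 v0] := Oe ord0; have /local_ring_value[e1 v1] := Oe (lift ord0 ord0).
have [r [_ r_uniq]] := ue 0 O0.
(* A nontrivial relation between the two supposed basis elements: their values [e0] and [e1] are
   cancelled by the coefficients (e1, -e0), or by (1, 1) when both are zero. It contradicts the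
   uniqueness of the coordinates of 0. *)
pose s : 'rV[k]_2 := if (e0 == 0) && (e1 == 0) then const_mx 1
  else \row_i (if i == ord0 then e1 else - e0).
suff Is : I (0 - \sum_(i < 2) (s 0 i)%:MP%:F * e i).
  have I00 : I (0 - \sum_(i < 2) ((0 : 'rV[k]_2) 0 i)%:MP%:F * e i).
    by rewrite big1 ?subrr // => i _; rewrite mxE mpolyC0 rmorph0 mul0r.
  have : s = 0 by rewrite -(r_uniq _ Is) (r_uniq _ I00).
  rewrite /s; case: ifP => [_ /matrixP/(_ 0 0)|e01 /matrixP E].
    by rewrite !mxE => /eqP; rewrite oner_eq0.
  have := E 0 ord0; have := E 0 (lift ord0 ord0); rewrite !mxE /= => /eqP.
  by rewrite oppr_eq0 => /eqP e00 e10; rewrite e00 e10 eqxx in e01.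
rewrite !big_ord_recl big_ord0 addr0 sub0r; apply: Iopp.
have Ie0 := I_value v0; have Ie1 := I_value v1.
rewrite /s; case: ifP => [/andP[/eqP e00 /eqP e10]|_].
  rewrite !mxE mpolyC1 rmorph1 !mul1r.
  move: Ie0 Ie1; rewrite e00 e10 cst0 !subr0; exact: local_idealD.
rewrite !mxE /=.
have -> : e1%:MP%:F * e ord0 + (- e0)%:MP%:F * e (lift ord0 ord0) =
   cst e1 * (e ord0 - cst e0) + (- cst e0) * (e (lift ord0 ord0) - cst e1).
  by rewrite mpolyCN rmorphN /cst; ring.
apply: local_idealD; apply: local_idealM => //; first exact: local_ringC.
by rewrite /cst -rmorphN -mpolyCN; apply: local_ringC.
Qed.

End NotTangent.
End Transversal.
End LocalRing.

(** * Morphisms of fraction fields and transport of multiplicities *)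

Section FractionLift.
Variables (R : idomainType) (L : fieldType) (s : {rmorphism R -> L}).
Hypothesis s_inj : injective s.
Local Notation "x %:F" := (@tofrac R x).

Lemma fraction_quot (u : {fraction R}) :
  exists ab : R * R, ab.2 != 0 /\ u = ab.1%:F / ab.2%:F.
Proof.
elim/quotW: u => r; exists (\n_r, \d_r); split; first exact: denom_ratioP.
have d0 : (\d_r)%:F != 0 by rewrite tofrac_eq0 denom_ratioP.
apply: (mulIf d0); rewrite divfK //; unlock FracField.tofrac.
rewrite -[LHS]FracField.pi_mul; apply/eqmodP; rewrite /= FracField.equivfE /FracField.mulf.
by rewrite !numden_Ratio ?mulf_neq0 ?denom_ratioP ?oner_neq0 // !mulr1 mulrC.
Qed.

(** Numerator and denominator are picked by choice; [frac_liftE] shows that the result does not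
    depend on them. *)
Definition frac_lift (u : {fraction R}) : L :=
  s (sval (cid (fraction_quot u))).1 / s (sval (cid (fraction_quot u))).2.

Let s_eq0 a : (s a == 0) = (a == 0).
Proof. by rewrite -(rmorph0 s) (inj_eq s_inj). Qed.

Lemma frac_liftE a b : b != 0 -> frac_lift (a%:F / b%:F) = s a / s b.
Proof.
move=> b0; rewrite /frac_lift; case: cid => -[a' b'] /= [b'0 /eqP].
rewrite eqr_div ?tofrac_eq0 // -!tofracM tofrac_eq => /eqP ab.
apply/eqP; rewrite eqr_div ?s_eq0 // -!rmorphM; apply/eqP; congr (s _).
by rewrite -ab.
Qed.

Lemma frac_lift_tofrac a : frac_lift a%:F = s a.
Proof. by rewrite -[a%:F]divr1 -tofrac1 frac_liftE ?oner_neq0 // rmorph1 divr1. Qed.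

Lemma frac_lift_zmod : zmod_morphism frac_lift.
Proof.
move=> u v; have [[a b] /= [b0 ->]] := fraction_quot u.
have [[c d] /= [d0 ->]] := fraction_quot v.
rewrite -mulNr addf_div ?tofrac_eq0 // -tofracN -!tofracM -tofracD.
rewrite !frac_liftE ?mulf_neq0 // -[X in _ = _ + X]mulNr addf_div ?s_eq0 //.
by rewrite rmorphD !rmorphM rmorphN.
Qed.

Lemma frac_lift_monoid : monoid_morphism frac_lift.
Proof.
split=> [|u v]; first by rewrite -tofrac1 frac_lift_tofrac rmorph1.
have [[a b] /= [b0 ->]] := fraction_quot u.
have [[c d] /= [d0 ->]] := fraction_quot v.
by rewrite mulf_div -!tofracM !frac_liftE ?mulf_neq0 // !rmorphM mulf_div.
Qed.

Lemma fraction_lift : exists Phi : {rmorphism {fraction R} -> L},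
  forall a, Phi a%:F = s a.
Proof.
pose zm := GRing.isZmodMorphism.Build _ _ _ frac_lift_zmod.
pose mm := GRing.isMonoidMorphism.Build _ _ _ frac_lift_monoid.
pose Phi : {rmorphism {fraction R} -> L} := HB.pack frac_lift zm mm.
by exists Phi; exact: frac_lift_tofrac.
Qed.
End FractionLift.

Section Transport.
Variable k : fieldType.
Local Notation poly3 := {mpoly k[3]}.
Variables (K : fieldType) (t : {rmorphism poly3 -> K}).

Definition mult (f g : poly3) (p : P2 k) (n : nat) : Prop :=
  exists e : 'I_n -> K,
    (forall i, lring t p (e i)) /\
    (forall u, lring t p u ->
       exists! c : 'rV[k]_n,
         lideal t f g p (u - \sum_(i < n) t (c 0 i)%:MP * e i)).

Variables (phi psi : poly3 -> poly3) (Phi Psi : {rmorphism K -> K}).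
Hypotheses (PhiE : forall a, Phi (t a) = t (phi a)) (PsiE : forall a, Psi (t a) = t (psi a)).
Hypotheses (PhiK : cancel Phi Psi) (PsiK : cancel Psi Phi).
Hypotheses (phiC : forall c, phi c%:MP = c%:MP).
Hypotheses (phi_homog : forall d a, a \is d.-homog -> phi a \is d.-homog)
           (psi_homog : forall d a, a \is d.-homog -> psi a \is d.-homog).
Variables p p' : P2 k.
Hypotheses (phi_van : forall d b, b \is d.-homog -> vanishes (phi b) p' -> vanishes b p)
           (psi_van : forall d b, b \is d.-homog -> vanishes (psi b) p -> vanishes b p').

(** [Phi] identifies the two local rings and the two ideals and fixes constants, so it carries a
    basis of one quotient to a basis of the other. The hypotheses [phi_van] and [psi_van] express
    that [p] and [p'] correspond. *)
Lemma mult_transport f g n : psi (phi f) = f -> psi (phi g) = g ->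
  mult f g p n -> mult (phi f) (phi g) p' n.
Proof.
move=> fK gK [e [Oe ue]].
have ringPhi u : lring t p u -> lring t p' (Phi u).
  move=> [d [a [b [ha hb b0 ->]]]]; exists d, (phi a), (phi b).
  split; try exact: phi_homog; last by rewrite fmorph_div !PhiE.
  by move/(phi_van hb).
have ringPsi u : lring t p' u -> lring t p (Psi u).
  move=> [d [a [b [ha hb b0 ->]]]]; exists d, (psi a), (psi b).
  split; try exact: psi_homog; last by rewrite fmorph_div !PsiE.
  by move/(psi_van hb).
have eqnPhi h u : leqn t h p u -> leqn t (phi h) p' (Phi u).
  move=> [d [b [ha hb b0 ->]]]; exists d, (phi b).
  split; try exact: phi_homog; last by rewrite fmorph_div !PhiE.
  by move/(phi_van hb).
have eqnPsi h u : psi (phi h) = h -> leqn t (phi h) p' u -> leqn t h p (Psi u).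
  move=> hK [d [b [ha hb b0 ->]]]; exists d, (psi b).
  split; first by rewrite -hK; exact: psi_homog.
  - exact: psi_homog.
  - by move/(psi_van hb).
  - by rewrite fmorph_div !PsiE hK.
have idPhi u : lideal t f g p u -> lideal t (phi f) (phi g) p' (Phi u).
  move=> [r [s [x [y [Or Os fx gy ->]]]]].
  exists (Phi r), (Phi s), (Phi x), (Phi y); split; auto.
  by rewrite rmorphD !rmorphM.
have idPsi u : lideal t (phi f) (phi g) p' u -> lideal t f g p (Psi u).
  move=> [r [s [x [y [Or Os fx gy ->]]]]].
  exists (Psi r), (Psi s), (Psi x), (Psi y); split; auto.
  by rewrite rmorphD !rmorphM.
exists (Phi \o e); split=> [i|u Ou]; first exact: ringPhi.
have PhiS (c : 'rV[k]_n) : Phi (Psi u - \sum_(i < n) t (c 0 i)%:MP * e i) =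
    u - \sum_(i < n) t (c 0 i)%:MP * (Phi \o e) i.
  rewrite rmorphB PsiK rmorph_sum; congr (_ - _); apply: eq_bigr => i _.
  by rewrite rmorphM PhiE phiC.
have [c [Ic c_uniq]] := ue _ (ringPsi _ Ou).
exists c; split=> [|c' Ic']; first by rewrite -PhiS; exact: idPhi.
by apply: c_uniq; rewrite -[X in lideal _ _ _ _ X]PhiK PhiS; exact: idPsi.
Qed.
End Transport.

Section Tangency.
Variable k : closedFieldType.
Hypothesis hk : 5%N \in [pchar k].
Local Notation poly3 := {mpoly k[3]}.

Lemma intersection_multE (f g : poly3) p n :
  intersection_mult f g p n = mult (@tofrac poly3) f g p n.
Proof. by []. Qed.

(** Vanishing of the 2 by 2 minors of the gradients: 2 B v for the conic, and v^5 (as 6 = 1) for the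
    sextic. *)
Definition tangent_at (B : 'M[k]_3) (v : 'cV[k]_3) := forall i j,
  (B *m v) i 0 * v j 0 ^+ 5 = (B *m v) j 0 * v i 0 ^+ 5.

(** [not_mult2] controls only the minor that avoids the chart index [a]. The others follow from the
    Euler relations [e1] and [e2], by which both gradients are orthogonal to [v]. *)
Lemma mult2_tangent (B : 'M[k]_3) p : B^T = B -> conic B p -> Gamma k p ->
  intersection_mult (qpoly B) (fermat6 k) p 2 -> tangent_at B (vec p).
Proof.
move=> BT Bp Gp; rewrite intersection_multE => m2.
have tinj : injective (@tofrac poly3) by move=> x y /eqP; rewrite tofrac_eq => /eqP.
set v := vec p; set b := B *m v.
have e1 : \sum_i v i 0 * b i 0 = 0.
  by move: Bp; rewrite /conic /= -mulmxA mx11_eq0 mxE => E; rewrite -[RHS]E; apply: eq_bigr => i _; rewrite [_^T _ _]mxE.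
have e2 : \sum_i v i 0 ^+ 6 = 0.
  have GpE : (fermat6 k).@[fun i => v i 0] = 0 := Gp.
  rewrite -[RHS]GpE /fermat6 raddf_sum; apply: eq_bigr => i _ /=.
  by rewrite rmorphXn /= mevalXU.
have main a j l : uniq [:: a; j; l] -> v a 0 != 0 ->
    b j 0 * v l 0 ^+ 5 = b l 0 * v j 0 ^+ 5.
  move=> ajl va; apply/eqP; rewrite -subr_eq0; apply/negPn/negP => d0.
  case: (@not_mult2 k _ (@tofrac poly3) tinj hk p B Bp Gp a j l ajl va BT _ m2).
  apply: contra d0 => d0; rewrite -(mulrI_eq0 _ (mulfI (expf_neq0 6 (invr_neq0 va)))).
  by apply: etrans d0; congr (_ == _); rewrite -/v -/b; field.
have [i vi] : exists i, v i 0 != 0.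
  apply/existsP; apply: contraNT (vec_neq0 p); rewrite negb_exists => /forallP v0.
  by apply/eqP/matrixP => i j; rewrite ord1 mxE; apply/eqP; have := v0 i; rewrite negbK.
have step a j l : uniq [:: a; j; l] -> v a 0 != 0 ->
    b a 0 * v j 0 ^+ 5 = b j 0 * v a 0 ^+ 5.
  move=> ajl va; have := main a j l ajl va; rewrite !(sum3_uniq _ ajl) in e1 e2 * => m.
  apply: (mulfI va).
  transitivity (- (v j 0 * b j 0 + v l 0 * b l 0) * v j 0 ^+ 5).
    by rewrite mulrA; congr (_ * _); apply/eqP; rewrite -addr_eq0 -e1 addrA.
  transitivity (b j 0 * - (v j 0 ^+ 6 + v l 0 ^+ 6)); last first.
    have -> : - (v j 0 ^+ 6 + v l 0 ^+ 6) = v a 0 ^+ 6.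
      by apply/eqP; rewrite eq_sym -addr_eq0 -e2 addrA.
    by ring.
  have : v l 0 * (b l 0 * v j 0 ^+ 5) = v l 0 * (b j 0 * v l 0 ^+ 5) by rewrite m.
  move=> m'; transitivity (- (v j 0 * b j 0 * v j 0 ^+ 5) - v l 0 * (b l 0 * v j 0 ^+ 5)); first ring.
  by rewrite m'; ring.
have all3 a j l : uniq [:: a; j; l] -> v a 0 != 0 -> tangent_at B v.
  move=> ajl va; have alj : uniq [:: a; l; j].
    by move: ajl; rewrite /= !inE !negb_or [j == l]eq_sym !andbT => /andP[/andP[-> ->] ->].
  have m := main a j l ajl va; have s1 := step _ _ _ ajl va; have s2 := step _ _ _ alj va.
  by apply: (all_ajl ajl); apply: (all_ajl ajl).
move: vi; elim/I3P: i => vi.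
- exact: (@all3 i0 i1 i2).
- exact: (@all3 i1 i0 i2).
- exact: (@all3 i2 i0 i1).
Qed.

End Tangency.

(** * Bilinear algebra in dimension three *)

Section Linear3.
Variable k : fieldType.
Implicit Types (A B M : 'M[k]_3) (u v w x y : 'cV[k]_3).

Definition dot u v := (u^T *m v) 0 0.
Definition form B u v := (u^T *m B *m v) 0 0.

Lemma dotE u v : dot u v = u i0 0 * v i0 0 + u i1 0 * v i1 0 + u i2 0 * v i2 0.
Proof. by rewrite /dot mxE sum3 !mxE. Qed.

Lemma form_dot B u v : form B u v = dot u (B *m v).
Proof. by rewrite /form /dot mulmxA. Qed.

Lemma dotC u v : dot u v = dot v u.
Proof. by rewrite !dotE; ring. Qed.

Lemma formC B u v : B^T = B -> form B u v = form B v u.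
Proof.
move=> BT; have : (u^T *m B *m v)^T = v^T *m B *m u.
  by rewrite !trmx_mul trmxK BT mulmxA.
by move/matrixP/(_ 0 0); rewrite mxE.
Qed.

Definition cross u v := cv3 (u i1 0 * v i2 0 - u i2 0 * v i1 0)
  (u i2 0 * v i0 0 - u i0 0 * v i2 0) (u i0 0 * v i1 0 - u i1 0 * v i0 0).

Lemma cV3_eq u v : u i0 0 = v i0 0 -> u i1 0 = v i1 0 -> u i2 0 = v i2 0 -> u = v.
Proof. by move=> e0 e1 e2; apply/matrixP => i j; rewrite ord1; elim/I3P: i. Qed.

Lemma cross_eq0 u v : u != 0 -> cross u v = 0 -> exists c, v = c *: u.
Proof.
move=> u0 /matrixP E; have := E i0 0; have := E i1 0; have := E i2 0.
rewrite !mxE /= => /subr0_eq E2 /subr0_eq E1 /subr0_eq E0.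
have [a ua] : exists a, u a 0 != 0.
  apply/existsP; apply: contraNT u0; rewrite negb_exists => /forallP z.
  by apply/eqP/matrixP => i j; rewrite ord1 mxE; apply/eqP; have := z i; rewrite negbK.
exists (v a 0 / u a 0); move: ua; elim/I3P: a => ua; apply: cV3_eq; rewrite !mxE;
  apply: (mulIf ua); rewrite mulrAC divfK //;
  first [by rewrite mulrC E0 mulrC | by rewrite mulrC -E0 mulrC | by rewrite mulrC E1 mulrC
        |by rewrite mulrC -E1 mulrC|by rewrite mulrC E2 mulrC|by rewrite mulrC -E2 mulrC].
Qed.

Lemma orth_cross x u v : dot x u = 0 -> dot x v = 0 -> cross u v != 0 ->
  exists c, x = c *: cross u v.
Proof.
move=> xu xv w0; apply: cross_eq0 => //.
have crossE i : v i 0 * dot x u - u i 0 * dot x v = 0 by rewrite xu xv !mulr0 subrr.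
by apply: cV3_eq; rewrite !mxE /=; [rewrite -(crossE i0)|rewrite -(crossE i1)
  |rewrite -(crossE i2)]; rewrite !dotE; ring.
Qed.

Definition cols3 u v w : 'M[k]_3 := \matrix_(i, j) (nth u [:: u; v; w] j) i 0.

Lemma cols3_form M u v w x y z : (cols3 u v w)^T *m M *m cols3 x y z =
  mx3 [:: [:: form M u x; form M u y; form M u z];
          [:: form M v x; form M v y; form M v z];
          [:: form M w x; form M w y; form M w z]].
Proof.
have E i j : ((cols3 u v w)^T *m M *m cols3 x y z) i j =
    form M (nth u [:: u; v; w] i) (nth x [:: x; y; z] j).
  rewrite /form form3E mxE sum3 !mxE !sum3 !mxE; ring.
by apply/matrixP => i j; rewrite E mxE; elim/I3P: i; elim/I3P: j.
Qed.

Lemma cols3_mul u v w a b c : cols3 u v w *m cv3 a b c = a *: u + b *: v + c *: w.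
Proof. by apply: cV3_eq; rewrite !mxE sum3 !mxE /=; ring. Qed.

Lemma mulmx_cols3 M u v w : M *m cols3 u v w = cols3 (M *m u) (M *m v) (M *m w).
Proof. by apply/matrixP => i j; rewrite !mxE sum3 !mxE; elim/I3P: j; rewrite /= !mxE sum3. Qed.

Lemma cols3_unit u v w : (forall a b c, a *: u + b *: v + c *: w = 0 ->
  [/\ a = 0, b = 0 & c = 0]) -> cols3 u v w \in unitmx.
Proof.
move=> free; rewrite -unitmx_tr unitmxE unitfE; apply/negP => /det0P[x x0 xA].
case/negP: x0; have E : cols3 u v w *m x^T = 0.
  by apply: trmx_inj; rewrite trmx_mul trmxK xA trmx0.
rewrite [x^T]cv3E cols3_mul in E; have [] := free _ _ _ E; rewrite !mxE => a0 b0 c0.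
by apply/eqP/matrixP => i j; rewrite ord1 mxE; elim/I3P: j.
Qed.

(* A nondegenerate symmetric form of rank 3 has no totally isotropic plane, so
   two isotropic vectors and the pole of their span form a basis. *)
Lemma isotropic_pair B u v : B^T = B -> B \in unitmx -> u != 0 -> v != 0 ->
  (forall c, v != c *: u) -> form B u u = 0 -> form B v v = 0 ->
  exists r, [/\ form B u v != 0, form B r u = 0, form B r v = 0, form B r r != 0
             & cols3 u r v \in unitmx].
Proof.
move=> BT uB u0 v0 uv uu vv.
have w0 : cross u v != 0.
  by apply/eqP => /(cross_eq0 u0)[c vE]; have := uv c; rewrite vE eqxx.
have Binj x : B *m x = 0 -> x = 0 by move=> Bx; rewrite -(mulKmx uB x) Bx mulmx0.
have buv : form B u v != 0.
  apply/eqP => uv0.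
  have [||c Bu] := @orth_cross (B *m u) u v _ _ w0.
  - by rewrite dotC -form_dot.
  - by rewrite dotC -form_dot formC.
  have [||d Bv] := @orth_cross (B *m v) u v _ _ w0.
  - by rewrite dotC -form_dot.
  - by rewrite dotC -form_dot.
  have c0 : c != 0 by apply: contra_neq u0 => c0; apply: Binj; rewrite Bu c0 scale0r.
  have /eqP := uv (d / c); apply; apply/eqP; rewrite -subr_eq0; apply/eqP/Binj.
  by rewrite mulmxBr -scalemxAr Bu Bv scalerA divfK // subrr.
pose r := invmx B *m cross u v.
have Br : B *m r = cross u v by rewrite mulKVmx.
have r0 : r != 0 by apply: contra_neq w0 => r0; rewrite -Br r0 mulmx0.
have ru : form B u r = 0 by rewrite form_dot Br dotE !mxE /=; ring.
have rv : form B v r = 0 by rewrite form_dot Br dotE !mxE /=; ring.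
have formD x y z : form B x (y + z) = form B x y + form B x z.
  by rewrite /form mulmxDr mxE.
have formZ c x y : form B x (c *: y) = c * form B x y by rewrite /form -scalemxAr mxE.
have uA : cols3 u r v \in unitmx.
  apply: cols3_unit => a b c E.
  have c0 : c = 0.
    have : form B u (a *: u + b *: r + c *: v) = 0 by rewrite E /form mulmx0 mxE.
    rewrite !formD !formZ uu ru !mulr0 !add0r => /eqP.
    by rewrite mulf_eq0 (negPf buv) orbF => /eqP.
  have a0 : a = 0.
    have : form B v (a *: u + b *: r + c *: v) = 0 by rewrite E /form mulmx0 mxE.
    rewrite !formD !formZ vv rv !mulr0 !addr0 formC // => /eqP.
    by rewrite mulf_eq0 (negPf buv) orbF => /eqP.
  split=> //; move: E; rewrite a0 c0 !scale0r add0r addr0 => /eqP.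
  by rewrite scaler_eq0 (negPf r0) orbF => /eqP.
exists r; split=> //; rewrite 1?formC //.
apply: contra_neq r0 => rr; apply: Binj; apply: trmx_inj.
rewrite -[LHS](mulmxK uA) trmx_mul BT (_ : r^T *m B *m _ = 0) ?mul0mx ?trmx0 //.
have E c : (r^T *m B *m cols3 u r v) 0 c = form B r (nth u [:: u; r; v] c).
  rewrite /form mxE [RHS]mxE; apply: eq_bigr => i _; congr (_ * _); by rewrite mxE.
apply/matrixP => i j; rewrite ord1 E mxE.
by elim/I3P: j => //=; rewrite formC.
Qed.

End Linear3.

Section Enumeration.

Lemma card_I_enum T (S : set T) n : S #= `I_n ->
  exists g : 'I_n -> T, injective g /\ forall i, S (g i).
Proof.
move=> /card_set_bijP[f [_ _ fsurj]].
have /choice[g gP] : forall i : 'I_n, exists x, S x /\ f x = i.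
  by move=> i; have [x Sx fx] := fsurj i (ltn_ord i); exists x.
exists g; split=> [i j gij|i]; last by have [] := gP i.
by apply: val_inj; have [_ fi] := gP i; have [_ fj] := gP j; rewrite /= -fi -fj gij.
Qed.

Lemma card_I_image T (S : set T) n (g : 'I_n.+1 -> T) : injective g ->
  (forall i, S (g i)) -> (forall x, S x -> exists i, x = g i) -> S #= `I_n.+1.
Proof.
move=> g_inj gS Sg; have -> : S = (fun m => g (inord m)) @` `I_n.+1.
  apply/seteqP; split=> [x /Sg[i ->]|_ [m _ <-]] //.
  by exists (val i); rewrite /= ?inord_val //; apply: ltn_ord.
apply: inj_card_eq => i j; rewrite !inE /= => ilt jlt /g_inj/(congr1 val).
by rewrite /= !inordK.
Qed.
End Enumeration.

(** * Normal form of a totally tangent conic *)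

Section NormalForm.
Variable k : closedFieldType.
Hypothesis hk : 5%N \in [pchar k].
Local Notation "A ^f" := (map_mx (pFrobenius_aut hk) A).
Implicit Types (A B : 'M[k]_3) (u v w : 'cV[k]_3).

Lemma Frob_inj v : v^f = 0 -> v = 0.
Proof. by move/eqP; rewrite map_mx_eq0 => /eqP. Qed.

Lemma tangent_frob B v : B \in unitmx -> v != 0 -> tangent_at B v ->
  exists2 c, c != 0 & B *m v = c *: v^f.
Proof.
move=> uB v0 tv.
have [a va] : exists a, v a 0 != 0.
  apply/existsP; apply: contraNT v0; rewrite negb_exists => /forallP z.
  by apply/eqP/matrixP => i j; rewrite ord1 mxE; apply/eqP; have := z i; rewrite negbK.
have E : B *m v = ((B *m v) a 0 / v a 0 ^+ 5) *: v^f.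
  apply/matrixP => i j; rewrite ord1 [RHS]mxE [_^f _ _]mxE pFrobenius_autE.
  by rewrite mulrAC -tv mulfK // expf_neq0.
exists ((B *m v) a 0 / v a 0 ^+ 5) => //.
apply: contraNneq v0 => c0; rewrite -(mulKmx uB v) E c0 scale0r mulmx0 //.
Qed.

Lemma tt_conic (Q : set (P2 k)) : totally_tangent_conic Q ->
  exists B, [/\ B^T = B, B \in unitmx, Q = conic B,
    exists g : 'I_6 -> P2 k, injective g /\ forall i, (Q `&` Gamma k) (g i)
    & forall p, (Q `&` Gamma k) p -> exists2 c, c != 0 & B *m vec p = c *: (vec p)^f].
Proof.
have two0 : (2 : k) != 0 by rewrite natr_neq0.
move=> [q [hq nsq QE Q6 Qm]].
have [B BT qB] := dhomog2_qpoly two0 hq.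
(* A vector killed by [B] would be a zero of the form at which all partial derivatives vanish. *)
have uB : B \in unitmx.
  rewrite -unitmx_tr unitmxE unitfE; apply/negP => /det0P[x x0 xB].
  have xT0 : x^T != 0 by rewrite trmx_eq0.
  have BxT : B *m x^T = 0 by apply: trmx_inj; rewrite trmx_mul trmxK xB trmx0.
  have [|i] := nsq (exist _ x^T xT0).
    by rewrite qB (qpoly_eval B x^T) -mulmxA BxT mulmx0 mxE.
  by rewrite qB (qpoly_deriv i x^T BT) BxT mxE mulr0 eqxx.
exists B; split=> //; first by rewrite QE qB zeros_qpoly.
  exact: card_I_enum.
move=> p Qp; apply: tangent_frob => //; first exact: vec_neq0.
apply: (mult2_tangent hk BT) (Qp.2) _; last by rewrite -qB; apply: Qm.
by case: Qp => + _; rewrite QE qB zeros_qpoly.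
Qed.

(** Gram matrix of 2 (x z - y^2), the conic parametrized by (1, t, t^2). *)
Definition Jmx : 'M[k]_3 := mx3 [:: [:: 0; 0; 1]; [:: 0; - 2; 0]; [:: 1; 0; 0]].

(** The hypotheses on [t] say that the point (1, t, t^2) satisfies B p ~ p^5 in the basis of
    [tt_Jmx]. Eliminating the high powers of [t] leaves the quadratic [Pq] with three distinct
    roots, so all its coefficients vanish. Here [be] is nonzero, since otherwise [t1] and [t2] would
    have the same fifth power, against the injectivity of the Frobenius. *)
Lemma quintic_elim (al be ga a b t1 t2 t3 : k) : a != 0 ->
  t1 != 0 -> t2 != 0 -> t3 != 0 -> t1 != t2 -> t1 != t3 -> t2 != t3 ->
  (forall t, t \in [:: t1; t2; t3] ->
     2 * b + 2 * ga * t ^+ 5 + be * t ^+ 4 = 0 /\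
     al * t ^+ 3 + a * t ^+ 8 = b + ga * t ^+ 5) ->
  [/\ al = 0, ga = 0, be = - 2 * a * t1 ^+ 4 & b = a * t1 ^+ 8].
Proof.
move=> a0 t10 t20 t30 t12 t13 t23 E.
have two0 : (2 : k) != 0 by rewrite natr_neq0.
have tn0 t : t \in [:: t1; t2; t3] -> t != 0.
  by rewrite !inE => /or3P[]/eqP->.
have E2 t : t \in [:: t1; t2; t3] -> 2 * a * t ^+ 5 + be * t + 2 * al = 0.
  move=> ht; have [e1 e2] := E _ ht; apply: (mulfI (expf_neq0 3 (tn0 _ ht))).
  transitivity (2 * (al * t ^+ 3 + a * t ^+ 8) + be * t ^+ 4); first ring.
  by rewrite e2 mulr0 -e1; ring.
have be0 : be != 0.
  apply: contra_neq t12 => b0.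
  have e t : t \in [:: t1; t2; t3] -> t ^+ 5 = - al / a.
    move=> ht; apply: (mulfI a0); apply: (mulfI two0); rewrite [a * (_ / a)]mulrC divfK //.
    apply/eqP; rewrite -subr_eq0; apply/eqP; rewrite -[RHS](E2 t ht) b0; ring.
  apply: (fmorph_inj (pFrobenius_aut hk)); rewrite /= !pFrobenius_autE !e // !inE eqxx ?orbT //.
have E4 t : t \in [:: t1; t2; t3] ->
    a * be * t ^+ 4 - ga * be * t + 2 * (a * b - ga * al) = 0.
  move=> ht; have [e1 _] := E _ ht.
  transitivity (a * (2 * b + 2 * ga * t ^+ 5 + be * t ^+ 4) - ga * (2 * a * t ^+ 5 + be * t + 2 * al)); first ring.
  by rewrite e1 (E2 _ ht) !mulr0 subrr.
pose Pq (t : k) := 2 * ga * be * t ^+ 2 + (be ^+ 2 - 4 * (a * b - ga * al)) * t + 2 * al * be.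
have E5 t : t \in [:: t1; t2; t3] -> Pq t = 0.
  move=> ht; transitivity (be * (2 * a * t ^+ 5 + be * t + 2 * al) -
    2 * t * (a * be * t ^+ 4 - ga * be * t + 2 * (a * b - ga * al))); first by rewrite /Pq; ring.
  by rewrite (E4 _ ht) (E2 _ ht) !mulr0 subrr.
have [h1 h2 h3] : [/\ t1 \in [:: t1; t2; t3], t2 \in [:: t1; t2; t3] & t3 \in [:: t1; t2; t3]].
  by rewrite !inE !eqxx !orbT.
have d12 : t1 - t2 != 0 by rewrite subr_eq0.
have d13 : t1 - t3 != 0 by rewrite subr_eq0.
have d23 : t2 - t3 != 0 by rewrite subr_eq0.
have ga0 : ga = 0.
  apply: (mulfI two0); rewrite mulr0; apply: (mulIf be0); rewrite mul0r.
  apply: (mulIf d12); apply: (mulIf d13); apply: (mulIf d23); rewrite !mul0r.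
  transitivity (Pq t1 * (t2 - t3) - Pq t2 * (t1 - t3) + Pq t3 * (t1 - t2)); first by rewrite /Pq; ring.
  by rewrite !E5 // !mul0r subrr addr0.
have lin : be ^+ 2 - 4 * (a * b - ga * al) = 0.
  apply: (mulIf d12); rewrite mul0r -[RHS](subrr 0) -{1}(E5 _ h1) -(E5 _ h2) /Pq ga0; ring.
have al0 : al = 0.
  apply: (mulfI two0); rewrite mulr0; apply: (mulIf be0); rewrite mul0r.
  by rewrite -[RHS](E5 _ h1) /Pq lin ga0; ring.
have beE : be = - 2 * a * t1 ^+ 4.
  apply: (mulIf t10); apply/eqP; rewrite -subr_eq0; apply/eqP.
  by rewrite -[RHS](E2 _ h1) al0; ring.
split=> //; have [e1 _] := E _ h1; apply: (mulfI two0).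
apply/eqP; rewrite -subr_eq0; apply/eqP; rewrite -[RHS]e1 ga0 beE; ring.
Qed.

Lemma Jmx_unit : Jmx \in unitmx.
Proof.
have two0 : (2 : k) != 0 by rewrite natr_neq0.
pose K : 'M[k]_3 := mx3 [:: [:: 0; 0; 1]; [:: 0; - 2^-1; 0]; [:: 1; 0; 0]].
suff : Jmx *m K = 1%:M by case/mulmx1_unit.
apply/matrixP; elim/I3P; elim/I3P; rewrite !mxE sum3 !mxE /=; by field.
Qed.

Lemma cols3_Frob u v w : (cols3 u v w)^f = cols3 (u^f) (v^f) (w^f).
Proof. by apply/matrixP => i; elim/I3P; rewrite !mxE. Qed.

(** Two contact points and the pole of their chord form a basis in which the conic is a multiple of
    [Jmx], and tangency at these two points leaves at most five nonzero entries in the Hermitian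
    matrix. Three further contact points, of the form (1, t, t^2), determine it by
    [quintic_elim]. *)
Lemma tt_Jmx (Q : set (P2 k)) : totally_tangent_conic Q ->
  exists A B b h, [/\ Q = conic B, A^T *m B *m A = b *: Jmx, A^T *m A^f = h *: Jmx,
    b != 0 & h != 0].
Proof.
move=> /tt_conic[B [BT uB QE [g [g_inj gQ]] tang]].
have two0 : (2 : k) != 0 by rewrite natr_neq0.
have conicB i : form B (vec (g i)) (vec (g i)) = 0.
  by have [+ _] := gQ i; rewrite QE /conic /= mx11_eq0.
pose v1 := vec (g ord0); pose v2 := vec (g (inord 1)).
have inord_neq m n : (m < 6)%N -> (n < 6)%N -> m != n -> g (inord m) <> g (inord n).
  by move=> m6 n6 mn /g_inj/(congr1 val); rewrite /= !inordK // => /eqP; rewrite (negPf mn).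
have g0E : g ord0 = g (inord 0) by congr g; apply: val_inj; rewrite /= inordK.
have v12 c : v2 != c *: v1.
  apply/eqP => E; apply: (@inord_neq 1%N 0%N) => //.
  rewrite -g0E; apply: (vec_inj _ E).
  by apply/eqP => c0; have /eqP := vec_neq0 (g (inord 1)); apply; rewrite -/v2 E c0 scale0r.
have [r [b0 rv1 rv2 rr0 _]] :=
  isotropic_pair BT uB (vec_neq0 _) (vec_neq0 _) v12 (conicB _) (conicB _).
set b := form B v1 v2 in b0.
(* The pole is rescaled so that its norm is [- 2 * b], the middle entry of [b *: Jmx]. *)
have [rho rhoE] := @nth_root k (- 2 * b / form B r r) 2 isT.
pose r' := rho *: r.
have formZr c x y : form B x (c *: y) = c * form B x y by rewrite /form -scalemxAr mxE.
have formZl c x y : form B (c *: x) y = c * form B x y.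
  by rewrite formC // formZr formC.
have rr' : form B r' r' = - 2 * b by rewrite formZr formZl mulrA -expr2 rhoE divfK.
pose A := cols3 v1 r' v2.
have AB : A^T *m B *m A = b *: Jmx.
  rewrite cols3_form (conicB ord0) (conicB (inord 1)) rr' !formZl (formC v1 r') // formZl rv1 rv2.
  rewrite (formC v2 r') // formZl rv2 (formC v2 v1) // -/b.
  by apply/matrixP; elim/I3P; elim/I3P; rewrite !mxE /=; ring.
have [c1 c10 t1E] := tang _ (gQ ord0); have [c2 c20 t2E] := tang _ (gQ (inord 1)).
have v1f : v1^f = c1^-1 *: (B *m v1) by rewrite t1E scalerA mulVf // scale1r.
have v2f : v2^f = c2^-1 *: (B *m v2) by rewrite t2E scalerA mulVf // scale1r.
have dotZ c x y : dot x (c *: y) = c * dot x y by rewrite /dot -scalemxAr mxE.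
pose al := dot v1 (r'^f); pose be := dot r' (r'^f); pose ga := dot v2 (r'^f).
pose a := b / c2; pose b' := b / c1.
have AH : A^T *m A^f = mx3 [:: [:: 0; al; a]; [:: 0; be; 0]; [:: b'; ga; 0]].
  rewrite -[A^T]mulmx1 cols3_Frob cols3_form; have f1 x y : form 1%:M x y = dot x y.
    by rewrite /form mulmx1.
  rewrite !f1 v1f v2f !dotZ -!form_dot (conicB ord0) (conicB (inord 1)) !formZl rv1 rv2.
  rewrite (formC v2 v1) // -/b -/al -/be -/ga !mulr0.
  by rewrite ![_^-1 * b]mulrC.
have uA : A \in unitmx.
  have : A^T *m B *m A \in unitmx by rewrite AB unitmxZ ?unitfE // Jmx_unit.
  by rewrite unitmx_mul => /andP[].
have a0 : a != 0 by rewrite mulf_neq0 ?invr_eq0.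
(* Each remaining contact point lies on x z = y^2 and differs from the two base points, which have
   parameters 0 and infinity; so its parameter is finite and nonzero. *)
have point_t i : (1 < i < 6)%N -> exists t d, [/\ t != 0, d != 0,
    vec (g (inord i)) = d *: (A *m cv3 1 t (t ^+ 2)),
    2 * b' + 2 * ga * t ^+ 5 + be * t ^+ 4 = 0
    & al * t ^+ 3 + a * t ^+ 8 = b' + ga * t ^+ 5].
  move=> /andP[lt1i lti6]; set q := g (inord i).
  have [x qE] : exists x, vec q = A *m x by exists (invmx A *m vec q); rewrite mulKVmx.
  have xE := cv3E x; move: qE xE; set x0 := x i0 0; set x1 := x i1 0; set x2 := x i2 0.
  move=> qE xE.
  have xx : x0 * x2 = x1 ^+ 2.
    have := conicB (inord i); rewrite -/q qE /form trmx_mul !mulmxA -(mulmxA x^T) -(mulmxA x^T) AB.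
    rewrite form3E !mxE /= -/x0 -/x1 -/x2 => E.
    apply: (mulfI two0); apply: (mulfI b0); apply/eqP; rewrite -subr_eq0; apply/eqP.
    by rewrite -[RHS]E; ring.
  have x00 : x0 != 0.
    apply/eqP => x00; have x10 : x1 = 0 by move: xx; rewrite x00 mul0r => /esym/eqP; rewrite expf_eq0 => /eqP.
    move: qE; rewrite xE x00 x10 cols3_mul !scale0r !add0r => qE.
    apply: (@inord_neq i 1%N) => //; first by rewrite gtn_eqF.
    apply: (vec_inj _ qE).
    by apply/eqP => x20; have /eqP := vec_neq0 q; apply; rewrite qE x20 scale0r.
  pose t := x1 / x0.
  have x2E : x2 = x0 * t ^+ 2.
    by apply: (mulfI x00); rewrite xx /t; field.
  have xm : x = x0 *: cv3 1 t (t ^+ 2).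
    by rewrite xE; apply: cV3_eq; rewrite !mxE /= ?mulr1 ?x2E // /t mulrC divfK.
  have qm : vec q = x0 *: (A *m cv3 1 t (t ^+ 2)) by rewrite qE xm scalemxAr.
  have t0 : t != 0.
    apply/eqP => t0; move: qm; rewrite t0 expr0n cols3_mul !scale0r !addr0 scale1r => qm.
    by apply: (@inord_neq i 0%N) => //; [by rewrite gtn_eqF // ltnW|rewrite -g0E; apply: (vec_inj _ qm)].
  have [c c0 tq] := tang _ (gQ (inord i)).
  have Hm : (b * x0) *: (Jmx *m cv3 1 t (t ^+ 2)) = (c * x0 ^+ 5) *: (A^T *m A^f *m (cv3 1 t (t ^+ 2))^f).
    have := congr1 (mulmx A^T) tq; rewrite -/q qm map_mxZ /= pFrobenius_autE mxFM.
    rewrite -!scalemxAr !scalerA !mulmxA AB => <-.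
    by rewrite -scalemxAl scalerA mulrC.
  pose ka := (c * x0 ^+ 5) / (b * x0).
  have ka0 : ka != 0 by rewrite !mulf_neq0 ?invr_eq0 ?mulf_neq0 ?expf_neq0.
  have {}Hm : Jmx *m cv3 1 t (t ^+ 2) = ka *: (A^T *m A^f *m (cv3 1 t (t ^+ 2))^f).
    apply: (@scalerI _ _ (b * x0)); first by rewrite mulf_neq0.
    by rewrite Hm scalerA; congr (_ *: _); rewrite /ka [RHS]mulrC divfK ?mulf_neq0.
  rewrite AH in Hm; move/matrixP: Hm => Hm.
  have := Hm i0 0; have := Hm i1 0; have := Hm i2 0.
  rewrite !mxE !sum3 !mxE /= !pFrobenius_autE !expr1n => m2 m1 m0.
  exists t, x0; split=> //.
    apply: (mulfI t0); apply: (mulfI ka0).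
    transitivity (2 * t * (ka * (b' * 1 + ga * t ^+ 5 + 0 * t ^+ 2 ^+ 5)) + ka * (0 * 1 + be * t ^+ 5 + 0 * t ^+ 2 ^+ 5)); first ring.
    by rewrite -m2 -m1; ring.
  apply: (mulfI (expf_neq0 2 t0)); apply: (mulfI ka0).
  transitivity (ka * (0 * 1 + al * t ^+ 5 + a * t ^+ 2 ^+ 5)); first ring.
  transitivity (t ^+ 2 * (ka * (b' * 1 + ga * t ^+ 5 + 0 * t ^+ 2 ^+ 5))); last ring.
  by rewrite -m2 -m0; ring.
have [t1 [d1 [t10 d10 g1 e1 f1]]] := point_t 2%N isT.
have [t2 [d2 [t20 d20 g2 e2 f2]]] := point_t 3%N isT.
have [t3 [d3 [t30 d30 g3 e3 f3]]] := point_t 4%N isT.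
have neq_t m n t t' d d' : (m < 6)%N -> (n < 6)%N -> m != n -> d != 0 -> d' != 0 ->
    vec (g (inord m)) = d *: (A *m cv3 1 t (t ^+ 2)) ->
    vec (g (inord n)) = d' *: (A *m cv3 1 t' (t' ^+ 2)) -> t != t'.
  move=> m6 n6 mn d0 d'0 mE nE; apply/eqP => tt'; apply: (inord_neq m n) => //.
  apply: (@vec_inj _ _ _ (d / d')); first by rewrite mulf_neq0 ?invr_eq0.
  by rewrite mE nE tt' scalerA divfK.
have [||||al0 ga0 beE bE] := @quintic_elim al be ga a b' t1 t2 t3 a0 t10 t20 t30.
- exact: (neq_t 2%N 3%N _ _ d1 d2).
- exact: (neq_t 2%N 4%N _ _ d1 d3).
- exact: (neq_t 3%N 4%N _ _ d2 d3).
- by move=> t; rewrite !inE => /or3P[]/eqP->.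
(* Scaling the parameter by [t1] preserves [Jmx] up to a scalar and turns the antidiagonal a, -2 a
   t1^4, a t1^8 of the Hermitian matrix into that of a multiple of [Jmx]. *)
pose D : 'M[k]_3 := mx3 [:: [:: 1; 0; 0]; [:: 0; t1; 0]; [:: 0; 0; t1 ^+ 2]].
exists (A *m D), B, (b * t1 ^+ 2), (a * t1 ^+ 10); split=> //.
- rewrite trmx_mul !mulmxA -(mulmxA D^T) -(mulmxA D^T) AB -scalemxAr -scalemxAl -scalerA.
  congr (_ *: _).
  by apply/matrixP; elim/I3P; elim/I3P; rewrite !mxE !sum3 !mxE !sum3 !mxE /=; ring.
- rewrite mxFM trmx_mul !mulmxA -(mulmxA D^T) AH al0 ga0 beE bE.
  by apply/matrixP; elim/I3P; elim/I3P; rewrite !mxE !sum3 !mxE !sum3 !mxE /= !pFrobenius_autE; ring.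
- by rewrite mulf_neq0 ?expf_neq0.
- by rewrite mulf_neq0 ?expf_neq0.
Qed.

Lemma tt_normal (Q : set (P2 k)) : totally_tangent_conic Q ->
  exists2 A, unitary hk A & Q = im (cl A) (conic 1%:M).
Proof.
move=> /tt_Jmx[A [B [b [h [QE AB AH b0 h0]]]]].
have three0 : (3 : k) != 0 by rewrite natr_neq0.
(* An orthogonal basis over F_5 for [Jmx], with all norms equal to 3 modulo 5. Being fixed by the
   Frobenius, [R] brings the quadratic and the Hermitian form to scalar matrices at the same
   time. *)
pose R : 'M[k]_3 := mx3 [:: [:: 0; 1; 2]; [:: 1; 0; 0]; [:: 0; 4; 2]].
have RF : R^f = R.
  apply/matrixP; elim/I3P; elim/I3P; rewrite !mxE /= ?rmorph0 ?rmorph1 ?rmorph_nat //.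
have RJ : R^T *m Jmx *m R = 3%:M.
  have z (c : k) : 5 * c = 0 by rewrite n5 // mul0r.
  apply/matrixP; elim/I3P; elim/I3P; rewrite !mxE !sum3 !mxE !sum3 !mxE /=;
  apply/eqP; rewrite -subr_eq0; apply/eqP;
  first [apply: etrans (z 0); ring | apply: etrans (z 1); ring
             |apply: etrans (z 2); ring | apply: etrans (z (- 1)); ring].
have uR : R \in unitmx.
  have : R^T *m Jmx *m R \in unitmx by rewrite RJ unitmxE det_scalar unitfE expf_neq0.
  by rewrite unitmx_mul => /andP[].
have uA : A \in unitmx.
  have : A^T *m A^f \in unitmx by rewrite AH unitmxZ ?unitfE // Jmx_unit.
  by rewrite unitmx_mul unitmx_tr => /andP[].
have [m mE] := nth_root (h * 3)^-1 (isT : (0 < 6)%N).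
have m0 : m != 0.
  apply/eqP => m0; have : (h * 3)^-1 != 0 by rewrite invr_eq0 mulf_neq0.
  by rewrite -mE m0 expr0n eqxx.
have uAR : A *m R \in unitmx by rewrite unitmx_mul uA.
exists (m *: (A *m R)).
  rewrite /unitary mxFZ [(_ *: (A *m R))^T]linearZ /= -scalemxAl -scalemxAr scalerA -exprS mE.
  rewrite mxFM RF trmx_mul !mulmxA -(mulmxA R^T) AH -scalemxAr -scalemxAl RJ.
  by rewrite scalerA -[3%:M]scalemx1 scalerA -mulrA mulVf ?mulf_neq0 // scale1r.
have -> : im (cl (m *: (A *m R))) (conic 1%:M) = im (cl (A *m R)) (conic 1%:M).
  congr (im _ _); apply/cl_eq; rewrite ?unitmxZ ?unitfE //.
  by exists m.
rewrite im_conic // mulmx1 QE.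
have ARB : (A *m R)^T *m B *m (A *m R) = (b * 3) *: 1%:M.
  rewrite trmx_mul !mulmxA -(mulmxA R^T) -(mulmxA R^T) AB -scalemxAr -scalemxAl RJ.
  by rewrite -scalerA scalemx1.
move: ARB uAR; set G := A *m R; move: G => G ARB uAR.
have -> : B = (b * 3) *: ((invmx G)^T *m invmx G).
  have := congr1 (fun M => (invmx G)^T *m M *m invmx G) ARB.
  rewrite !mulmxA -trmx_mul mulmxV // trmx1 mul1mx mulmxK // => ->.
  by rewrite -scalemxAr mulmx1 -scalemxAl.
by rewrite conicZ // mulf_neq0.
Qed.

End NormalForm.

(** * Linear substitutions and the action of unitary matrices on conics *)

Section Substitution.
Variable k : fieldType.
Local Notation poly3 := {mpoly k[3]}.
Implicit Types (A B C D : 'M[k]_3) (a b : poly3).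

Definition lin_tuple C : 3.-tuple poly3 := [tuple \sum_j C i j *: 'X_j | i < 3].
Definition subst C : poly3 -> poly3 := comp_mpoly (lin_tuple C).

HB.instance Definition _ C := GRing.RMorphism.on (subst C).

Lemma substX C i : subst C 'X_i = \sum_j C i j *: 'X_j.
Proof. by rewrite /subst comp_mpolyXU -tnth_nth tnth_mktuple. Qed.

Lemma substC C c : subst C c%:MP = c%:MP.
Proof. exact: comp_mpolyC. Qed.

Lemma substZ C c a : subst C (c *: a) = c *: subst C a.
Proof. exact: comp_mpolyZ. Qed.

Lemma subst_eval C a (v : 'cV[k]_3) :
  (subst C a).@[fun i => v i 0] = a.@[fun i => (C *m v) i 0].
Proof.
rewrite comp_mpoly_meval; apply: meval_eq => i; rewrite tnth_mktuple raddf_sum mxE.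
by apply: eq_bigr => j _ /=; rewrite mevalZ mevalXU.
Qed.

Lemma subst_homog C d a : a \is d.-homog -> subst C a \is d.-homog.
Proof.
move: d a; apply: dhomog_ind => [|d|d a b ha hb|d c a ha|d i a ha].
- by rewrite rmorph1 dhomog1.
- by rewrite rmorph0 rpred0.
- by rewrite rmorphD rpredD.
- by rewrite substZ rpredZ.
- rewrite rmorphM /= substX; apply: (@dhomogM _ _ _ 1%N) => //.
  by apply: rpred_sum => j _; apply: rpredZ; apply: dhomogXU.
Qed.

Lemma substK C D a : D *m C = 1%:M -> subst C (subst D a) = a.
Proof.
move=> DC; have X i : subst C (subst D 'X_i) = 'X_i.
  rewrite substX rmorph_sum /=.
  transitivity (\sum_l (D *m C) i l *: ('X_l : poly3)).
    under eq_bigr => j _ do rewrite substZ substX scaler_sumr.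
    rewrite exchange_big; apply: eq_bigr => l _ /=; rewrite mxE scaler_suml.
    by apply: eq_bigr => j _; rewrite scalerA.
  rewrite DC (bigD1 i) //= big1 ?addr0 => [|l li]; first by rewrite mxE eqxx scale1r.
  by rewrite mxE eq_sym (negPf li) scale0r.
rewrite [a]mpolyE; transitivity (\sum_(m <- msupp a) subst C (subst D (a@_m *: 'X_[m]))).
  by rewrite -!rmorph_sum.
apply: eq_bigr => m _.
rewrite !substZ; congr (_ *: _); rewrite mpolyXE_id !rmorph_prod /=.
by apply: eq_bigr => i _; rewrite !rmorphXn /= X.
Qed.

Lemma subst_qpoly C B : subst C (qpoly B) = qpoly (C^T *m B *m C).
Proof.
rewrite /qpoly !sum3 !rmorphD /= !substZ !rmorphM /= !substX !sum3.
rewrite !mxE !sum3 !mxE !sum3 !mxE -!mul_mpolyC !(mpolyCD, mpolyCM); ring.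
Qed.

End Substitution.

Section TangentTransport.
Variable k : closedFieldType.
Hypothesis hk : 5%N \in [pchar k].
Local Notation poly3 := {mpoly k[3]}.
Local Notation "A ^f" := (map_mx (pFrobenius_aut hk) A).

(** The fifth power is additive, so the coefficients of the substituted sextic are the entries of
    [C^T *m C^f]. *)
Lemma subst_fermat C : unitary hk C -> subst C (fermat6 k) = fermat6 k.
Proof.
move=> uC; have n5P : 5 = 0 :> poly3.
  by rewrite -(rmorph_nat (@mpolyC 3 k)) n5 ?mpolyC0.
have pow5 (x y z : poly3) : (x + y + z) ^+ 5 = x ^+ 5 + y ^+ 5 + z ^+ 5.
  have p5 (r s : poly3) : (r + s) ^+ 5 = r ^+ 5 + s ^+ 5.
    have -> : (r + s) ^+ 5 = r ^+ 5 + s ^+ 5 +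
      5 * (r ^+ 4 * s + 2 * r ^+ 3 * s ^+ 2 + 2 * r ^+ 2 * s ^+ 3 + r * s ^+ 4) by ring.
    by rewrite n5P mul0r addr0.
  by rewrite !p5.
have scale_mul (a b : k) (x y : poly3) : (a *: x) * (b *: y) = (a * b) *: (x * y).
  by rewrite -scalerAl -scalerAr scalerA.
have l6 i : subst C ('X_i ^+ 6) = \sum_j \sum_l (C i j * C i l ^+ 5) *: ('X_j * 'X_l ^+ 5).
  rewrite rmorphXn /= substX exprS !sum3 pow5 !exprZn !mulrDl !mulrDr.
  by rewrite !scale_mul.
rewrite /fermat6 rmorph_sum /=; under eq_bigr => i _ do rewrite l6.
rewrite exchange_big; apply: eq_bigr => j _ /=.
rewrite exchange_big (bigD1 j) //= [X in _ + X]big1 ?addr0 => [|l lj].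
  rewrite -scaler_suml -exprS; move/matrixP: uC => /(_ j j); rewrite !mxE eqxx => E.
  rewrite (_ : \sum_i _ = 1) ?scale1r // -[RHS]E; apply: eq_bigr => i _.
  by rewrite !mxE pFrobenius_autE.
rewrite -scaler_suml; move/matrixP: uC => /(_ j l); rewrite !mxE eq_sym (negPf lj) => E.
rewrite (_ : \sum_i _ = 0) ?scale0r // -[RHS]E; apply: eq_bigr => i _.
by rewrite !mxE pFrobenius_autE.
Qed.

(** Substituting the inverse matrix extends to an automorphism of the fraction field that fixes the
    sextic, sends the form of the conic to that of its image, and sends the local ring at [p] to the
    one at the image point. *)
Lemma intersection_mult_im A B p n : unitary hk A ->
  intersection_mult (qpoly B) (fermat6 k) p n ->
  intersection_mult (qpoly ((invmx A)^T *m B *m invmx A)) (fermat6 k)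
    (PGL3_act (cl A) p) n.
Proof.
move=> uA; have uA' := unitary_unitmx uA; set C := invmx A.
have AC : A *m C = 1%:M by rewrite mulmxV.
have CA : C *m A = 1%:M by rewrite mulVmx.
have uC : unitary hk C := unitaryV uA.
have subst_inj D E : E *m D = 1%:M -> injective (@tofrac poly3 \o subst E).
  by move=> ED x y /= /eqP; rewrite tofrac_eq => /eqP /(congr1 (subst D)); rewrite !substK.
have [Phi PhiE] := fraction_lift (subst_inj A C CA).
have [Psi PsiE] := fraction_lift (subst_inj C A AC).
have liftK (F G : {rmorphism {fraction poly3} -> {fraction poly3}}) f g :
    (forall a, F (tofrac a) = tofrac (f a)) -> (forall a, G (tofrac a) = tofrac (g a)) ->
    (forall a, g (f a) = a :> poly3) -> cancel F G.
  move=> FE GE fg u; have [[a b] /= [_ ->]] := fraction_quot u.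
  by rewrite !fmorph_div !FE !GE !fg.
rewrite !intersection_multE => m2.
rewrite -subst_qpoly -{1}(subst_fermat uC).
have [c c0 pE] := vec_act p uA'.
apply: (@mult_transport _ _ _ (subst C) (subst A) Phi Psi PhiE PsiE _ _ _ _ _ p) m2.
- by apply: (liftK _ _ (subst C) (subst A)) => // a; apply: substK.
- by apply: (liftK _ _ (subst A) (subst C)) => // a; apply: substK.
- exact: substC.
- by move=> d a; apply: subst_homog.
- by move=> d a; apply: subst_homog.
- move=> d b hb; rewrite /vanishes (subst_eval _ _ (vec (PGL3_act (cl A) p))) pE -scalemxAr mulmxA CA mul1mx.
  have -> : b.@[fun i => (c *: vec p) i 0] = b.@[fun i => c * vec p i 0].
    by apply: meval_eq => i; rewrite mxE.
  rewrite (dhomog_meval_scale _ _ hb) => /eqP.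
  by rewrite mulf_eq0 expf_eq0 (negPf c0) andbF => /eqP.
- move=> d b hb; rewrite /vanishes (subst_eval _ _ (vec p)).
  have -> : b.@[fun i => (A *m vec p) i 0] = b.@[fun i => c^-1 * vec (PGL3_act (cl A) p) i 0].
    by apply: meval_eq => i; rewrite pE [in RHS]mxE mulKf.
  rewrite (dhomog_meval_scale _ _ hb) => /eqP.
  by rewrite mulf_eq0 expf_eq0 invr_eq0 (negPf c0) andbF => /eqP.
- exact: substK.
- exact: substK.
Qed.

Lemma im_Gamma A : unitary hk A -> im (cl A) (Gamma k) = Gamma k.
Proof. exact: unitary_aut. Qed.

Lemma imI (g : PGL3 k) S S' : im g (S `&` S') = im g S `&` im g S'.
Proof. by apply/seteqP; split => p; rewrite /setI /= !in_im. Qed.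

Lemma im_card (g : PGL3 k) S n : (S #= `I_n)%card -> (im g S #= `I_n)%card.
Proof.
apply: card_eq_trans; apply: inj_card_eq => p q _ _.
exact: (can_inj (PGL3_actK g)).
Qed.

Lemma tt_im A Q : unitary hk A -> totally_tangent_conic Q ->
  totally_tangent_conic (im (cl A) Q).
Proof.
move=> uA ttQ; have uA' := unitary_unitmx uA.
have [q [hq nsq QE Q6 Qm]] := ttQ; have two0 : (2 : k) != 0 by rewrite natr_neq0.
have [B BT qB] := dhomog2_qpoly two0 hq.
rewrite {}qB in hq nsq QE Qm.
set C := invmx A; pose B' := C^T *m B *m C.
have QB : Q = conic B by rewrite QE zeros_qpoly.
have B'T : B'^T = B' by rewrite /B' !trmx_mul trmxK BT mulmxA.
have imQ : im (cl A) Q = conic B' by rewrite QB im_conic.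
exists (qpoly B'); split.
- exact: qpoly_homog.
- move=> v v0; have Cv0 : C *m val v != 0.
    by apply: contraNneq (valP v) => Cv; rewrite -(mulKVmx uA' (val v)) -/C Cv mulmx0.
  have := nsq (exist _ (C *m val v) Cv0).
  have -> : (qpoly B).@[coords (exist _ (C *m val v) Cv0)] = 0.
    by rewrite -v0 -subst_qpoly; apply/esym; exact: (subst_eval C _ (val v)).
  case=> // i; rewrite (qpoly_deriv i (C *m val v) BT) mulf_eq0 negb_or => /andP[_ Bi].
  have : B' *m val v != 0.
    apply: contraNneq Bi => B'v; suff -> : B *m (C *m val v) = 0 by rewrite mxE.
    have uCT : C^T \in unitmx by rewrite unitmx_tr unitmx_inv.
    have E : C^T *m (B *m (C *m val v)) = 0 by rewrite !mulmxA.
    by rewrite -(mulKmx uCT (B *m _)) E mulmx0.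
  move=> B'v; have [j Bj] : exists j, (B' *m val v) j 0 != 0.
    apply/existsP; apply: contraNT B'v; rewrite negb_exists => /forallP z.
    by apply/eqP/matrixP => j l; rewrite ord1 [RHS]mxE; apply/eqP; have := z j; rewrite negbK.
  by exists j; rewrite (qpoly_deriv j (val v) B'T) mulf_neq0.
- by rewrite imQ zeros_qpoly.
- by rewrite -{1}(im_Gamma uA) -imI; apply: im_card.
- move=> p; rewrite -{1}(im_Gamma uA) -imI => -[q' Qq' <-].
  by apply: intersection_mult_im => //; apply: Qm.
Qed.

End TangentTransport.

(** * Diagonal forms, chords of conics and lines *)

Section Diagonal.
Variable k : fieldType.
Implicit Types (A B M : 'M[k]_3) (u v w x y : 'cV[k]_3).

Definition dg (a b c : k) : 'M[k]_3 := mx3 [:: [:: a; 0; 0]; [:: 0; b; 0]; [:: 0; 0; c]].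

Lemma dg1 : dg 1 1 1 = 1%:M.
Proof. by apply/matrixP; elim/I3P; elim/I3P; rewrite !mxE. Qed.

Lemma dgT a b c : (dg a b c)^T = dg a b c.
Proof. by apply/matrixP; elim/I3P; elim/I3P; rewrite !mxE. Qed.

Lemma dgZ m a b c : m *: dg a b c = dg (m * a) (m * b) (m * c).
Proof. by apply/matrixP; elim/I3P; elim/I3P; rewrite !mxE /= ?mulr0. Qed.

Lemma dgM a b c a' b' c' : dg a b c *m dg a' b' c' = dg (a * a') (b * b') (c * c').
Proof. by apply/matrixP; elim/I3P; elim/I3P; rewrite !mxE sum3 !mxE /=; ring. Qed.

Lemma dg_unit a b c : a != 0 -> b != 0 -> c != 0 -> dg a b c \in unitmx.
Proof.
move=> a0 b0 c0; suff : dg a b c *m dg a^-1 b^-1 c^-1 = 1%:M by case/mulmx1_unit.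
by rewrite dgM !divff ?dg1.
Qed.

Lemma unit_dg a b c : dg a b c \in unitmx -> [/\ a != 0, b != 0 & c != 0].
Proof.
move=> u; have K v : dg a b c *m v = 0 -> v = 0.
  by move=> e; rewrite -(mulKmx u v) e mulmx0.
split; apply/eqP => z.
- have /K/eqP : dg a b c *m cv3 1 0 0 = 0.
    by apply: cV3_eq; rewrite !mxE sum3 !mxE /= ?z; ring.
  by rewrite cv3_eq0 oner_eq0.
- have /K/eqP : dg a b c *m cv3 0 1 0 = 0.
    by apply: cV3_eq; rewrite !mxE sum3 !mxE /= ?z; ring.
  by rewrite cv3_eq0 oner_eq0 andbF.
- have /K/eqP : dg a b c *m cv3 0 0 1 = 0.
    by apply: cV3_eq; rewrite !mxE sum3 !mxE /= ?z; ring.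
  by rewrite cv3_eq0 oner_eq0 !andbF.
Qed.

Lemma dotDr u v w : dot u (v + w) = dot u v + dot u w.
Proof. by rewrite /dot mulmxDr mxE. Qed.
Lemma dotZr c u v : dot u (c *: v) = c * dot u v.
Proof. by rewrite /dot -scalemxAr mxE. Qed.
Lemma dotDl u v w : dot (u + v) w = dot u w + dot v w.
Proof. by rewrite !(dotC _ w) dotDr. Qed.
Lemma dotZl c u v : dot (c *: u) v = c * dot u v.
Proof. by rewrite !(dotC _ v) dotZr. Qed.
Lemma dot0r u : dot u 0 = 0. Proof. by rewrite /dot mulmx0 mxE. Qed.

Lemma dot_mulmx M u v : dot (M *m u) v = dot u (M^T *m v).
Proof. by rewrite /dot trmx_mul mulmxA. Qed.

Lemma cross0 u : cross u 0 = 0.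
Proof. by apply: cV3_eq; rewrite !mxE /=; ring. Qed.

Lemma dot_crossl u v : dot u (cross u v) = 0.
Proof. by rewrite dotE !mxE /=; ring. Qed.
Lemma dot_crossr u v : dot v (cross u v) = 0.
Proof. by rewrite dotE !mxE /=; ring. Qed.

Lemma cross_indep u v a b : cross u v != 0 -> a *: u + b *: v = 0 -> a = 0 /\ b = 0.
Proof.
move=> w0 E; split; apply/eqP; have := w0; apply: contraNT => ne.
  have : a *: cross u v = 0.
    rewrite -(cross0 v); move: E => /(congr1 (fun x => - cross v x)).
    rewrite cross0 oppr0 => <-; by apply: cV3_eq; rewrite !mxE /=; ring.
  by move/eqP; rewrite scaler_eq0 (negPf ne).
have : b *: cross u v = 0.
  move: E => /(congr1 (cross u)); rewrite cross0 => <-.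
  by apply: cV3_eq; rewrite !mxE /=; ring.
by move/eqP; rewrite scaler_eq0 (negPf ne).
Qed.

Lemma cols3_unit_cross u v x : dot x (cross u v) != 0 -> cols3 u v x \in unitmx.
Proof.
move=> xw; have w0 : cross u v != 0 by apply: contraNneq xw => ->; rewrite dot0r.
apply: cols3_unit => a b c E; have c0 : c = 0.
  have := dot0r (cross u v); rewrite -{}E dotC !dotDl !dotZl dot_crossl dot_crossr.
  by rewrite !mulr0 !add0r => /eqP; rewrite mulf_eq0 (negPf xw) orbF => /eqP.
by move: E; rewrite c0 scale0r addr0 => /(cross_indep w0)[-> ->].
Qed.

Lemma coplanar u v x : cross u v != 0 -> dot x (cross u v) = 0 ->
  exists a b, x = a *: u + b *: v.
Proof.
move=> w0 xw.
have [i ni] : exists i, cross u v i 0 != 0.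
  apply/existsP; apply: contraNT w0; rewrite negb_exists => /forallP z.
  by apply/eqP/matrixP => i j; rewrite ord1 [RHS]mxE; apply/eqP; have := z i; rewrite negbK.
exists (cross x v i 0 / cross u v i 0), (cross u x i 0 / cross u v i 0).
apply: (scalerI ni); rewrite scalerDr !scalerA ![cross u v i 0 * _]mulrC !divfK //.
have Z c : c * dot x (cross u v) = 0 by rewrite xw mulr0.
elim/I3P: i ni => _; apply: cV3_eq; rewrite !mxE /=; apply/eqP; rewrite -subr_eq0; apply/eqP;
 first [apply: etrans (Z 1); rewrite dotE !mxE /=; ring
       |apply: etrans (Z 0); rewrite dotE !mxE /=; ring].
Qed.

Lemma conic_mul A B : A \in unitmx -> im (cl A) (conic (A^T *m B *m A)) = conic B.
Proof.
move=> uA; rewrite im_conic //; congr conic.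
rewrite !mulmxA mulmxK // -trmx_mul mulmxV // trmx1 mul1mx //.
Qed.

(** A line meets a nondegenerate conic in at most two points: at x = a u + b v the form is 2 a b
    B(u, v), and B(u, v) is nonzero. *)
Lemma conic_not_collinear B u v x : 2 != 0 :> k -> B^T = B -> B \in unitmx -> u != 0 -> v != 0 ->
  cross u v != 0 -> cross u x != 0 -> cross v x != 0 ->
  form B u u = 0 -> form B v v = 0 -> form B x x = 0 -> dot x (cross u v) != 0.
Proof.
move=> two0 BT uB u0 v0 uv ux vx Bu Bv Bx; apply/eqP => /(coplanar uv)[a [b xE]].
have [c|r [buv _ _ _ _]] := @isotropic_pair _ B u v BT uB u0 v0 _ Bu Bv.
  by apply: contraNneq uv => ->; apply/eqP; apply: cV3_eq; rewrite !mxE /=; ring.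
move: Bx; rewrite form_dot xE mulmxDr -!scalemxAr !(dotDl, dotDr, dotZl, dotZr) -!form_dot.
rewrite Bu Bv (formC v u) // => E.
have : 2 * (a * (b * form B u v)) = 0 by rewrite -[RHS]E; ring.
move/eqP; rewrite !mulf_eq0 (negPf two0) (negPf buv) orbF /= => /orP[]/eqP z.
  by case/eqP: vx; rewrite xE z; apply: cV3_eq; rewrite !mxE /=; ring.
by case/eqP: ux; rewrite xE z; apply: cV3_eq; rewrite !mxE /=; ring.
Qed.

Definition polar u : set (P2 k) := [set p | dot (vec p) u = 0].

Lemma polarZ c u : c != 0 -> polar (c *: u) = polar u.
Proof.
move=> c0; apply/seteqP; split=> p; rewrite /polar /= dotZr; last by move=> ->; rewrite mulr0.
by move/eqP; rewrite mulf_eq0 (negPf c0) => /eqP.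
Qed.

Lemma cross_vec (p q : P2 k) : p <> q -> cross (vec p) (vec q) != 0.
Proof.
move=> pq; apply/eqP => /(cross_eq0 (vec_neq0 p))[c qE]; apply: pq; apply/esym.
apply: (vec_inj _ qE); apply: contraNneq (vec_neq0 q) => c0.
by rewrite qE c0 scale0r.
Qed.

Lemma line_polar (l : {mpoly k[3]}) : l \is 1.-homog -> l != 0 ->
  exists2 u, u != 0 & zeros l = polar u.
Proof.
move=> /dhomog1_linear[c lE] l0; exists (\col_i c i).
  apply: contraNneq l0 => c0; apply/eqP; rewrite lE big1 // => i _.
  have -> : c i = (\col_i c i : 'cV[k]_3) i 0 by rewrite mxE.
  by rewrite c0 mxE scale0r.
apply/seteqP; split=> p; rewrite /zeros /vanishes /polar /= lE dotE raddf_sum sum3 /=;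
  by rewrite !mevalZ !mevalXU !mxE ![c _ * _]mulrC.
Qed.

Lemma polar_line u : u != 0 -> is_line (polar u).
Proof.
move=> u0; exists (\sum_i u i 0 *: 'X_i); split.
- by apply: rpred_sum => i _; apply: rpredZ; apply: dhomogXU.
- apply: contraNneq u0 => E; apply/eqP/matrixP => i j; rewrite ord1 [RHS]mxE.
  have := congr1 (fun q : {mpoly k[3]} => q.@[fun l => (l == i)%:R]) E.
  rewrite meval0 raddf_sum /= (bigD1 i) //= mevalZ mevalXU eqxx mulr1 big1 ?addr0 // => l li.
  by rewrite mevalZ mevalXU (negPf li) mulr0.
- apply/seteqP; split=> p; rewrite /zeros /vanishes /polar /= dotE raddf_sum sum3 /=;
  by rewrite !mevalZ !mevalXU ![u _ 0 * _]mulrC.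
Qed.

End Diagonal.

(** * Adjacent pairs of conics *)

Section Secants.
Variable k : closedFieldType.
Hypothesis hk : 5%N \in [pchar k].
Local Notation "A ^f" := (map_mx (pFrobenius_aut hk) A).
Implicit Types (A B M : 'M[k]_3) (u v w : 'cV[k]_3) (Q L : set (P2 k)).

Lemma dotF u v : dot (u^f) (v^f) = dot u v ^+ 5.
Proof.
have := congr1 (fun M : 'M[k]_1 => M 0 0) (mxFM hk u^T v).
by rewrite mxFT mxE pFrobenius_autE => ->.
Qed.

(** The cross product of the coordinate vectors of two F_25-points gives the line an equation over
    F_25, that is, one fixed by the squared Frobenius. *)
Lemma special_line L : special_secant L ->
  exists u, [/\ u != 0, u^f^f = u & L = polar u].
Proof.
move=> [[l [hl l0 LE]] [p [q [pq [_ [v pv vF]] [_ [w qw wF]] Lp Lq]]]].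
have [u u0 lu] := line_polar hl l0.
have rat (x : nzvec k) : (forall i, coords x i ^+ 25 = coords x i) -> (val x)^f^f = val x.
  move=> xF; apply/matrixP => i j; rewrite ord1 !mxE !pFrobenius_autE -exprM.
  exact: xF.
have [c c0 pE] := repr_point v; have [d d0 qE] := repr_point w.
have vw0 : cross (val v) (val w) != 0.
  apply/eqP => vw; have /eqP := cross_vec pq; apply.
  rewrite /vec pv qw pE qE; transitivity (c * d *: cross (val v) (val w)).
    by apply: cV3_eq; rewrite !mxE /=; ring.
  by rewrite vw scaler0.
have on (x : nzvec k) : L (point x) -> dot (val x) u = 0.
  rewrite LE lu /polar /= /vec; have [e e0 ->] := repr_point x; rewrite dotZl => /eqP.
  by rewrite mulf_eq0 (negPf e0) => /eqP.
have [||e uE] := @orth_cross _ u (val v) (val w) _ _ vw0.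
- by rewrite dotC on // -pv.
- by rewrite dotC on // -qw.
have e0 : e != 0 by apply: contraNneq u0 => e0; rewrite uE e0 scale0r.
exists (cross (val v) (val w)); split=> //; last by rewrite LE lu uE polarZ.
have crossF x y : (cross x y)^f = cross (x^f) (y^f).
  by apply: cV3_eq; rewrite !mxE /= rmorphB !rmorphM.
by rewrite !crossF !rat.
Qed.

Definition tangential B Q := forall p, (Q `&` Gamma k) p ->
  exists2 c, c != 0 & B *m vec p = c *: (vec p)^f.

(* A common secant of the curve and the conic has the same pole with respect to
   both, because the tangents at its two points of contact agree. *)
Lemma secant_pole B Q u : B^T = B -> B \in unitmx -> Q = conic B -> tangential B Q ->
  u != 0 -> secants Q (polar u) ->
  (exists a, B *m u^f = a *: u) /\
  exists v, [/\ v != 0, dot v u = 0, form B v v = 0 & dot v v^f = 0].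
Proof.
move=> BT uB QE tQ u0 [_ [p [q [pq Qp Qq Lp Lq]]]].
split; last first.
  exists (vec p); split=> //; first exact: vec_neq0.
    by have [+ _] := Qp; rewrite QE /conic /= mx11_eq0.
  by have [_ /(GammaE hk)/mx11_eq0] := Qp.
have w0 := cross_vec pq.
have on r : (Q `&` Gamma k) r -> polar u r -> dot (B *m u^f) (vec r) = 0.
  move=> /tQ[c c0 Br] ur; rewrite dot_mulmx BT Br dotZr dotF dotC ur.
  by rewrite expr0n mulr0.
have [a aE] := orth_cross (on p Qp Lp) (on q Qq Lq) w0.
have [||b bE] := @orth_cross _ u _ _ _ _ w0; rewrite 1?dotC //.
have b0 : b != 0 by apply: contraNneq u0 => b0; rewrite bE b0 scale0r.
by exists (a / b); rewrite aE bE scalerA divfK.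
Qed.

End Secants.

Section Adjacency.
Variable k : closedFieldType.
Hypothesis hk : 5%N \in [pchar k].
Variable w : k.
Hypothesis hw : w ^+ 2 + w + 1 = 0.
Local Notation "A ^f" := (map_mx (pFrobenius_aut hk) A).
Implicit Types (A B M W : 'M[k]_3) (u v : 'cV[k]_3) (Q L : set (P2 k)).

Definition NF Q Q' := exists A, [/\ unitary hk A, Q = im (cl A) (conic 1%:M)
  & Q' = im (cl A) (conic (dg 1 w (w ^+ 2)))].

Lemma w3 : w ^+ 3 = 1.
Proof.
have -> : w ^+ 3 = (w - 1) * (w ^+ 2 + w + 1) + 1 by ring.
by rewrite hw mulr0 add0r.
Qed.

Lemma w0 : w != 0.
Proof. by apply/eqP => z; have /eqP := w3; rewrite z expr0n eq_sym oner_eq0. Qed.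

Lemma two0 : (2 : k) != 0. Proof. by rewrite natr_neq0. Qed.

Lemma w1 : w != 1.
Proof.
apply/eqP => z; have /eqP : (3 : k) = 0 by rewrite -hw z; ring.
by apply/negP; rewrite natr_neq0.
Qed.

Lemma w21 : w ^+ 2 != 1.
Proof. by apply: contra_neq w1 => e; rewrite -w3 exprSr e mul1r. Qed.

Lemma w2w : w ^+ 2 != w.
Proof.
apply: contra_neq w1 => e; apply: (mulfI w0); by rewrite mulr1 -expr2.
Qed.

Lemma cube_root g : g ^+ 3 = 1 -> g != 1 -> g = w \/ g = w ^+ 2.
Proof.
move=> g3 g1; have g2 : g ^+ 2 + g + 1 = 0.
  have g1' : g - 1 != 0 by rewrite subr_eq0.
  apply: (mulfI g1'); rewrite mulr0; transitivity (g ^+ 3 - 1); first ring.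
  by rewrite g3 subrr.
have /eqP : (g - w) * (g - w ^+ 2) = 0.
  transitivity (g ^+ 2 + g + 1 + (w - 1 - g) * (w ^+ 2 + w + 1)); first ring.
  by rewrite g2 hw mulr0 addr0.
by rewrite mulf_eq0 !subr_eq0 => /orP[]/eqP; [left|right].
Qed.

Lemma unitary_dg a b c : a ^+ 6 = 1 -> b ^+ 6 = 1 -> c ^+ 6 = 1 -> unitary hk (dg a b c).
Proof.
move=> a6 b6 c6; rewrite /unitary dgT.
have -> : (dg a b c)^f = dg (a ^+ 5) (b ^+ 5) (c ^+ 5).
  by apply/matrixP; elim/I3P; elim/I3P; rewrite !mxE /= ?pFrobenius_autE ?expr0n.
by rewrite dgM -!exprS a6 b6 c6 dg1.
Qed.

Lemma dg_conj W B a b c x y z : W^T *m B *m W = dg a b c ->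
  (W *m dg x y z)^T *m B *m (W *m dg x y z) = dg (a * x ^+ 2) (b * y ^+ 2) (c * z ^+ 2).
Proof.
move=> E; rewrite trmx_mul dgT !mulmxA -(mulmxA (dg _ _ _)) -(mulmxA (dg _ _ _)) E.
by rewrite !dgM; congr dg; ring.
Qed.

Lemma conic_dg Q B W b : unitary hk W -> Q = conic B -> b != 0 ->
  forall D, W^T *m B *m W = b *: D -> Q = im (cl W) (conic D).
Proof.
move=> uW -> b0 D E; rewrite -(conic_mul B (unitary_unitmx uW)) E conicZ //.
Qed.

(** The ratios [m1] and [m2] are cube roots of unity, so rescaling the frame by them keeps it
    unitary and replaces b_i by b_i m_i^2 = b0 m_i^3 = b0. The second conic becomes proportional to
    diag(1, g1, g2) with 1, [g1] and [g2] distinct cube roots of unity. *)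
Lemma diag_NF Q Q' B B' W (b0 b1 b2 c0 c1 c2 : k) : unitary hk W ->
  Q = conic B -> Q' = conic B' -> W^T *m B *m W = dg b0 b1 b2 ->
  W^T *m B' *m W = dg c0 c1 c2 -> b0 != 0 -> c0 != 0 ->
  b1 ^+ 3 = b0 ^+ 3 -> b2 ^+ 3 = b0 ^+ 3 -> c1 ^+ 3 = c0 ^+ 3 -> c2 ^+ 3 = c0 ^+ 3 ->
  b0 * c1 != b1 * c0 -> b0 * c2 != b2 * c0 -> b1 * c2 != b2 * c1 -> NF Q Q'.
Proof.
move=> uW QB QB' WB WB' b00 c00 b13 b23 c13 c23 d01 d02 d12.
pose m1 := b1 / b0; pose m2 := b2 / b0.
have m13 : m1 ^+ 3 = 1 by rewrite expr_div_n b13 divff ?expf_neq0.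
have m23 : m2 ^+ 3 = 1 by rewrite expr_div_n b23 divff ?expf_neq0.
pose D := dg 1 m1 m2; pose W1 := W *m D.
have uW1 : unitary hk W1.
  apply: unitaryM => //; apply: unitary_dg; rewrite ?expr1n //;
  by rewrite -[6%N]/(3 * 2)%N exprM ?m13 ?m23 expr1n.
have W1B : W1^T *m B *m W1 = b0 *: 1%:M.
  rewrite (dg_conj _ _ _ WB) -dg1 dgZ; congr dg; first ring.
    by rewrite mulr1 -[RHS]mulr1 -m13 /m1; field.
  by rewrite mulr1 -[RHS]mulr1 -m23 /m2; field.
pose g1 := c1 * m1 ^+ 2 / c0; pose g2 := c2 * m2 ^+ 2 / c0.
have W1B' : W1^T *m B' *m W1 = c0 *: dg 1 g1 g2.
  rewrite (dg_conj _ _ _ WB') dgZ; congr dg; first ring.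
    by rewrite /g1; field.
  by rewrite /g2; field.
clearbody W1.
have g13 : g1 ^+ 3 = 1.
  rewrite /g1 expr_div_n exprMn -exprM mulnC exprM m13 expr1n mulr1 c13 divff //.
  by rewrite expf_neq0.
have g23 : g2 ^+ 3 = 1.
  rewrite /g2 expr_div_n exprMn -exprM mulnC exprM m23 expr1n mulr1 c23 divff //.
  by rewrite expf_neq0.
have m1E : b0 * c1 * m1 ^+ 3 = b1 * (c1 * m1 ^+ 2) by rewrite /m1; field.
have m2E : b0 * c2 * m2 ^+ 3 = b2 * (c2 * m2 ^+ 2) by rewrite /m2; field.
rewrite m13 mulr1 in m1E; rewrite m23 mulr1 in m2E.
have g11 : g1 != 1.
  apply: contra_neq d01 => e; rewrite m1E; congr (_ * _).
  by rewrite -[RHS]mul1r -e /g1 divfK.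
have g21 : g2 != 1.
  apply: contra_neq d02 => e; rewrite m2E; congr (_ * _).
  by rewrite -[RHS]mul1r -e /g2 divfK.
have g12 : g1 != g2.
  apply: contra_neq d12 => e.
  have E : c1 * m1 ^+ 2 = c2 * m2 ^+ 2 by apply: (mulIf (invr_neq0 c00)).
  have : b2 * (b0 * c1) = b1 * (b0 * c2) by rewrite m1E m2E E; ring.
  by move=> e2; apply: (mulfI b00); rewrite mulrCA -e2 mulrCA.
have QW : Q = im (cl W1) (conic 1%:M) by apply: conic_dg uW1 QB b00 _ W1B.
have [g1w|g1w] := cube_root g13 g11; have [g2w|g2w] := cube_root g23 g21.
- by rewrite g1w g2w eqxx in g12.
- exists W1; split=> //; apply: conic_dg uW1 QB' c00 _ _.
  by rewrite W1B' g1w g2w.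
(* The two roots come in the opposite order; swapping the last two coordinates exchanges them. *)
- pose P : 'M[k]_3 := mx3 [:: [:: 1; 0; 0]; [:: 0; 0; 1]; [:: 0; 1; 0]].
  have PT : P^T = P by apply/matrixP; elim/I3P; elim/I3P; rewrite !mxE.
  have PP : P *m P = 1%:M.
    by apply/matrixP; elim/I3P; elim/I3P; rewrite !mxE sum3 !mxE /=; ring.
  have uP : unitary hk P.
    rewrite /unitary PT (_ : P^f = P) //.
    by apply/matrixP; elim/I3P; elim/I3P; rewrite !mxE /= ?rmorph0 ?rmorph1.
  have uWP : unitary hk (W1 *m P) by apply: unitaryM.
  exists (W1 *m P); split=> //.
    apply: conic_dg uWP QB b00 _ _.
    rewrite trmx_mul PT !mulmxA -(mulmxA P) -(mulmxA P) W1B -scalemxAr -scalemxAl.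
    by rewrite mulmx1 PP.
  apply: conic_dg uWP QB' c00 _ _.
  rewrite trmx_mul PT !mulmxA -(mulmxA P) -(mulmxA P) W1B' -scalemxAr -scalemxAl.
  congr (_ *: _); rewrite g1w g2w.
  by apply/matrixP; elim/I3P; elim/I3P; rewrite !mxE !sum3 !mxE !sum3 !mxE /=; ring.
- by rewrite g1w g2w eqxx in g12.
Qed.

Lemma adj_NF Q Q' : totally_tangent_conic Q -> totally_tangent_conic Q' -> Q <> Q' ->
  (Q `&` Q' #= `I_4)%card -> (secants Q `&` secants Q' #= `I_3)%card -> NF Q Q'.
Proof.
move=> /tt_conic-/(_ hk)[B [BT uB QB _ tQ]] /tt_conic-/(_ hk)[B' [B'T uB' QB' _ tQ']] QQ'.
move=> /card_I_enum[p4 [p4_inj p4Q]] /card_I_enum[L [L_inj LQ]].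
have /choice[u uP] : forall i, exists u, [/\ u != 0, u^f^f = u & L i = polar u].
  by move=> i; have [[/(special_line hk)]] := LQ i.
have un0 i : u i != 0 by have [] := uP i.
(* The pole of the secant for the Hermitian form: [u i] is fixed by the squared Frobenius, so
   [herm v (x i)] is the pairing of [v] with [u i]. *)
pose x i := (u i)^f; have xF i : (x i)^f = u i by have [] := uP i.
have xn0 i : x i != 0 by apply: contraNneq (un0 i) => z; rewrite -xF z map_mx0.
have poleQ i : (exists a, B *m x i = a *: u i) /\
    exists v, [/\ v != 0, dot v (u i) = 0, form B v v = 0 & dot v v^f = 0].
  apply: (secant_pole BT uB QB tQ) => //.
  by have [_ _ <-] := uP i; have [] := LQ i.
have poleQ' i : (exists a, B' *m x i = a *: u i) /\
    exists v, [/\ v != 0, dot v (u i) = 0, form B' v v = 0 & dot v v^f = 0].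
  apply: (secant_pole B'T uB' QB' tQ') => //.
  by have [_ _ <-] := uP i; have [] := LQ i.
have /choice[a aE] : forall i, exists a, B *m x i = a *: u i by move=> i; have [] := poleQ i.
have /choice[a' a'E] : forall i, exists a, B' *m x i = a *: u i by move=> i; have [] := poleQ' i.
have an0 (C : 'M[k]_3) (e : 'I_3 -> k) : C \in unitmx -> (forall i, C *m x i = e i *: u i) ->
    forall i, e i != 0.
  move=> uC E i; apply: contraNneq (xn0 i) => z.
  by rewrite -(mulKmx uC (x i)) E z scale0r mulmx0.
have a0 := an0 _ _ uB aE; have a'0 := an0 _ _ uB' a'E.
have cross_x i j : i != j -> cross (x i) (x j) != 0.
  move=> ij; apply/eqP => /(cross_eq0 (xn0 i))[c xE].
  case/eqP: ij; apply: L_inj; have [_ _ ->] := uP i; have [_ _ ->] := uP j.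
  rewrite -(xF j) xE mxFZ xF polarZ // expf_neq0 //.
  by apply: contraNneq (xn0 j) => c0; rewrite xE c0 scale0r.
have cross_u i j : i != j -> cross (u i) (u j) != 0.
  move=> ij; apply/eqP => /(cross_eq0 (un0 i))[c uE].
  have := cross_x i j ij; rewrite /x uE mxFZ => /eqP; apply.
  by apply: cV3_eq; rewrite !mxE /=; ring.
(* Equal ratios would give a member of the pencil of the two conics that kills two poles. It has
   rank 1, so it is a double line containing all common points; but no three points of a conic are
   collinear. *)
have dist i j : i != j -> a i * a' j != a j * a' i.
  move=> ij; apply/eqP => aa; pose M := a j *: B' - a' j *: B.
  have MT : M^T = M by rewrite /M linearB !linearZ /= BT B'T.
  have Mx l : l = i \/ l = j -> M *m x l = 0.
    rewrite /M mulmxBl -!scalemxAl aE a'E !scalerA -scalerBl.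
    by case=> ->; [rewrite -aa mulrC subrr scale0r | rewrite mulrC subrr scale0r].
  have M0 : M != 0.
    apply/eqP => /eqP; rewrite subr_eq0 => /eqP E; apply: QQ'.
    have : conic (a j *: B') = conic (a' j *: B) by rewrite E.
    by rewrite !conicZ // QB QB'.
  pose n := cross (x i) (x j); have n0 : n != 0 := cross_x i j ij.
  have onn p : (Q `&` Q') p -> dot (vec p) n = 0.
    move=> [Qp Q'p]; apply/eqP/negPn/negP => dn.
    have Mv : form M (vec p) (vec p) = 0.
      move: Qp Q'p; rewrite QB QB' /conic /= !mx11_eq0 -/(form _ _ _) -/(form _ _ _) => e e'.
      rewrite form_dot /M mulmxBl -!scalemxAl -scaleNr dotDr !dotZr -!form_dot e e'.
      by rewrite !mulr0 addr0.
    have [||s sE] := @orth_cross _ (M *m vec p) (x i) (x j) _ _ n0.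
    - by rewrite dot_mulmx MT Mx ?dot0r; [|left].
    - by rewrite dot_mulmx MT Mx ?dot0r; [|right].
    have s0 : s = 0.
      apply/eqP; move: Mv; rewrite form_dot sE dotZr => /eqP.
      by rewrite mulf_eq0 (negPf dn) orbF.
    have uX := cols3_unit_cross dn.
    case/eqP: M0; rewrite -(mulmxK uX M) mulmx_cols3 !Mx; [|by right|by left].
    rewrite sE s0 scale0r (_ : cols3 _ _ _ = 0) ?mul0mx //.
    by apply/matrixP => l; elim/I3P; rewrite !mxE.
  pose v (m : nat) := vec (p4 (inord m)).
  have vv m m' : (m < 4)%N -> (m' < 4)%N -> m != m' -> cross (v m) (v m') != 0.
    move=> lm lm' mm; apply: cross_vec => /p4_inj/(congr1 val).
    by rewrite /= !inordK // => /eqP; rewrite (negPf mm).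
  have c01 := vv 0%N 1%N isT isT isT; have c02 := vv 0%N 2%N isT isT isT.
  have c12 := vv 1%N 2%N isT isT isT.
  have Bv m : form B (v m) (v m) = 0.
    by have [+ _] := p4Q (inord m); rewrite QB /conic /= mx11_eq0.
  have := conic_not_collinear two0 BT uB (vec_neq0 _) (vec_neq0 _) c01 c02 c12 (Bv _) (Bv _) (Bv _).
  have [||c nE] := @orth_cross _ n (v 0%N) (v 1%N) _ _ c01.
  - by rewrite dotC onn.
  - by rewrite dotC onn.
  have cn0 : c != 0 by apply: contraNneq n0 => c0; rewrite nE c0 scale0r.
  apply/negP/negPn; have := onn _ (p4Q (inord 2)); rewrite nE dotZr => /eqP.
  by rewrite mulf_eq0 (negPf cn0).
(* Each of the symmetric forms [B] and [B'] gives a linear relation between the pairings of [x i]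
   with [u j] and of [x j] with [u i]. By [dist] the two relations are independent. *)
have orth i j : i != j -> dot (x i) (u j) = 0.
  move=> ij.
  have e1 : a j * dot (x i) (u j) = form B (x i) (x j) by rewrite form_dot aE dotZr.
  have e2 : a' j * dot (x i) (u j) = form B' (x i) (x j) by rewrite form_dot a'E dotZr.
  have f1 : a i * dot (x j) (u i) = form B (x i) (x j) by rewrite formC // form_dot aE dotZr.
  have f2 : a' i * dot (x j) (u i) = form B' (x i) (x j) by rewrite formC // form_dot a'E dotZr.
  have : (a i * a' j - a j * a' i) * dot (x i) (u j) = 0.
    transitivity (a i * (a' j * dot (x i) (u j)) - a' i * (a j * dot (x i) (u j))); first ring.
    by rewrite e1 e2 -f1 -f2; ring.
  by move/eqP; rewrite mulf_eq0 subr_eq0 (negPf (dist _ _ ij)) => /eqP.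
pose h i := dot (x i) (u i).
have BE i : form B (x i) (x i) = a i * h i by rewrite form_dot aE dotZr.
have BE' i : form B' (x i) (x i) = a' i * h i by rewrite form_dot a'E dotZr.
have Bo i j : i != j -> form B (x i) (x j) = 0 by move=> ij; rewrite form_dot aE dotZr orth ?mulr0.
have Bo' i j : i != j -> form B' (x i) (x j) = 0.
  by move=> ij; rewrite form_dot a'E dotZr orth ?mulr0.
pose W := cols3 (x i0) (x i1) (x i2).
have WB : W^T *m B *m W = dg (a i0 * h i0) (a i1 * h i1) (a i2 * h i2).
  by rewrite cols3_form !BE !Bo.
have WB' : W^T *m B' *m W = dg (a' i0 * h i0) (a' i1 * h i1) (a' i2 * h i2).
  by rewrite cols3_form !BE' !Bo'.
have WH : W^T *m W^f = dg (h i0) (h i1) (h i2).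
  rewrite -[W^T]mulmx1 cols3_Frob cols3_form !xF.
  have f1 y z : form 1%:M y z = dot y z by rewrite /form mulmx1.
  by rewrite !f1 -/(h _) -/(h _) -/(h _) !orth.
have uW : W \in unitmx.
  apply: cols3_unit => y0 y1 y2 E.
  have E1 : (y0 * a i0) *: u i0 + (y1 * a i1) *: u i1 + (y2 * a i2) *: u i2 = 0.
    by rewrite -!scalerA -!aE !scalemxAr -!mulmxDr E mulmx0.
  have E2 : (y0 * a' i0) *: u i0 + (y1 * a' i1) *: u i1 + (y2 * a' i2) *: u i2 = 0.
    by rewrite -!scalerA -!a'E !scalemxAr -!mulmxDr E mulmx0.
  have [] : y1 * (a i0 * a' i1 - a i1 * a' i0) = 0 /\ y2 * (a i0 * a' i2 - a i2 * a' i0) = 0.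
    apply: (cross_indep (cross_u i1 i2 isT)).
    transitivity (a i0 *: ((y0 * a' i0) *: u i0 + (y1 * a' i1) *: u i1 + (y2 * a' i2) *: u i2)
      - a' i0 *: ((y0 * a i0) *: u i0 + (y1 * a i1) *: u i1 + (y2 * a i2) *: u i2)).
      by apply: cV3_eq; rewrite !mxE /=; ring.
    by rewrite E1 E2 !scaler0 subrr.
  move=> /eqP; rewrite mulf_eq0 subr_eq0 (negPf (dist i0 i1 isT)) orbF => /eqP y10.
  move=> /eqP; rewrite mulf_eq0 subr_eq0 (negPf (dist i0 i2 isT)) orbF => /eqP y20.
  move: E; rewrite y10 y20 !scale0r !addr0 => /eqP.
  by rewrite scaler_eq0 (negPf (xn0 _)) orbF => /eqP.
have h0 i : h i != 0.
  have : W^T *m W^f \in unitmx by rewrite unitmx_mul unitmx_tr map_unitmx uW.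
  by rewrite WH => /unit_dg[? ? ?]; elim/I3P: i.
(* A contact point on the secant is a combination of the other two poles, with coordinates y_j and
   y_l. Eliminating them between y_j^2 e_j h_j + y_l^2 e_l h_l = 0 (conic) and y_j^6 h_j + y_l^6 h_l
   = 0 (sextic) leaves this relation. *)
have cubes (C : 'M[k]_3) (e : 'I_3 -> k) : (forall i, C *m x i = e i *: u i) ->
    (forall i, exists v, [/\ v != 0, dot v (u i) = 0, form C v v = 0 & dot v v^f = 0]) ->
    forall i j l, uniq [:: i; j; l] -> e j ^+ 3 * h j ^+ 2 = e l ^+ 3 * h l ^+ 2.
  move=> CE secC i j l ijl; have [v [v0 vu Cv vv]] := secC i.
  pose y := invmx W *m v; have vE : v = \sum_n y n 0 *: x n.
    rewrite sum3 -cols3_mul -cv3E; by rewrite /y mulKVmx.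
  have [ij il jl] : [/\ i != j, i != l & j != l].
    by move: ijl; rewrite /= !inE negb_or andbT => /andP[/andP[-> ->] ->].
  have yi : y i 0 = 0.
    move: vu; rewrite vE (sum3_uniq _ ijl) !dotDl !dotZl -/(h i) !orth 1?eq_sym //.
    by rewrite !mulr0 !addr0 => /eqP; rewrite mulf_eq0 (negPf (h0 i)) orbF => /eqP.
  have {}vE : v = y j 0 *: x j + y l 0 *: x l.
    by rewrite vE (sum3_uniq _ ijl) yi scale0r add0r.
  have Fv : v^f = y j 0 ^+ 5 *: u j + y l 0 ^+ 5 *: u l.
    by rewrite vE map_mxD !mxFZ !xF.
  have E1 : y j 0 ^+ 2 * (e j * h j) + y l 0 ^+ 2 * (e l * h l) = 0.
    rewrite -[RHS]Cv form_dot vE mulmxDr -!scalemxAr !CE !(dotDl, dotDr, dotZl, dotZr).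
    rewrite (orth j l) // (orth l j) 1?eq_sym // /h; ring.
  have E2 : y j 0 ^+ 6 * h j + y l 0 ^+ 6 * h l = 0.
    rewrite -[RHS]vv Fv {1}vE !(dotDl, dotDr, dotZl, dotZr).
    rewrite (orth j l) // (orth l j) 1?eq_sym // /h; ring.
  have yj : y j 0 != 0.
    apply: contraNneq v0 => yj0; move: E2; rewrite yj0 expr0n mul0r add0r => /eqP.
    rewrite mulf_eq0 (negPf (h0 l)) orbF expf_eq0 => /eqP yl0.
    by rewrite vE yj0 yl0 !scale0r addr0.
  have E1' : y j 0 ^+ 2 * (e j * h j) = - (y l 0 ^+ 2 * (e l * h l)).
    by apply/eqP; rewrite -addr_eq0 E1.
  have E2' : y l 0 ^+ 6 * h l = - (y j 0 ^+ 6 * h j).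
    by apply/eqP; rewrite -addr_eq0 addrC E2.
  apply: (mulfI (expf_neq0 6 yj)); apply: (mulfI (h0 j)).
  transitivity ((y j 0 ^+ 2 * (e j * h j)) ^+ 3); first ring.
  rewrite E1'; transitivity (- (y l 0 ^+ 6 * h l) * (e l ^+ 3 * h l ^+ 2)); first ring.
  rewrite E2'; ring.
(* Sixth roots make the frame unitary. The diagonal entries then have cubes e^3 h^2 by [cube_m], and
   these agree by [cubes]. *)
have /choice[m mE] : forall i, exists m, m ^+ 6 = (h i)^-1 by move=> i; apply: nth_root.
have m0 i : m i != 0.
  by apply/eqP => z; have := mE i; rewrite z expr0n => /eqP; rewrite eq_sym invr_eq0 (negPf (h0 i)).
pose D := dg (m i0) (m i1) (m i2).
have uWD : unitary hk (W *m D).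
  rewrite /unitary mxFM trmx_mul dgT !mulmxA -(mulmxA D) WH.
  have -> : D^f = dg (m i0 ^+ 5) (m i1 ^+ 5) (m i2 ^+ 5).
    by apply/matrixP; elim/I3P; elim/I3P; rewrite !mxE /= ?pFrobenius_autE ?expr0n.
  rewrite !dgM -dg1; congr dg; rewrite mulrAC -exprS mE mulVf //.
have cube_m (e : 'I_3 -> k) i : (e i * h i * m i ^+ 2) ^+ 3 = e i ^+ 3 * h i ^+ 2.
  transitivity (e i ^+ 3 * h i ^+ 3 * m i ^+ 6); first ring.
  by rewrite mE; field.
have cB := cubes B a aE (fun i => (poleQ i).2); have cB' := cubes B' a' a'E (fun i => (poleQ' i).2).
have hm0 i : h i * m i ^+ 2 != 0 by rewrite mulf_neq0 ?expf_neq0.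
have dist' i j : i != j -> a i * h i * m i ^+ 2 * (a' j * h j * m j ^+ 2) !=
    a j * h j * m j ^+ 2 * (a' i * h i * m i ^+ 2).
  move=> /dist; apply: contra_neq => E; apply: (mulIf (hm0 i)); apply: (mulIf (hm0 j)).
  transitivity (a i * h i * m i ^+ 2 * (a' j * h j * m j ^+ 2)); first ring.
  by rewrite E; ring.
apply: (diag_NF uWD QB QB' (dg_conj _ _ _ WB) (dg_conj _ _ _ WB')).
- by rewrite -mulrA mulf_neq0.
- by rewrite -mulrA mulf_neq0.
- by rewrite !cube_m (cB i2 i1 i0).
- by rewrite !cube_m (cB i1 i2 i0).
- by rewrite !cube_m (cB' i2 i1 i0).
- by rewrite !cube_m (cB' i1 i2 i0).
- exact: dist'.
- exact: dist'.
- exact: dist'.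
Qed.

End Adjacency.

(** * Adjacency of pairs in normal form *)

Section NormalFormAdjacent.
Variable k : closedFieldType.
Hypothesis hk : 5%N \in [pchar k].
Local Notation "A ^f" := (map_mx (pFrobenius_aut hk) A).
Implicit Types (A B M W : 'M[k]_3) (u v : 'cV[k]_3) (Q L : set (P2 k)).

Lemma five0 (c : k) : 5 * c = 0. Proof. by rewrite n5 // mul0r. Qed.

(** As 4 + 1 = 0, the conic contains (2s, 1, 0), (2s, 0, 1) and (0, 2s, 1) for s = 1 and s = -1.
    Subtracting the two conditions kills an off-diagonal entry, and what remains equates two
    diagonal ones. *)
Lemma conic1_scalar B : B^T = B -> conic 1%:M `<=` conic B -> B = (B i0 i0)%:M.
Proof.
move=> BT sub.
have ev x y z : x ^+ 2 + y ^+ 2 + z ^+ 2 = 0 -> cv3 x y z != 0 ->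
    form B (cv3 x y z) (cv3 x y z) = 0.
  move=> e v0; have [p [c c0 pE]] := point_vec v0.
  have /sub/(conic_vec _ c0 pE)/mx11_eq0 // : conic 1%:M p.
  by apply/(conic_vec _ c0 pE); rewrite mulmx1 mx11_eq0 -/(dot _ _) dotE !mxE /= -e; ring.
have B10 : B i1 i0 = B i0 i1 by rewrite -{1}BT mxE.
have B20 : B i2 i0 = B i0 i2 by rewrite -{1}BT mxE.
have B21 : B i2 i1 = B i1 i2 by rewrite -{1}BT mxE.
have nz (a b c : k) : [|| a == 1, b == 1 | c == 1] -> cv3 a b c != 0.
  move=> abc; rewrite cv3_eq0; apply: contraTN abc => /and3P[/eqP-> /eqP-> /eqP->].
  by rewrite !(eq_sym 0) !oner_eq0.
have sq s : s = 1 \/ s = - 1 -> (2 * s) ^+ 2 + 1 ^+ 2 = 0 :> k.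
  by case=> ->; apply: etrans (five0 1); ring.
have off a b c : (forall s, s = 1 \/ s = - 1 -> (2 * s) ^+ 2 * a + 2 * (2 * s) * b + c = 0) ->
    b = 0 /\ a = c :> k.
  move=> H; have h1 := H 1 (or_introl erefl); have h2 := H (- 1) (or_intror erefl).
  have b0 : b = 0.
    apply: (mulfI (natr_neq0 hk (isT : ~~ (5 %| 8)%N))); rewrite mulr0.
    by rewrite -[RHS](subrr 0) -{1}h1 -h2; ring.
  split=> //; apply/eqP; rewrite -subr_eq0; apply/eqP.
  rewrite -[RHS]subr0 -{1}(five0 a) -h1 b0; ring.
have [b01 d01] : B i0 i1 = 0 /\ B i0 i0 = B i1 i1.
  apply: off => s hs; have e : (2 * s) ^+ 2 + 1 ^+ 2 + 0 ^+ 2 = 0 :> k by rewrite sq // expr0n addr0.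
  by rewrite -[RHS](ev _ _ _ e) ?nz ?eqxx ?orbT // /form form3E !mxE /= B10; ring.
have [b02 d02] : B i0 i2 = 0 /\ B i0 i0 = B i2 i2.
  apply: off => s hs; have e : (2 * s) ^+ 2 + 0 ^+ 2 + 1 ^+ 2 = 0 :> k by rewrite expr0n addr0 sq.
  by rewrite -[RHS](ev _ _ _ e) ?nz ?eqxx ?orbT // /form form3E !mxE /= B20; ring.
have [b12 _] : B i1 i2 = 0 /\ B i1 i1 = B i2 i2.
  apply: off => s hs; have e : 0 ^+ 2 + (2 * s) ^+ 2 + 1 ^+ 2 = 0 :> k by rewrite expr0n add0r sq.
  by rewrite -[RHS](ev _ _ _ e) ?nz ?eqxx ?orbT // /form form3E !mxE /= B21; ring.
apply/matrixP; elim/I3P; elim/I3P; rewrite !mxE /= ?B10 ?B20 ?B21 ?b01 ?b02 ?b12 -?d01 -?d02 //.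
Qed.

Lemma conic_im1 A B : A \in unitmx -> B^T = B -> B \in unitmx ->
  im (cl A) (conic 1%:M) = conic B -> exists2 c, c != 0 & A^T *m B *m A = c%:M.
Proof.
move=> uA BT uB E; set M := A^T *m B *m A.
have MT : M^T = M by rewrite /M !trmx_mul trmxK BT mulmxA.
have ME : M = (M i0 i0)%:M.
  apply: conic1_scalar => //; suff -> : conic M = conic 1%:M by [].
  by apply: (@im_inj _ (cl A)); rewrite E conic_mul.
exists (M i0 i0) => //; apply/eqP => z.
have : M \in unitmx by rewrite !unitmx_mul unitmx_tr uA uB.
by rewrite ME z unitmxE det_scalar expr0n unitr0.
Qed.

(** [tt_conic] provides tangency for one matrix of the conic; the matrix is unique up to a scalar,
    so tangency holds for every choice. *)
Lemma tt_tangential Q B : totally_tangent_conic Q -> B^T = B -> B \in unitmx ->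
  Q = conic B -> tangential hk B Q.
Proof.
move=> ttQ BT uB QB; have [A uA QA] := tt_normal hk ttQ; have uA' := unitary_unitmx uA.
have [B0 [B0T uB0 QB0 _ tB0]] := tt_conic hk ttQ.
have [c c0 cE] := @conic_im1 A B uA' BT uB (etrans (esym QA) QB).
have [d d0 dE] := @conic_im1 A B0 uA' B0T uB0 (etrans (esym QA) QB0).
have BE : B = (c / d) *: B0.
  have cancelA M N : A^T *m M *m A = A^T *m N *m A -> M = N.
    move=> /(congr1 (fun X => invmx A^T *m X *m invmx A)).
    by rewrite !mulmxA !mulVmx ?unitmx_tr // !mul1mx !mulmxK.
  apply: cancelA; rewrite cE -scalemxAr -scalemxAl dE -[d%:M]scalemx1 scalerA divfK //.
  by rewrite scalemx1.
move=> p /tB0[e e0 pE]; exists (c / d * e); first by rewrite !mulf_neq0 ?invr_eq0.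
by rewrite BE -scalemxAl pE scalerA.
Qed.

(** By unitarity of [A] and of its inverse, [A^T] and the transpose of [A^f^f] are both inverse to
    [A^f]. *)
Lemma unitary_FF A : unitary hk A -> A^f^f = A.
Proof.
move=> uA; have uV := unitaryV uA; rewrite /unitary unitary_inv // trmxK mxFT in uV.
have AA : A^f *m A^T = 1%:M.
  by have /mulmx1C := (uA : A^T *m A^f = 1%:M).
apply: trmx_inj; rewrite -[LHS]mul1mx -(mulmx1C AA) -mulmxA uV mulmx1 //.
Qed.

Definition ebase (i : 'I_3) : 'cV[k]_3 := delta_mx i 0.

Lemma dot_unitary A u v : unitary hk A -> dot (A *m u) ((A *m v)^f) = dot u (v^f).
Proof. by move=> uA; rewrite mxFM dot_mulmx mulmxA uA mul1mx. Qed.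

Lemma ebaseF i : (ebase i)^f = ebase i.
Proof. by rewrite /ebase map_delta_mx. Qed.

Lemma dot_ebase u i : dot u (ebase i) = u i 0.
Proof.
rewrite /dot mxE (bigD1 i) //= !mxE !eqxx mulr1 big1 ?addr0 // => j ji.
by rewrite [ebase _ _ _]mxE (negPf ji) mulr0.
Qed.

Lemma secant_ebase A D (d : 'I_3 -> k) (i j l : 'I_3) : unitary hk A ->
  (forall y, form D y y = \sum_n d n * y n 0 ^+ 2) -> (forall n, d n ^+ 3 = 1) ->
  uniq [:: i; j; l] -> secants (im (cl A) (conic D)) (polar ((A *m ebase i)^f)).
Proof.
move=> uA Dd d3 ijl; have uA' := unitary_unitmx uA.
have [ij il jl] : [/\ i != j, i != l & j != l].
  by move: ijl; rewrite /= !inE negb_or andbT => /andP[/andP[-> ->] ->].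
(* For s = 1 and s = -1 these give two contact points on the line: there the conic takes the value 5
   d_l and the sextic the value 64 + 1, both zero in characteristic 5. *)
pose y (s : k) := (2 * s * d l ^+ 2 * d j) *: ebase j + ebase l.
have eE m n : ebase m n 0 = (n == m)%:R by rewrite mxE eqxx andbT.
have yi s : y s i 0 = 0.
  by rewrite mxE [X in X + _]mxE !eE (negPf ij) (negPf il) mulr0 addr0.
have yj s : y s j 0 = 2 * s * d l ^+ 2 * d j.
  by rewrite mxE [X in X + _]mxE !eE eqxx (negPf jl) mulr1 addr0.
have yl s : y s l 0 = 1.
  by rewrite mxE [X in X + _]mxE !eE eq_sym (negPf jl) eqxx mulr0 add0r.
have y0 s : y s != 0.
  by apply/eqP => z; have := yl s; rewrite z mxE => /eqP; rewrite eq_sym oner_eq0.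
have Ay0 s : A *m y s != 0.
  by apply: contraNneq (y0 s) => z; rewrite -(mulKmx uA' (y s)) z mulmx0.
pose p s := point (exist _ (A *m y s) (Ay0 s)).
have pE s := repr_point (exist _ (A *m y s) (Ay0 s)).
have d24 n : d n ^+ 24 = 1 by rewrite -[24%N]/(3 * 8)%N exprM d3 expr1n.
have d25 n : d n ^+ 25 = d n by rewrite exprSr d24 mul1r.
have sF (s : k) : s ^+ 2 = 1 -> s ^+ 25 = s.
  by move=> s2; rewrite exprSr -[24%N]/(2 * 12)%N exprM s2 expr1n mul1r.
have two25 : (2 : k) ^+ 25 = 2.
  have two5 : (2 : k) ^+ 5 = 2 by rewrite -(pFrobenius_autE hk) rmorph_nat.
  by rewrite -[25%N]/(5 * 5)%N exprM !two5.
have AF : A^f^f = A := unitary_FF uA.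
have yF s : s ^+ 2 = 1 -> (y s)^f^f = y s.
  move=> s2; apply/matrixP => n z; rewrite ord1 [LHS]mxE [_^f _ _]mxE !pFrobenius_autE.
  rewrite -exprM -[(5 * 5)%N]/25%N.
  have -> : y s n 0 = if n == j then 2 * s * d l ^+ 2 * d j else (n == l)%:R.
    by case: eqP => [->//|/eqP nj]; rewrite mxE [X in X + _]mxE !eE (negPf nj) mulr0 add0r.
  case: eqP => _; last by case: eqP; rewrite ?expr1n ?expr0n.
  by rewrite !exprMn !d25 two25 sF // expr2.
have rat s : s ^+ 2 = 1 -> forall n, coords (exist _ (A *m y s) (Ay0 s)) n ^+ 25 =
    coords (exist _ (A *m y s) (Ay0 s)) n.
  move=> s2 n; rewrite /coords /=; transitivity ((A *m y s)^f^f n 0).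
    by rewrite [RHS]mxE [(A *m y s)^f _ _]mxE !pFrobenius_autE -exprM.
  by rewrite !mxFM AF yF.
have on s : s ^+ 2 = 1 -> im (cl A) (conic D) (p s).
  move=> s2; apply/in_im; rewrite -clV //.
  have [c c0 cE] := @vec_act _ (invmx A) (p s) (etrans (unitmx_inv A) uA').
  apply/(conic_vec _ c0 cE); rewrite /vec; have [c' c'0 ->] := pE s.
  rewrite -scalemxAr mulKmx // [(_ *: _)^T]linearZ /= -!scalemxAl -!scalemxAr.
  suff -> : (y s)^T *m D *m y s = 0 by rewrite !scaler0.
  apply/mx11_eq0; rewrite -/(form D _ _) Dd (sum3_uniq _ ijl) yi yj yl.
  have djl : (2 * s * d l ^+ 2 * d j) ^+ 2 = 4 * d l * d j ^+ 2.
    transitivity (4 * s ^+ 2 * (d l ^+ 3 * d l) * d j ^+ 2); first ring.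
    by rewrite s2 d3; ring.
  rewrite djl; transitivity (d l * (4 * d j ^+ 3 + 1)); first ring.
  rewrite d3; apply: etrans (five0 (d l)); ring.
have Gp s : s ^+ 2 = 1 -> Gamma k (p s).
  move=> s2; have [c' c'0 c'E] := pE s; apply/(Gamma_vec hk c'0 c'E).
  apply/mx11_eq0; rewrite -[herm _ _ _]/(_^T *m _) -/(dot _ _) /= dot_unitary //.
  have -> : dot (y s) (y s)^f = \sum_n y s n 0 ^+ 6.
    by rewrite /dot mxE; apply: eq_bigr => n _; rewrite !mxE pFrobenius_autE -exprS.
  rewrite (sum3_uniq _ ijl) yi yj yl.
  have -> : (2 * s * d l ^+ 2 * d j) ^+ 6 = 64 * (s ^+ 2) ^+ 3 * (d l ^+ 3) ^+ 4 * (d j ^+ 3) ^+ 2 by ring.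
  rewrite s2 !d3 !expr1n expr0n /=; apply: etrans (five0 13); ring.
have Lp s : polar ((A *m ebase i)^f) (p s).
  rewrite /polar /= /vec; have [c' c'0 ->] := pE s.
  by rewrite dotZl /= dot_unitary // ebaseF dot_ebase yi mulr0.
have one2 : (1 : k) ^+ 2 = 1 by rewrite expr1n.
have N12 : (- 1 : k) ^+ 2 = 1 by rewrite sqrrN expr1n.
have dn0 n : d n != 0.
  by apply/eqP => z; have /eqP := d3 n; rewrite z expr0n eq_sym oner_eq0.
have ppN : p 1 <> p (- 1).
  move=> /pointP[c c0 /= E]; have {}E : y 1 = c *: y (- 1).
    by rewrite -(mulKmx uA' (y 1)) E -scalemxAr mulKmx.
  have c1 : c = 1 by have /matrixP/(_ l 0) := E; rewrite yl [RHS]mxE yl mulr1.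
  have /matrixP/(_ j 0) := E; rewrite yj [RHS]mxE yj c1 => E'.
  have : 4 * d l ^+ 2 * d j = 0.
    transitivity (2 * 1 * d l ^+ 2 * d j - 1 * (2 * - 1 * d l ^+ 2 * d j)); first ring.
    by rewrite E' subrr.
  by apply/eqP; rewrite !mulf_neq0 ?expf_neq0 // natr_neq0.
have onQ s : s ^+ 2 = 1 -> (im (cl A) (conic D) `&` Gamma k) (p s).
  by move=> s2; split; [apply: on|apply: Gp].
split; last first.
  by exists (p 1), (p (- 1)); split; rewrite ?onQ //; apply: onQ.
split.
  apply: polar_line; apply/eqP => /Frob_inj z.
  have e0 : ebase i = 0 by rewrite -(mulKmx uA' (ebase i)) z mulmx0.
  have := dot_ebase (ebase i) i; rewrite {1}e0 /dot trmx0 mul0mx !mxE !eqxx => /eqP.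
  by rewrite eq_sym oner_eq0.
have ratp s : s ^+ 2 = 1 -> rational_points k (p s).
  move=> s2; split; first exact: Gp.
  by exists (exist _ (A *m y s) (Ay0 s)) => // n; apply: rat.
by exists (p 1), (p (- 1)); split=> //; apply: ratp.
Qed.
End NormalFormAdjacent.

Section NFAdjacent.
Variable k : closedFieldType.
Hypothesis hk : 5%N \in [pchar k].
Variable w : k.
Hypothesis hw : w ^+ 2 + w + 1 = 0.
Local Notation "A ^f" := (map_mx (pFrobenius_aut hk) A).
Local Notation Dw := (dg 1 w (w ^+ 2)).
Implicit Types (A B M W : 'M[k]_3) (u v : 'cV[k]_3) (Q L : set (P2 k)).

Let w3 := w3 hw.
Let w1 := w1 hk hw.
Let two0 := two0 hk.

Lemma conic_dgE (a b c : k) (p : P2 k) : conic (dg a b c) p <->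
  a * vec p i0 0 ^+ 2 + b * vec p i1 0 ^+ 2 + c * vec p i2 0 ^+ 2 = 0.
Proof.
rewrite /conic /= mx11_eq0 form3E !mxE /=.
by split=> e; rewrite -[RHS]e; ring.
Qed.

Lemma one_neqN1 : (1 : k) != - 1.
Proof. by rewrite -subr_eq0 opprK. Qed.

Lemma conics_meet4 : (conic (1%:M : 'M[k]_3) `&` conic Dw #= `I_4)%card.
Proof.
(* The common points are (w^2, w, 1) up to the signs of the first two coordinates; the two bits of
   [m] encode these signs. *)
pose s1 (m : 'I_4) : k := (-1) ^+ odd m; pose s2 (m : 'I_4) : k := (-1) ^+ odd (m./2).
have sq (b : bool) : ((-1 : k) ^+ b) ^+ 2 = 1 by case: b; rewrite ?expr1 ?sqrrN ?expr1n.
have sign_inj (b c : bool) : (-1 : k) ^+ b = (-1) ^+ c -> b = c.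
  case: b c => [] [] //; rewrite expr0 expr1 => /eqP.
    by rewrite eq_sym (negPf one_neqN1).
  by rewrite (negPf one_neqN1).
have nz a b : cv3 a b 1 != 0 :> 'cV[k]_3 by rewrite cv3_eq0 oner_eq0 !andbF.
have /choice[g gP] : forall m, exists p, exists2 c, c != 0 & vec p = c *: cv3 (s1 m * w ^+ 2) (s2 m * w) 1.
  by move=> m; exact: point_vec (nz _ _).
have idx (m n : 'I_4) : odd m = odd n -> odd m./2 = odd n./2 -> m = n.
  by move: m n => [[|[|[|[|//]]]] ?] [[|[|[|[|//]]]] ?] //= _ _; apply: val_inj.
have w40 : w ^+ 4 = w by rewrite exprS w3 mulr1.
apply: (@card_I_image _ _ _ g).
- move=> m n gmn; have [c c0 cE] := gP m; have [d d0 dE] := gP n.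
  rewrite gmn dE in cE; move/matrixP: cE => E.
  have e2 := E i2 0; rewrite !mxE /= !mulr1 in e2; subst d.
  have e0 := E i0 0; have e1 := E i1 0; rewrite !mxE /= in e0 e1.
  have /sign_inj o1 := mulIf (expf_neq0 2 (w0 hw)) (mulfI c0 e0).
  have /sign_inj o2 := mulIf (w0 hw) (mulfI c0 e1).
  exact: idx.
- move=> m; have [c c0 cE] := gP m; rewrite -dg1; split; apply/conic_dgE; rewrite cE !mxE /= !exprMn.
    transitivity (c ^+ 2 * (s1 m ^+ 2 * w ^+ 4 + s2 m ^+ 2 * w ^+ 2 + 1)); first ring.
    by rewrite !sq w40 !mul1r [w + _]addrC hw mulr0.
  transitivity (c ^+ 2 * (s1 m ^+ 2 * w ^+ 4 + s2 m ^+ 2 * w ^+ 3 + w ^+ 2)); first ring.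
  by rewrite !sq w40 w3 !mul1r addrC addrA hw mulr0.
- move=> p; rewrite -dg1 => -[/conic_dgE e1 /conic_dgE e2].
  have z0 : vec p i2 0 != 0.
    apply/eqP => z; move: e1 e2; rewrite z expr0n !mulr0 !addr0 !mul1r => e1 e2.
    have /eqP : (1 - w) * vec p i1 0 ^+ 2 = 0.
      transitivity (vec p i0 0 ^+ 2 + vec p i1 0 ^+ 2 - (vec p i0 0 ^+ 2 + w * vec p i1 0 ^+ 2)); first ring.
      by rewrite e1 e2 subrr.
    rewrite mulf_eq0 subr_eq0 eq_sym (negPf w1) expf_eq0 /= => /eqP y0.
    move: e1; rewrite y0 expr0n addr0 => /eqP; rewrite expf_eq0 /= => /eqP x0.
    by have /eqP := vec_neq0 p; apply; rewrite [vec p]cv3E x0 y0 z; apply/eqP; rewrite cv3_eq0 !eqxx.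
  set x := vec p i0 0 in e1 e2 *; set y := vec p i1 0 in e1 e2 *; set z := vec p i2 0 in z0 e1 e2 *.
  have y2 : y ^+ 2 = (w * z) ^+ 2.
    have w10 : 1 - w != 0 by rewrite subr_eq0 eq_sym.
    apply: (mulfI w10); transitivity ((1 * x ^+ 2 + 1 * y ^+ 2 + 1 * z ^+ 2) - (1 * x ^+ 2 + w * y ^+ 2 + w ^+ 2 * z ^+ 2) - (1 - w ^+ 2) * z ^+ 2); first ring.
    rewrite e1 e2; transitivity ((w - 1) * (w ^+ 2 + w + 1) * z ^+ 2 + (1 - w) * (w * z) ^+ 2); first ring.
    by rewrite hw mulr0 mul0r add0r.
  have x2 : x ^+ 2 = (w ^+ 2 * z) ^+ 2.
    transitivity (1 * x ^+ 2 + 1 * y ^+ 2 + 1 * z ^+ 2 - y ^+ 2 - z ^+ 2); first ring.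
    rewrite e1 y2; transitivity (- (w ^+ 2 + w + 1) * z ^+ 2 + w * z ^+ 2); first ring.
    by rewrite hw oppr0 mul0r add0r -{1}w40; ring.
  have sgn (a b : k) : a ^+ 2 = b ^+ 2 -> exists c : bool, a = (-1) ^+ c * b.
    move/eqP; rewrite eqf_sqr => /orP[]/eqP->; [exists false|exists true].
      by rewrite expr0 mul1r.
    by rewrite expr1 mulN1r.
  have [b1 xE] := sgn _ _ x2; have [b2 yE] := sgn _ _ y2.
  have lt4 : (b1 + b2.*2 < 4)%N by case: (b1) (b2) => [] [].
  exists (Ordinal lt4); have [c c0 cE] := gP (Ordinal lt4).
  have m1 : odd (b1 + b2.*2) = b1 by rewrite oddD odd_double addbF; case: (b1).
  have m2 : odd (b1 + b2.*2)./2 = b2 by rewrite half_bit_double; case: (b2).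
  apply: (@vec_inj _ _ _ (z / c)); first by rewrite mulf_neq0 ?invr_eq0.
  rewrite cE scalerA divfK // [vec p]cv3E -/x -/y -/z xE yE /s1 /s2 /= m1 m2.
  by apply: cV3_eq; rewrite !mxE /=; ring.
Qed.

Lemma NF_adj Q Q' : totally_tangent_conic Q -> totally_tangent_conic Q' ->
  NF hk w Q Q' -> adjacent Q Q'.
Proof.
move=> ttQ ttQ' [A [uA QA QA']]; have uA' := unitary_unitmx uA.
have uD : Dw \in unitmx by apply: dg_unit; rewrite ?oner_neq0 ?expf_neq0 // (w0 hw).
split=> //.
- rewrite QA QA' => /im_inj E.
  have := conic1_scalar hk (dgT 1 w (w ^+ 2)); rewrite -E => /(_ (fun p h => h)).
  by move=> /matrixP/(_ i1 i1); rewrite !mxE /= mulr1n => /eqP; rewrite (negPf w1).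
- by rewrite QA QA' -imI; apply: im_card; exact: conics_meet4.
pose B M : 'M[k]_3 := (invmx A)^T *m M *m invmx A.
have AB M : A^T *m B M *m A = M.
  by rewrite /B !mulmxA -trmx_mul mulVmx // trmx1 mul1mx mulmxKV.
have BT M : M^T = M -> (B M)^T = B M by move=> MT; rewrite /B !trmx_mul trmxK MT mulmxA.
have uB M : M \in unitmx -> B M \in unitmx.
  by move=> uM; rewrite !unitmx_mul unitmx_tr unitmx_inv uA' uM.
have QB : Q = conic (B 1%:M) by rewrite QA im_conic.
have QB' : Q' = conic (B Dw) by rewrite QA' im_conic.
clearbody B.
have tQ := tt_tangential hk ttQ (BT _ (trmx1 _ _)) (uB _ (unitmx1 _ _)) QB.
have tQ' := tt_tangential hk ttQ' (BT _ (dgT _ _ _)) (uB _ uD) QB'.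
have three (i : 'I_3) : exists j l, uniq [:: i; j; l].
  by elim/I3P: i; [exists i1, i2|exists i0, i2|exists i0, i1].
have form_dg (a b c : k) y : form (dg a b c) y y =
    \sum_(n < 3) (nth 0 [:: a; b; c] n) * y n 0 ^+ 2.
  by rewrite /form form3E sum3 !mxE /=; ring.
apply: (@card_I_image _ _ _ (fun i => polar ((A *m ebase k i)^f))).
- move=> i j E; apply/eqP/negPn/negP => ij.
  have Aj0 : A *m ebase k j != 0.
    apply/eqP => z; have := dot_unitary (ebase k j) (ebase k j) uA.
    rewrite z /dot trmx0 mul0mx ebaseF -/(dot _ _) dot_ebase mxE mxE !eqxx => /eqP.
    by rewrite eq_sym oner_eq0.
  have [p [c c0 pE]] := point_vec Aj0.
  have : polar ((A *m ebase k i)^f) p.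
    rewrite /polar /= pE dotZl dot_unitary // ebaseF dot_ebase mxE eqxx andbT (negPf ij).
    by rewrite mulr0.
  rewrite E /polar /= pE dotZl dot_unitary // ebaseF dot_ebase mxE !eqxx mulr1 => /eqP.
  by rewrite (negPf c0).
- move=> i; have [j [l ijl]] := three i; split.
    rewrite QA; apply: (secant_ebase (d := fun=> 1) uA _ _ ijl).
      by move=> y; rewrite -dg1 form_dg !sum3.
    by move=> n; rewrite expr1n.
  rewrite QA'; apply: (secant_ebase (d := fun n => nth 0 [:: 1; w; w ^+ 2] n) uA _ _ ijl).
    by move=> y; rewrite form_dg.
  by elim/I3P; rewrite /= ?expr1n // -exprM mulnC exprM w3 expr1n.
move=> L [LQ LQ']; have [u [u0 uF LE]] := special_line hk LQ.1.
rewrite LE in LQ LQ'.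
have [[a aE] _] := secant_pole (BT _ (trmx1 _ _)) (uB _ (unitmx1 _ _)) QB tQ u0 LQ.
have [[b bE] _] := secant_pole (BT _ (dgT _ _ _)) (uB _ uD) QB' tQ' u0 LQ'.
have uf0 : u^f != 0 by apply: contraNneq u0 => z; rewrite -uF z map_mx0.
have [y yE] : exists y, u^f = A *m y by exists (invmx A *m u^f); rewrite mulKVmx.
have y0 : y != 0 by apply: contraNneq uf0 => z; rewrite yE z mulmx0.
have E1 : y = a *: (A^T *m u).
  by rewrite scalemxAr -aE yE !mulmxA AB mul1mx.
have E2 : Dw *m y = b *: (A^T *m u).
  by rewrite scalemxAr -bE yE !mulmxA AB.
have a0 : a != 0 by apply: contraNneq y0 => z; rewrite E1 z scale0r.
have E3 : Dw *m y = (b / a) *: y by rewrite E2 [in RHS]E1 scalerA divfK.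
(* In the frame given by [A], the pole of a common secant is an eigenvector of the second diagonal
   matrix, whose eigenvalues 1, w, w^2 are distinct. So it is a multiple of a coordinate vector. *)
have [i [z yi]] : exists i z, y = z *: ebase k i.
  set la := b / a in E3; move/matrixP: E3 => E3.
  have d (n : 'I_3) : (nth 0 [:: 1; w; w ^+ 2] n - la) * y n 0 = 0.
    have := E3 n 0; rewrite [RHS]mxE => E; rewrite mulrBl -E mxE sum3 !mxE.
    by elim/I3P: n {E} => /=; ring.
  have ne (n : 'I_3) : y n 0 != 0 -> nth 0 [:: 1; w; w ^+ 2] n = la.
    move=> yn; apply/eqP; rewrite -subr_eq0; have /eqP := d n.
    by rewrite mulf_eq0 (negPf yn) orbF.
  have [i yi] : exists i, y i 0 != 0.
    apply/existsP; apply: contraNT y0; rewrite negb_exists => /forallP z.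
    by apply/eqP/matrixP => i j; rewrite ord1 [RHS]mxE; apply/eqP; have := z i; rewrite negbK.
  exists i, (y i 0); apply/matrixP => n z; rewrite ord1 [RHS]mxE [ebase _ _ _ _]mxE eqxx andbT.
  have [->|ni] := eqVneq n i; first by rewrite mulr1.
  rewrite mulr0; apply/eqP; apply: contraNT ni => yn.
  have := ne n yn; rewrite -(ne i yi).
  have w21 := w21 hk hw; have w2w := w2w hk hw.
  by elim/I3P: n {yn} => /=; elim/I3P: i {yi} => //= /eqP;
    rewrite ?(negPf w1) ?(negPf w21) ?(negPf w2w) 1?eq_sym ?(negPf w1) ?(negPf w21) ?(negPf w2w).
exists i; rewrite LE -uF yE yi -scalemxAr mxFZ polarZ // expf_neq0 //.
by apply: contraNneq y0 => z0; rewrite yi z0 scale0r.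
Qed.

End NFAdjacent.

(** * Tetrahedral groups *)

Section Tetrahedral.
Variable k : closedFieldType.
Hypothesis hk : 5%N \in [pchar k].
Variable w : k.
Hypothesis hw : w ^+ 2 + w + 1 = 0.
Local Notation "A ^f" := (map_mx (pFrobenius_aut hk) A).
Implicit Types (A B M N W S : 'M[k]_3) (u v : 'cV[k]_3) (Q L : set (P2 k)).

Lemma stab_form Q B N : totally_tangent_conic Q -> B^T = B -> B \in unitmx -> Q = conic B ->
  N \in unitmx -> im (cl N) Q = Q -> exists2 c, c != 0 & N^T *m B *m N = c *: B.
Proof.
move=> ttQ BT uB QB uN NQ; have [A uA QA] := tt_normal hk ttQ; have uA' := unitary_unitmx uA.
have [c c0 cE] := @conic_im1 _ hk A B uA' BT uB (etrans (esym QA) QB).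
have [||d d0 dE] := @conic_im1 _ hk (N *m A) B _ BT uB _.
- by rewrite unitmx_mul uN.
- by rewrite clM // imM -QA NQ.
exists (d / c); first by rewrite mulf_neq0 ?invr_eq0.
have cancelA X Y : A^T *m X *m A = A^T *m Y *m A -> X = Y.
  move=> /(congr1 (fun X => invmx A^T *m X *m invmx A)).
  by rewrite !mulmxA !mulVmx ?unitmx_tr // !mul1mx !mulmxK.
apply: cancelA; rewrite -scalemxAr -scalemxAl cE -[c%:M]scalemx1 scalerA divfK // scalemx1.
by rewrite -dE trmx_mul !mulmxA.
Qed.

Lemma aut_form N : N \in unitmx -> aut_Gamma k (cl N) ->
  exists2 c, c != 0 & N^T *m N^f = c%:M.
Proof.
move=> uN /(aut_unitary hk)[A uA /(cl_eq uN (unitary_unitmx uA))[e e0 NE]].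
exists (e ^+ 6); first by rewrite expf_neq0.
rewrite NE mxFZ [(_ *: A)^T]linearZ /= -scalemxAl -scalemxAr uA scalerA -exprS.
by rewrite scalemx1.
Qed.

Lemma one_of_two_three (c : k) : c ^+ 2 = 1 -> c ^+ 3 = 1 -> c = 1.
Proof. by move=> c2 c3; rewrite -[LHS]mul1r -{1}c2 -exprSr. Qed.

(** Applying the similitude twice gives c^2 = 1, and determinants in dimension 3 give c^3 = 1. *)
Lemma invol_form N B c : B \in unitmx -> N *m N = 1%:M -> N^T *m B *m N = c *: B -> c = 1.
Proof.
move=> uB NN E; have c2 : c ^+ 2 = 1.
  have : (c ^+ 2) *: B = B.
    rewrite expr2 -scalerA; transitivity (N^T *m (N^T *m B *m N) *m N).
      by rewrite E -scalemxAr -scalemxAl E.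
    by rewrite !mulmxA -(mulmxA _ N N) NN mulmx1 -trmx_mul NN trmx1 mul1mx.
  move/(congr1 (fun X => X *m invmx B)); rewrite -scalemxAl mulmxV // => /matrixP/(_ i0 i0).
  by rewrite !mxE mulr1.
apply: one_of_two_three => //; have detN : \det N ^+ 2 = 1.
  by rewrite expr2 -det_mulmx NN det1.
have := congr1 determinant E; rewrite !det_mulmx det_tr detZ => e.
have dB : \det B != 0 by rewrite -unitfE -unitmxE.
by apply: (mulIf dB); rewrite mul1r -e mulrAC -expr2 detN mul1r.
Qed.

Lemma invol_herm N c : N *m N = 1%:M -> N^T *m N^f = c%:M -> c = 1.
Proof.
move=> NN E; have NNF : N^f *m N^f = 1%:M by rewrite -mxFM NN mxF1.
have NNT : N^T *m N^T = 1%:M by rewrite -trmx_mul NN trmx1.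
have c2 : c ^+ 2 = 1.
  have : (c ^+ 2)%:M = 1%:M :> 'M[k]_3.
    transitivity (N^T *m (N^T *m N^f) *m N^f).
      by rewrite E mul_mx_scalar -scalemxAl E scale_scalar_mx expr2.
    by rewrite !mulmxA -(mulmxA _ N^f) NNF mulmx1 NNT.
  by move/matrixP/(_ i0 i0); rewrite !mxE.
apply: one_of_two_three => //; have detN : \det N ^+ 2 = 1.
  by rewrite expr2 -det_mulmx NN det1.
have := congr1 determinant E; rewrite det_mulmx det_tr det_scalar det_map_mx /= pFrobenius_autE => <-.
by rewrite -exprS -[6%N]/(2 * 3)%N exprM detN expr1n.
Qed.

Lemma formM B N u v : form B (N *m u) (N *m v) = form (N^T *m B *m N) u v.
Proof. by rewrite /form trmx_mul !mulmxA. Qed.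

Lemma formZ c B u v : form (c *: B) u v = c * form B u v.
Proof. by rewrite /form -scalemxAr -scalemxAl mxE. Qed.

Lemma hdotM N c u v : N^T *m N^f = c%:M -> dot (N *m u) ((N *m v)^f) = c * dot u v^f.
Proof. by move=> E; rewrite mxFM dot_mulmx mulmxA E mul_scalar_mx dotZr. Qed.

(** The matrix is a multiple of [A^f *m A^f^T] for a unitary [A], whose entries are fixed by the
    squared Frobenius. In [tetra_NF] this relates the scale of the conic to that of the Hermitian
    form. *)
Lemma tt_conjugate Q B : totally_tangent_conic Q -> B^T = B -> B \in unitmx -> Q = conic B ->
  exists s, B^f *m B = s%:M.
Proof.
move=> ttQ BT uB QB; have [A uA QA] := tt_normal hk ttQ; have uA' := unitary_unitmx uA.
have [c c0 cE] := @conic_im1 _ hk A B uA' BT uB (etrans (esym QA) QB).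
have iA := unitary_inv uA.
have BE : B = c *: (A^f *m A^f^T).
  rewrite -[A^f]trmxK -iA; apply: (@trmx_inj); rewrite BT.
  have := congr1 (fun X => (invmx A)^T *m X *m invmx A) cE.
  rewrite !mulmxA -trmx_mul mulmxV // trmx1 mul1mx mulmxK // => ->.
  by rewrite mul_mx_scalar -scalemxAl [(_ *: _)^T]linearZ /= !trmx_mul !trmxK.
exists (c ^+ 6); rewrite {1}BE mxFZ mxFM mxFT (unitary_FF uA) BE -scalemxAl -scalemxAr scalerA.
rewrite mulmxA -(mulmxA A) (uA : A^T *m A^f = 1%:M) mulmx1 -iA mulmxV //.
by rewrite mulrC -exprS scalemx1.
Qed.

Lemma tetra_NF Q Q' (g1 g2 t : PGL3 k) : totally_tangent_conic Q ->
  totally_tangent_conic Q' -> Q <> Q' ->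
  (forall g, g = g1 \/ g = g2 \/ g = t -> (stab Q `&` stab Q') g) ->
  (g1 * g1 = 1)%g -> g1 <> 1%g -> (g1 * g2 = g2 * g1)%g -> (t * t * t = 1)%g ->
  (g1 * t = t * g2)%g -> (g2 * t = t * (g1 * g2))%g -> NF hk w Q Q'.
Proof.
move=> ttQ ttQ' QQ' gst g1g1 g1n1 g12 t3 g1t g2t.
have [B [BT uB QB _ _]] := tt_conic hk ttQ; have [B' [B'T uB' QB' _ _]] := tt_conic hk ttQ'.
have scal A : A \in unitmx -> cl A = 1%g -> exists2 c, c != 0 & A = c%:M.
  move=> uA; rewrite -(cl1 k) => /(cl_eq uA (unitmx1 _ _))[d d0 ->].
  by exists d; rewrite ?scalemx1.
have clZ A c : A \in unitmx -> c != 0 -> cl (c *: A) = cl A.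
  by move=> uA c0; apply/cl_eq; rewrite ?unitmxZ ?unitfE //; exists c.
(* [S] lifts the inverse of [t], so conjugation by [S] lifts g -> t^-1 g t, which cycles g1, g2 and
   g1 g2. A cube root normalizes [S]. *)
have [S [uS tS S3]] : exists S, [/\ S \in unitmx, (t^-1 = cl S)%g & S *m S *m S = 1%:M].
  have [S uS tS] := cl_surj (t^-1)%g.
  have [||c c0 cE] := scal (S *m S *m S).
  - by rewrite !unitmx_mul uS.
  - by rewrite !clM ?unitmx_mul ?uS // -tS -!invMg mulgA t3 invg1.
  have [m mE] := nth_root c^-1 (isT : (0 < 3)%N).
  have m0 : m != 0 by apply/eqP => z; move/eqP: mE; rewrite z expr0n eq_sym invr_eq0 (negPf c0).
  exists (m *: S); split; rewrite ?unitmxZ ?unitfE ?clZ //.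
  rewrite -!scalemxAl -!scalemxAr -!scalemxAl !scalerA cE -[c%:M]scalemx1 scalerA.
  rewrite (_ : _ * c = 1) ?scale1r //.
  by rewrite -[RHS](mulVf c0) -mE; ring.
have S3' : S *m (S *m S) = 1%:M by rewrite mulmxA.
have iS : invmx S = S *m S.
  by rewrite -[LHS]mul1mx -S3 mulmxK.
have e0P (e : k) : e ^+ 2 = 1 -> e = 1 \/ e = - 1.
  by move/eqP; rewrite sqrf_eq1 => /orP[]/eqP; [left|right].
have NNunit N : N *m N = 1%:M -> N \in unitmx by case/mulmx1_unit.
pose cj N := S *m N *m (S *m S).
have cjM M N : cj (M *m N) = cj M *m cj N.
  rewrite /cj !mulmxA; do 3 congr (_ *m _); rewrite -!mulmxA.
  by rewrite [S *m (S *m S)]mulmxA S3 mulmx1.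
have cj1 : cj 1%:M = 1%:M by rewrite /cj mulmx1 mulmxA S3.
have cj_cl N : N \in unitmx -> cl (cj N) = (t^-1 * cl N * t)%g.
  move=> uN; rewrite /cj -iS !clM ?unitmx_mul ?unitmx_inv ?uS ?uN // clV //.
  by rewrite -tS invgK.
have cjN X : cj (- X) = - cj X by rewrite /cj mulmxN mulNmx.
have cjD X Y : cj (X + Y) = cj X + cj Y by rewrite /cj mulmxDr mulmxDl.
have cjS X : cj X *m S = S *m X by rewrite /cj -!mulmxA S3' mulmx1.
have cj0 : cj 0 = 0 by rewrite /cj mulmx0 mul0mx.
clearbody cj.
(* A square root normalizes the lift of [g1] up to sign. The scalar [e] by which it fails to commute
   with its conjugate satisfies e^2 = e^3 = 1. The remaining sign is chosen so that the third
   conjugate is the product of the other two. *)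
have [N1 [clN1 NN1 N12 N3E]] : exists N, [/\ cl N = g1, N *m N = 1%:M,
    N *m cj N = cj N *m N & cj (cj N) = N *m cj N].
  have [N0 uN0 gN0] := cl_surj g1.
  have [||c c0 cE] := scal (N0 *m N0).
  - by rewrite unitmx_mul uN0.
  - by rewrite clM // -gN0.
  have [m mE] := nth_root c^-1 (isT : (0 < 2)%N).
  have m0 : m != 0 by apply/eqP => z; move/eqP: mE; rewrite z expr0n eq_sym invr_eq0 (negPf c0).
  pose N := m *: N0.
  have NN : N *m N = 1%:M.
    rewrite /N -scalemxAl -scalemxAr scalerA -expr2 mE cE -[c%:M]scalemx1 scalerA mulVf //.
    by rewrite scale1r.
  have clN : cl N = g1 by rewrite clZ.
  have uN := NNunit _ NN; clearbody N.
  have N2N2 : cj N *m cj N = 1%:M by rewrite -cjM NN cj1.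
  have uN2 := NNunit _ N2N2.
  have clN2 : cl (cj N) = g2 by rewrite cj_cl // clN -mulgA g1t mulgA mulVg mul1g.
  have uNN2 : N *m cj N \in unitmx by rewrite unitmx_mul uN.
  have uN2N : cj N *m N \in unitmx by rewrite unitmx_mul uN2.
  have /(cl_eq uNN2 uN2N)[e e0 eE] : cl (N *m cj N) = cl (cj N *m N).
    by rewrite (clM uN uN2) (clM uN2 uN) clN clN2 g12.
  have e1 : e = 1.
    apply: one_of_two_three.
      have : (e ^+ 2) *: cj N = cj N.
        rewrite -[RHS]mul1mx -NN -mulmxA eE -scalemxAr mulmxA eE -scalemxAl.
        by rewrite -mulmxA NN mulmx1 scalerA expr2.
      move/(congr1 (fun X => X *m invmx (cj N))); rewrite -scalemxAl mulmxV // => /matrixP/(_ i0 i0).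
      by rewrite !mxE mulr1.
    have := congr1 determinant eE; rewrite detZ !det_mulmx [\det (cj N) * _]mulrC => dE.
    have d0 : \det N * \det (cj N) != 0 by rewrite mulf_neq0 // -unitfE -unitmxE.
    by apply: (mulIf d0); rewrite mul1r -dE.
  rewrite e1 scale1r in eE.
  have uN3 : cj (cj N) \in unitmx by apply: NNunit; rewrite -cjM N2N2 cj1.
  have /(cl_eq uN3 uNN2)[f f0 fE] : cl (cj (cj N)) = cl (N *m cj N).
    by rewrite cj_cl // clN2 (clM uN uN2) clN clN2 -mulgA g2t mulgA mulVg mul1g.
  have N3sq : (N *m cj N) *m (N *m cj N) = 1%:M.
    by rewrite {2}eE -mulmxA (mulmxA (cj N)) N2N2 mul1mx NN.
  have f2 : f ^+ 2 = 1.
    have : cj (cj N) *m cj (cj N) = 1%:M by rewrite -cjM N2N2 cj1.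
    rewrite fE -scalemxAl -scalemxAr N3sq scalerA -expr2 => /matrixP/(_ i0 i0).
    by rewrite !mxE mulr1.
  have [f1|f1] := e0P _ f2; first by exists N; split=> //; rewrite fE f1 scale1r.
  exists (- N); rewrite !cjN; split.
  - by rewrite -scaleN1r clZ // oppr_eq0 oner_neq0.
  - by rewrite mulmxN mulNmx opprK.
  - by rewrite !mulmxN !mulNmx eE.
  - by rewrite mulmxN mulNmx opprK fE f1 scaleN1r opprK.
pose N2 := cj N1; rewrite -/N2 in N12 N3E.
have NN2 : N2 *m N2 = 1%:M by rewrite -cjM NN1 cj1.
have cjN3 : cj (N1 *m N2) = N1.
  by rewrite cjM -/N2 N3E N12 mulmxA NN2 mul1mx.
have uN1 := NNunit _ NN1; have uN2 := NNunit _ NN2.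
(* This is (1 + N1) (1 - N2), whose image consists of common eigenvectors with eigenvalues 1 and -1.
   If it vanished, so would its conjugates under [S], two of which add up to 2 (1 - N1). *)
pose E := 1%:M + N1 - N2 - N1 *m N2.
have E0 : E != 0.
  apply/eqP => z; have z2 : 1%:M + N2 - N1 *m N2 - N1 = 0.
    by have := congr1 cj z; rewrite /E !(cjD, cjN) cj1 cjN3 N3E cj0.
  have z3 : 1%:M + N1 *m N2 - N1 - N2 = 0.
    have := congr1 cj z2; rewrite !(cjD, cjN) cj1 cjN3 N3E cj0 => <-.
    by apply/matrixP => i j; rewrite !mxE; ring.
  apply: g1n1; rewrite -clN1 -(cl1 k); congr cl; apply/eqP; rewrite eq_sym -subr_eq0.
  have : 2%:R *: (1%:M - N1) = 0 :> 'M[k]_3.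
    have -> : 0 = (1%:M + N2 - N1 *m N2 - N1) + (1%:M + N1 *m N2 - N1 - N2).
      by rewrite z2 z3 addr0.
    rewrite scaler_nat mulr2n; apply/matrixP => i j; rewrite !mxE; ring.
  by move/eqP; rewrite scaler_eq0 (negPf (two0 hk)).
have clN2 : cl N2 = g2 by rewrite cj_cl // clN1 -mulgA g1t mulgA mulVg mul1g.
have N1E : N1 *m E = E.
  rewrite /E !mulmxDr !mulmxN mulmxA NN1 mulmx1 mul1mx.
  by apply/matrixP => i j; rewrite !mxE; ring.
have N2E : N2 *m E = - E.
  rewrite /E !mulmxDr !mulmxN mulmxA -N12 -mulmxA NN2 !mulmx1.
  by apply/matrixP => i j; rewrite !mxE; ring.
have [v v0] : exists v, E *m v != 0.
  apply: contrapT => nov; case/eqP: E0; apply/matrixP => i j.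
  have Ej : E *m delta_mx j 0 = 0 :> 'cV[k]_3.
    by apply/eqP/negPn/negP => ne; apply: nov; exists (delta_mx j 0).
  by have /matrixP/(_ i 0) := Ej; rewrite -colE !mxE.
clearbody E.
(* [S] permutes these vectors cyclically, and the Klein group acts on them through its three
   nontrivial characters, which makes them pairwise orthogonal for every invariant form. *)
pose x1 := E *m v; pose x2 := S *m x1; pose x3 := S *m x2.
have a1 : N1 *m x1 = x1 by rewrite /x1 mulmxA N1E.
have b1 : N2 *m x1 = - x1 by rewrite /x1 mulmxA N2E mulNmx.
have S1 M x : cj M *m (S *m x) = S *m (M *m x) by rewrite mulmxA cjS mulmxA.
have b2 : N2 *m x2 = x2 by rewrite S1 a1.
have N3x y : N1 *m N2 *m (S *m y) = S *m (N2 *m y) by rewrite -N3E S1.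
have a2 : N1 *m x2 = - x2.
  by rewrite -[in LHS]b2 mulmxA /x2 N3x b1 mulmxN.
have b3 : N2 *m x3 = - x3 by rewrite S1 a2 mulmxN.
have a3 : N1 *m x3 = - x3.
  have := N3x _ x2; rewrite -/x3 b2 -mulmxA b3 mulmxN => /eqP.
  by rewrite -/x3 eqr_oppLR => /eqP.
have Sx3 : S *m x3 = x1 by rewrite /x3 /x2 !mulmxA S3 mul1mx.
clearbody N2.
have x1n0 : x1 != 0 := v0; have Sinj x : S *m x = 0 -> x = 0.
  by move=> z; rewrite -(mulKmx uS x) z mulmx0.
have x2n0 : x2 != 0 by apply: contra_neq x1n0; apply: Sinj.
have x3n0 : x3 != 0 by apply: contra_neq x2n0; apply: Sinj.
clearbody x1.
pose W := cols3 x1 x2 x3.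
have two0 := two0 hk.
have uW : W \in unitmx.
  apply: cols3_unit => p q r E'.
  have p0 : p = 0.
    have : (1%:M + N1) *m (p *: x1 + q *: x2 + r *: x3) = 0 by rewrite E' mulmx0.
    rewrite mulmxDl mul1mx !mulmxDr -!scalemxAr a1 a2 a3 => e.
    have /eqP : 2%:R *: (p *: x1) = 0.
      by rewrite -[RHS]e; apply/matrixP => i j; rewrite !mxE; ring.
    by rewrite !scaler_eq0 (negPf two0) (negPf x1n0) orbF => /eqP.
  have q0 : q = 0.
    have : (1%:M + N2) *m (p *: x1 + q *: x2 + r *: x3) = 0 by rewrite E' mulmx0.
    rewrite mulmxDl mul1mx !mulmxDr -!scalemxAr b1 b2 b3 => e.
    have /eqP : 2%:R *: (q *: x2) = 0.
      by rewrite -[RHS]e; apply/matrixP => i j; rewrite !mxE; ring.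
    by rewrite !scaler_eq0 (negPf two0) (negPf x2n0) orbF => /eqP.
  split=> //; move: E'; rewrite p0 q0 !scale0r !add0r => /eqP.
  by rewrite scaler_eq0 (negPf x3n0) orbF => /eqP.
have imst N g : (g = g1 \/ g = g2 \/ g = t) -> cl N = g ->
    [/\ im (cl N) Q = Q, im (cl N) Q' = Q' & aut_Gamma k (cl N)].
  by move=> gg ->; have [[? ?] [? ?]] := gst g gg; split.
have Sst : [/\ im (cl S) Q = Q, im (cl S) Q' = Q' & aut_Gamma k (cl S)].
  have [[tG tQ] [_ tQ']] := gst t (or_intror (or_intror erefl)).
  rewrite -tS; split; first by rewrite -[in LHS]tQ imK.
    by rewrite -[in LHS]tQ' imK.
  by apply: (@im_inj _ t); rewrite imKV; exact/esym.
have [S_Q S_Q' S_G] := Sst.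
have [N1Q N1Q' N1G] := imst N1 _ (or_introl erefl) clN1.
have [N2Q N2Q' N2G] := imst N2 _ (or_intror (or_introl erefl)) clN2.
have invol C QC N : totally_tangent_conic QC -> C^T = C -> C \in unitmx -> QC = conic C ->
    N *m N = 1%:M -> im (cl N) QC = QC -> forall x y, form C (N *m x) (N *m y) = form C x y.
  move=> ttC CT uC QC_E NN NQ x y; rewrite formM.
  have [c _ cE] := stab_form ttC CT uC QC_E (NNunit _ NN) NQ.
  by rewrite cE (invol_form uC NN cE) scale1r.
have hinvol N : N *m N = 1%:M -> aut_Gamma k (cl N) -> forall x y,
    dot (N *m x) ((N *m y)^f) = dot x (y^f).
  move=> NN NG x y; have [c _ cE] := aut_form (NNunit _ NN) NG.
  by rewrite (hdotM _ _ cE) (invol_herm NN cE) mul1r.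
have formNr C x y : form C x (- y) = - form C x y.
  by rewrite -scaleN1r /form -scalemxAr mxE mulN1r.
have formNl C x y : form C (- x) y = - form C x y.
  by rewrite /form linearN /= !mulNmx mxE.
have dotNr x y : dot x (- y) = - dot x y by rewrite -scaleN1r dotZr mulN1r.
have dotNl x y : dot (- x) y = - dot x y by rewrite -scaleN1r dotZl mulN1r.
have mxFN x : (- x : 'cV[k]_3)^f = - x^f by rewrite map_mxN.
have anti (a : k) : - a = a -> a = 0.
  by move=> e; apply: (mulfI two0); rewrite mulr0 -[RHS](subrr a) e; ring.
(* [c] is the multiplier of [S] on the form; going once around the cycle of vectors gives c^3 =
   1. *)
have diagB C QC : totally_tangent_conic QC -> C^T = C -> C \in unitmx -> QC = conic C ->
    im (cl N1) QC = QC -> im (cl N2) QC = QC -> im (cl S) QC = QC ->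
    exists c, [/\ c ^+ 3 = 1, form C x1 x1 != 0 &
      W^T *m C *m W = dg (form C x1 x1) (c * form C x1 x1) (c ^+ 2 * form C x1 x1)].
  move=> ttC CT uC QC_E q1 q2 qS.
  have I1 := invol _ _ _ ttC CT uC QC_E NN1 q1; have I2 := invol _ _ _ ttC CT uC QC_E NN2 q2.
  have [c _ cE] := stab_form ttC CT uC QC_E uS qS.
  have IS x y : form C (S *m x) (S *m y) = c * form C x y by rewrite formM cE formZ.
  have f12 : form C x1 x2 = 0.
    by apply: anti; rewrite -[in RHS](I1 x1 x2) a1 a2 formNr.
  have f13 : form C x1 x3 = 0.
    by apply: anti; rewrite -[in RHS](I1 x1 x3) a1 a3 formNr.
  have f23 : form C x2 x3 = 0.
    by apply: anti; rewrite -[in RHS](I2 x2 x3) b2 b3 formNr.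
  have f11 : form C x1 x1 != 0.
    apply: contra_neq x1n0 => f11.
    have : (cols3 x1 x1 x1)^T *m C *m W = 0.
      rewrite cols3_form f11 f12 f13.
      by apply/matrixP; elim/I3P; elim/I3P; rewrite !mxE.
    move=> /(congr1 (fun X => X *m invmx W)); rewrite mulmxK // mul0mx => /(congr1 (fun X => X *m invmx C)).
    rewrite mulmxK // mul0mx => /(congr1 trmx); rewrite trmxK trmx0 => /matrixP z.
    by apply: cV3_eq; [have := z i0 i0|have := z i1 i0|have := z i2 i0]; rewrite !mxE.
  have c3 : c ^+ 3 = 1.
    have x1c : form C x1 x1 = c ^+ 3 * form C x1 x1.
      by rewrite -{1 2}Sx3 IS /x3 IS /x2 IS exprS expr2 !mulrA.
    by apply: (mulIf f11); rewrite mul1r -x1c.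
  have WC : W^T *m C *m W = dg (form C x1 x1) (c * form C x1 x1) (c ^+ 2 * form C x1 x1).
    rewrite cols3_form (formC x2 x1) // (formC x3 x1) // (formC x3 x2) // f12 f13 f23.
    have -> : form C x2 x2 = c * form C x1 x1 := IS _ _.
    have -> : form C x3 x3 = c ^+ 2 * form C x1 x1 by rewrite expr2 -mulrA -!IS.
    by apply/matrixP; elim/I3P; elim/I3P; rewrite !mxE /=; ring.
  by exists c.
have [c [c3 b0 WB]] := diagB B Q ttQ BT uB QB N1Q N2Q S_Q.
have [c' [c'3 b'0 WB']] := diagB B' Q' ttQ' B'T uB' QB' N1Q' N2Q' S_Q'.
pose h := dot x1 x1^f.
have H1 := hinvol _ NN1 N1G; have H2 := hinvol _ NN2 N2G.
have [d dn0 dE] := aut_form uS S_G.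
have HS x y : dot (S *m x) (S *m y)^f = d * dot x y^f := hdotM _ _ dE.
have d3 : h = d ^+ 3 * h by rewrite /h -{1 2}Sx3 HS /x3 HS /x2 HS exprS expr2 !mulrA.
have hW : W^T *m W^f = dg h (d * h) (d ^+ 2 * h).
  have h12 : dot x1 x2^f = 0 by apply: anti; rewrite -[in RHS](H1 x1 x2) a1 a2 mxFN dotNr.
  have h21 : dot x2 x1^f = 0 by apply: anti; rewrite -[in RHS](H1 x2 x1) a1 a2 dotNl.
  have h13 : dot x1 x3^f = 0 by apply: anti; rewrite -[in RHS](H1 x1 x3) a1 a3 mxFN dotNr.
  have h31 : dot x3 x1^f = 0 by apply: anti; rewrite -[in RHS](H1 x3 x1) a1 a3 dotNl.
  have h23 : dot x2 x3^f = 0 by apply: anti; rewrite -[in RHS](H2 x2 x3) b2 b3 mxFN dotNr.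
  have h32 : dot x3 x2^f = 0 by apply: anti; rewrite -[in RHS](H2 x3 x2) b2 b3 dotNl.
  rewrite -[W^T]mulmx1 /W cols3_Frob cols3_form !form_dot !mul1mx h12 h13 h21 h23 h31 h32.
  have -> : dot x2 x2^f = d * h := HS _ _.
  have -> : dot x3 x3^f = d ^+ 2 * h by rewrite expr2 -mulrA /h -!HS.
  by apply/matrixP; elim/I3P; elim/I3P; rewrite !mxE /=; ring.
have [h0 dh0 ddh0] : [/\ h != 0, d * h != 0 & d ^+ 2 * h != 0].
  apply: unit_dg; rewrite -hW unitmx_mul unitmx_tr uW.
  by rewrite map_unitmx.
have {}d3 : d ^+ 3 = 1 by apply: (mulIf h0); rewrite -d3 mul1r.
(* With d^3 = 1 known, it remains to get d^2 = 1. Written in this basis, [tt_conjugate] yields s h^2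
   = b^6 and s (d h)^2 = (c b)^6 = b^6. *)
have d1 : d = 1.
  apply: one_of_two_three d3; have [s sE] := tt_conjugate ttQ BT uB QB.
  move: (form B x1 x1) b0 WB => b b0 WB.
  have hWT : (W^f)^T *m W = dg h (d * h) (d ^+ 2 * h) by rewrite -dgT -hW trmx_mul trmxK.
  pose Y := dg h^-1 (d * h)^-1 (d ^+ 2 * h)^-1.
  have WY : W^f *m Y *m W^T = 1%:M.
    by rewrite -mulmxA; apply: mulmx1C; rewrite -mulmxA hW dgM !mulVf ?dg1.
  have : (W^T *m B *m W)^f *m Y *m (W^T *m B *m W) = s *: dg h (d * h) (d ^+ 2 * h).
    transitivity ((W^f)^T *m B^f *m (W^f *m Y *m W^T) *m B *m W).
      by rewrite !mxFM mxFT !mulmxA.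
    by rewrite WY mulmx1 -(mulmxA _ _ B) sE mul_mx_scalar -scalemxAl hWT.
  have -> : (W^T *m B *m W)^f = dg (b ^+ 5) ((c * b) ^+ 5) ((c ^+ 2 * b) ^+ 5).
    by rewrite WB; apply/matrixP; elim/I3P; elim/I3P; rewrite !mxE /= ?pFrobenius_autE ?expr0n.
  rewrite WB !dgM dgZ => eE.
  have /matrixP/(_ i0 i0) := eE; have /matrixP/(_ i1 i1) := eE; rewrite !mxE /= => eE1 eE0.
  have s0 : s * h ^+ 2 = b ^+ 6 by apply: (mulIf (invr_neq0 h0)); transitivity (s * h); [field|rewrite -eE0; field].
  have s1 : s * (d * h) ^+ 2 = (c * b) ^+ 6.
    by apply: (mulIf (invr_neq0 dh0)); transitivity (s * (d * h)); [field; rewrite h0 dn0|rewrite -eE1; field; rewrite h0 dn0].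
  apply: (@mulIf _ (b ^+ 6)); first exact: expf_neq0.
  rewrite mul1r -{1}s0; transitivity (s * (d * h) ^+ 2); first ring.
  by rewrite s1 exprMn -[6%N]/(3 * 2)%N exprM c3 expr1n mul1r.
rewrite d1 expr1n !mul1r in hW.
have cc' : c != c'.
  apply: contra_not_neq QQ' => cc; rewrite QB QB' -(conic_mul B uW) -(conic_mul B' uW) WB WB'.
  move: (form B x1 x1) (form B' x1 x1) b0 b'0 => b b' b0 b'0; rewrite cc.
  rewrite -[b]mulr1 -[b']mulr1 !(mulrCA _ b) !(mulrCA _ b') -!dgZ ?conicZ //.
have [m mE] := nth_root h^-1 (isT : (0 < 6)%N).
have m0 : m != 0 by apply/eqP => z; move/eqP: mE; rewrite z expr0n eq_sym invr_eq0 (negPf h0).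
pose X := W *m dg m m m.
have uX : unitary hk X.
  rewrite /unitary /X trmx_mul mxFM dgT mulmxA -(mulmxA (dg _ _ _)) hW.
  have -> : (dg m m m)^f = dg (m ^+ 5) (m ^+ 5) (m ^+ 5).
    by apply/matrixP; elim/I3P; elim/I3P; rewrite !mxE /= ?pFrobenius_autE ?expr0n.
  rewrite !dgM -dg1 mulrAC -exprS mE mulVf //.
have XB := dg_conj m m m WB; have XB' := dg_conj m m m WB'.
move: (form B x1 x1) (form B' x1 x1) b0 b'0 XB XB' => b b' b0 b'0 XB XB'.
have cu : c * c ^+ 2 = 1 by rewrite -exprS.
have cu' : c' * c' ^+ 2 = 1 by rewrite -exprS.
have c0 : c != 0 by apply/eqP => z; move/eqP: c3; rewrite z expr0n eq_sym oner_eq0.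
have c'0 : c' != 0 by apply/eqP => z; move/eqP: c'3; rewrite z expr0n eq_sym oner_eq0.
have bb : b * m ^+ 2 * (b' * m ^+ 2) != 0 by rewrite !mulf_neq0 ?expf_neq0.
apply: (diag_NF hw uX QB QB' XB XB'); rewrite ?mulf_neq0 ?expf_neq0 //.
- by transitivity (c ^+ 3 * (b * m ^+ 2) ^+ 3); [ring|rewrite c3 mul1r].
- by transitivity ((c ^+ 3) ^+ 2 * (b * m ^+ 2) ^+ 3); [ring|rewrite c3 expr1n mul1r].
- by transitivity (c' ^+ 3 * (b' * m ^+ 2) ^+ 3); [ring|rewrite c'3 mul1r].
- by transitivity ((c' ^+ 3) ^+ 2 * (b' * m ^+ 2) ^+ 3); [ring|rewrite c'3 expr1n mul1r].
- apply: contra_neq cc' => e; apply: (mulIf bb); transitivity (c * b * m ^+ 2 * (b' * m ^+ 2)); first ring.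
  by rewrite -e; ring.
- have : c ^+ 2 != c' ^+ 2.
    apply: contra_neq cc' => e; apply: (@mulIf _ (c ^+ 2)); first exact: expf_neq0.
    by rewrite cu e cu'.
  apply: contra_neq => e; apply: (mulIf bb); transitivity (c ^+ 2 * b * m ^+ 2 * (b' * m ^+ 2)); first ring.
  by rewrite -e; ring.
- apply: contra_neq cc' => e.
  have e' : c * c' ^+ 2 = c ^+ 2 * c'.
    apply: (mulIf bb); transitivity (c * b * m ^+ 2 * (c' ^+ 2 * b' * m ^+ 2)); first ring.
    by rewrite e; ring.
  have cc0 : c * c' != 0 by rewrite mulf_neq0.
  by apply: (mulIf cc0); transitivity (c ^+ 2 * c'); [ring|rewrite -e'; ring].
Qed.

End Tetrahedral.

Lemma Alt_star_ind (T : finType) (x0 x1 : T) (P : {perm T} -> Prop) : x0 != x1 ->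
  P 1%g -> (forall s t, P s -> P t -> P (s * t)%g) ->
  (forall a, a != x0 -> a != x1 -> P (tperm x0 a * tperm x0 x1)%g) ->
  forall s, s \in ('Alt_T)%g -> P s.
Proof.
move=> x01 P1 PM Pg s sA.
have gR : group_set (finset (fun s : {perm T} => `[< P s >])).
  by apply/group_setP; split=> [|t u]; rewrite !finset.in_set; [apply/asboolP|
    move=> /asboolP Pt /asboolP Pu; apply/asboolP; exact: PM].
suff : ('Alt_T \subset Group gR)%g by move=> /fintype.subsetP/(_ s sA); rewrite finset.in_set => /asboolP.
by apply: (Alt_sub_star x01) => a a0 a1; rewrite finset.in_set; apply/asboolP/Pg.
Qed.

(** * Stabilizers of the two conics of the normal form *)

Section Stabilizers.
Variable k : closedFieldType.
Hypothesis hk : 5%N \in [pchar k].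
Variable w : k.
Hypothesis hw : w ^+ 2 + w + 1 = 0.
Local Notation "A ^f" := (map_mx (pFrobenius_aut hk) A).
Implicit Types (A B M N W : 'M[k]_3) (u v : 'cV[k]_3) (Q L : set (P2 k)).

Lemma conic_fix A B c : A \in unitmx -> c != 0 -> A^T *m B *m A = c *: B ->
  im (cl A) (conic B) = conic B.
Proof. by move=> uA c0 E; rewrite -{2}(conic_mul B uA) E conicZ. Qed.

Lemma stab_im A Q : unitary hk A ->
  stab (im (cl A) Q) = [set g | stab Q ((cl A)^-1 * g * cl A)%g].
Proof.
move=> uA; have AG := im_Gamma uA; apply/seteqP; split=> g [gG gQ]; split.
- by rewrite /aut_Gamma /= -/(im _ _) !imM AG (gG : im g _ = _) -{1}AG imK.
- by rewrite /= -/(im _ _) !imM (gQ : im g _ = _) imK.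
- apply: (@im_inj _ (cl A)^-1%g); rewrite -[in RHS]AG imK -[in LHS]AG -!imM.
  exact: gG.
- by apply: (@im_inj _ (cl A)^-1%g); rewrite imK -!imM; exact: gQ.
Qed.

Lemma isomorphic_conj (gT : finGroupType) (H : {group gT}) (a : PGL3 k) X :
  isomorphic_to H X -> isomorphic_to H [set g | X (a^-1 * g * a)%g].
Proof.
move=> [f [fM [fX fi fS]]]; exists (fun s => a * f s * a^-1)%g; split.
  by move=> s t sH tH /=; rewrite fM // !mulgA mulgKV.
split.
- by move=> s sH /=; rewrite !mulgA mulVg mul1g mulgKV; apply: fX.
- by move=> s t sH tH /mulIg/mulgI; apply: fi.
move=> g Xg; have [s sH sE] := fS _ Xg; exists s => //.
by rewrite sE !mulgA mulgV mul1g mulgK.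
Qed.

Definition real_orth A := A^T *m A = 1%:M /\ A^f = A.

Lemma real_orth_unitary A : real_orth A -> unitary hk A.
Proof. by case=> AA Af; rewrite /unitary Af. Qed.

Lemma real_orthM A B : real_orth A -> real_orth B -> real_orth (A *m B).
Proof.
move=> [AA Af] [BB Bf]; split; last by rewrite mxFM Af Bf.
by rewrite trmx_mul mulmxA -(mulmxA _ _ A) AA mulmx1.
Qed.

Lemma real_orth_conic1 A : real_orth A -> im (cl A) (conic 1%:M) = conic 1%:M.
Proof.
move=> RA; apply: (@conic_fix _ _ 1); rewrite ?oner_neq0 ?scale1r //.
  exact/(unitary_unitmx (real_orth_unitary RA)).
by rewrite mulmx1; case: RA.
Qed.

(** A unitary [A] fixing the conic has A^T A = c, hence A^f = c^-1 A. Applying the Frobenius twice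
    gives c^6 = 1, and comparing determinants gives c^9 = 1. So c^3 = 1, and [c *: A] is orthogonal
    with entries in F_5. *)
Lemma stab1P g : stab (conic 1%:M) g <-> exists2 A, real_orth A & g = cl A.
Proof.
split=> [[/(aut_unitary hk)[A uA ->] gQ]|[A RA ->]]; last first.
  by split; [apply/unitary_aut/real_orth_unitary|exact: real_orth_conic1].
have uA' := unitary_unitmx uA.
have [c c0] := conic_im1 hk uA' (trmx1 _ _) (unitmx1 _ _) gQ.
rewrite mulmx1 => AA; have Af : A^f = c^-1 *: A.
  have /(congr1 (fun X => invmx A^T *m X)) : A^T *m A^f = A^T *m (c^-1 *: A).
    by rewrite -scalemxAr AA uA scale_scalar_mx mulVf.
  by rewrite !mulKmx ?unitmx_tr.
have c6 : c ^+ 6 = 1.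
  have := unitary_FF uA; rewrite Af mxFZ Af scalerA => E.
  have : (c^-1 ^+ 6) *: A = A by rewrite exprSr.
  move/(congr1 (fun X => X *m invmx A)); rewrite -scalemxAl mulmxV // => /matrixP/(_ i0 i0).
  by rewrite !mxE mulr1 exprVn => /(canRL (@invrK _)); rewrite invr1.
have dA : \det A != 0 by rewrite -unitfE -unitmxE.
have c9 : c ^+ 9 = 1.
  have d2 : \det A ^+ 2 = c ^+ 3.
    by have := congr1 determinant AA; rewrite det_mulmx det_tr det_scalar.
  have := congr1 determinant Af; rewrite det_map_mx detZ /= pFrobenius_autE => d5.
  have d4 : \det A ^+ 4 = c^-1 ^+ 3 by apply: (mulIf dA); rewrite -exprSr.
  transitivity (c ^+ 3 * (c ^+ 3) ^+ 2); first ring.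
  by rewrite -{2}d2 -exprM d4 exprVn divff ?expf_neq0.
have c3 : c ^+ 3 = 1 by rewrite -c9 -[9%N]/(3 + 6)%N exprD c6 mulr1.
have cV : c^-1 = c ^+ 2 by apply: (mulfI c0); rewrite divff // -exprS c3.
exists (c *: A); last first.
  by apply/(cl_eq uA'); rewrite ?unitmxZ ?unitfE //; exists c^-1; rewrite ?invr_eq0 // scalerA mulVf ?scale1r.
split.
  by rewrite [(_ *: A)^T]linearZ /= -scalemxAl -scalemxAr AA !scalerA scale_scalar_mx -expr2 -exprSr c3.
by rewrite mxFZ Af scalerA cV -exprD -[(5 + 2)%N]/(6 + 1)%N exprD c6 mul1r.
Qed.

Definition cyc : 'M[k]_3 := mx3 [:: [:: 0; 1; 0]; [:: 0; 0; 1]; [:: 1; 0; 0]].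

Lemma real_mx3 A : (forall i j, A i j ^+ 5 = A i j) -> A^f = A.
Proof. by move=> h; apply/matrixP => i j; rewrite mxE pFrobenius_autE. Qed.

Lemma odd_signr5 : (-1 : k) ^+ 5 = -1. Proof. by rewrite !exprS expr0; ring. Qed.

Lemma real_orth_cyc : real_orth cyc.
Proof.
split; first by apply/matrixP; elim/I3P; elim/I3P; rewrite !mxE sum3 !mxE /=; ring.
by apply: real_mx3; elim/I3P; elim/I3P; rewrite !mxE /= ?expr0n ?expr1n.
Qed.

Lemma cyc3 : cyc *m cyc *m cyc = 1%:M.
Proof.
by apply/matrixP; elim/I3P; elim/I3P; rewrite !mxE sum3 !mxE !sum3 !mxE /=; ring.
Qed.

Lemma real_orth_dg a b c : a ^+ 2 = 1 -> b ^+ 2 = 1 -> c ^+ 2 = 1 -> real_orth (dg a b c).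
Proof.
move=> a2 b2 c2; split; first by rewrite dgT dgM -!expr2 a2 b2 c2 dg1.
by apply: real_mx3; elim/I3P; elim/I3P; rewrite !mxE /= ?expr0n //
 -[5%N]/(2 * 2).+1 exprS exprM ?a2 ?b2 ?c2 expr1n mulr1.
Qed.

Local Notation Dw := (dg 1 w (w ^+ 2)).

Lemma cyc_Dw : cyc^T *m Dw *m cyc = w ^+ 2 *: Dw.
Proof.
have w3 := w3 hw.
apply/matrixP; elim/I3P; elim/I3P; rewrite !mxE sum3 !mxE !sum3 !mxE /=;
 first [ring | by rewrite -exprSr w3; ring | by rewrite -exprD (exprD _ 3 1) w3; ring].
Qed.

Lemma dgpm a b c : a ^+ 2 = 1 -> b ^+ 2 = 1 -> c ^+ 2 = 1 ->
  (dg a b c)^T *m Dw *m dg a b c = Dw.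
Proof. by move=> a2 b2 c2; rewrite dgT !dgM; congr dg; rewrite ?mulr1 -?expr2 // mulrAC -expr2 ?b2 ?c2 mul1r. Qed.

Lemma sqrN1 : (-1 : k) ^+ 2 = 1. Proof. by rewrite sqrrN expr1n. Qed.

(** An induction principle saying that the intersection is generated by the three listed classes. A
    common element is orthogonal and multiplies [Dw] by a cube root of unity, which a power of [cyc]
    reduces to 1. It then commutes with [Dw], whose eigenvalues are distinct, so it is diagonal with
    entries 1 and -1. *)
Lemma stab_cap_sub (K : PGL3 k -> Prop) : totally_tangent_conic (conic Dw) ->
  (forall g h, K g -> K h -> K (g * h)%g) -> K 1%g ->
  K (cl (dg 1 (-1) (-1))) -> K (cl (dg (-1) 1 (-1))) -> K (cl cyc) ->
  forall g, (stab (conic 1%:M) `&` stab (conic Dw)) g -> K g.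
Proof.
move=> ttw KM K1 KD1 KD2 Kc _ [/stab1P[A RA ->] [_ gw]].
have w0 := w0 hw; have w1 := w1 hk hw; have w3 := w3 hw; have N1 := sqrN1.
have uO X : real_orth X -> X \in unitmx by move=> /real_orth_unitary/unitary_unitmx.
have diag X : real_orth X -> X^T *m Dw *m X = Dw -> K (cl X).
  move=> RX E; have [XX _] := RX.
  have XX' : X *m X^T = 1%:M by apply: mulmx1C.
  have com : Dw *m X = X *m Dw by rewrite -{2}E !mulmxA XX' mul1mx.
  have ent i j : Dw i i * X i j = X i j * Dw j j.
    have /matrixP/(_ i j) := com; rewrite !mxE !sum3.
    by elim/I3P: i; elim/I3P: j; rewrite !mxE /= ?(mul0r, mulr0, addr0, add0r).
  have w2w := w2w hk hw; have w21 := w21 hk hw.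
  have off i j : i != j -> X i j = 0.
    move=> ij; have /eqP := ent i j; rewrite mulrC -subr_eq0 -mulrBr mulf_eq0 => /orP[/eqP //|].
    rewrite subr_eq0; elim/I3P: i ij; elim/I3P: j; rewrite ?mxE //= => _;
     by rewrite ?(negPf w1) ?(negPf w2w) ?(negPf w21) // eq_sym ?(negPf w1) ?(negPf w2w) ?(negPf w21).
  have XE : X = dg (X i0 i0) (X i1 i1) (X i2 i2).
    by rewrite {1}(mx3E X) (off i0 i1) // (off i0 i2) // (off i1 i0) // (off i1 i2) // (off i2 i0) // (off i2 i1).
  move: XX RX; rewrite XE; move: (X i0 i0) (X i1 i1) (X i2 i2) => a b c {X XX' E com ent off XE}.
  rewrite dgT dgM -!expr2 -dg1 => XX RX.
  have /matrixP E := XX; have a2 := E i0 i0; have b2 := E i1 i1; have c2 := E i2 i2.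
  rewrite !mxE /= in a2 b2 c2.
  have pm (e : k) : e ^+ 2 = 1 -> e = 1 \/ e = -1.
    by move=> /eqP; rewrite sqrf_eq1 => /orP[]/eqP; auto.
  have neg x y z : x ^+ 2 = 1 -> y ^+ 2 = 1 -> z ^+ 2 = 1 -> K (cl (dg x y z)) -> K (cl (dg (- x) (- y) (- z))).
    move=> x2 y2 z2; rewrite (_ : cl (dg (-x) _ _) = cl (dg x y z)) //.
    apply/cl_eq; [| |by exists (-1); rewrite ?oppr_eq0 ?oner_neq0 // dgZ !mulN1r];
      by apply: uO; apply: real_orth_dg; rewrite ?sqrrN.
  have I2 : (1 : k) ^+ 2 = 1 by rewrite expr1n.
  have K3 : K (cl (dg (-1) (-1) 1)).
    have := KM _ _ KD1 KD2; rewrite -clM ?dgM ?uO //; try exact: real_orth_dg.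
    by rewrite !mul1r mulr1 mulrNN mulr1.
  have K4 : K (cl (dg 1 1 1)) by rewrite dg1 cl1.
  case: (pm _ a2) (pm _ b2) (pm _ c2) => -> [] -> [] -> //.
  - by have := neg _ _ _ N1 N1 I2 K3; rewrite !opprK.
  - by have := neg _ _ _ N1 I2 N1 KD2; rewrite !opprK.
  - by have := neg _ _ _ I2 N1 N1 KD1; rewrite !opprK.
  - exact: (neg _ _ _ I2 I2 I2 K4).
have cM X c : X^T *m Dw *m X = c *: Dw -> (cyc *m X)^T *m Dw *m (cyc *m X) = (w ^+ 2 * c) *: Dw.
  move=> E; rewrite trmx_mul -!mulmxA (mulmxA Dw) (mulmxA cyc^T) mulmxA (mulmxA cyc^T) cyc_Dw.
  by rewrite -scalemxAr -scalemxAl E scalerA.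
have Rc := real_orth_cyc; have uc := uO _ Rc.
have clA X : real_orth X -> K (cl (cyc *m X)) -> K (cl X).
  move=> RX KX; have uX := uO _ RX.
  have -> : cl X = (cl cyc * cl cyc * cl (cyc *m X))%g.
    by rewrite -!clM ?unitmx_mul ?uc ?uX // !mulmxA cyc3 mul1mx.
  by apply: (KM) => //; apply: KM.
have step X : real_orth X -> X^T *m Dw *m X = w *: Dw -> K (cl X).
  move=> RX E; apply: clA => //; apply: diag; first exact: real_orthM.
  by rewrite (cM _ _ E) -exprSr w3 scale1r.
have uD : Dw \in unitmx by rewrite dg_unit ?oner_neq0 ?expf_neq0.
have [c _ cE] := stab_form hk ttw (dgT _ _ _) uD erefl (uO _ RA) gw.
have c3 : c ^+ 3 = 1.
  have dD : \det Dw != 0 by rewrite -unitfE -unitmxE.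
  have dA : \det A ^+ 2 = 1.
    by have [AA _] := RA; have := congr1 determinant AA; rewrite det_mulmx det_tr det1.
  have := congr1 determinant cE; rewrite !det_mulmx det_tr detZ => e.
  by apply: (mulIf dD); rewrite -e mulrAC -expr2 dA.
have [c1|cn1] := eqVneq c 1; first by apply: diag; rewrite // cE c1 scale1r.
have [cE'|cE'] := cube_root hw c3 cn1; rewrite cE' in cE; first exact: step.
apply: clA => //; apply: step; first exact: real_orthM.
by rewrite (cM _ _ cE) -exprD (exprD _ 3 1) w3 mul1r.
Qed.

End Stabilizers.

(** * The alternating group on the vertices of a tetrahedron *)

Section AltFour.
Variable k : closedFieldType.
Hypothesis hk : 5%N \in [pchar k].
Variable w : k.
Hypothesis hw : w ^+ 2 + w + 1 = 0.
Local Notation "A ^f" := (map_mx (pFrobenius_aut hk) A).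
Local Notation Dw := (dg 1 w (w ^+ 2)).
Local Notation j0 := (@Ordinal 4 0 isT).
Local Notation j1 := (@Ordinal 4 1 isT).
Local Notation j2 := (@Ordinal 4 2 isT).
Local Notation j3 := (@Ordinal 4 3 isT).

Lemma I4P (P : 'I_4 -> Prop) : P j0 -> P j1 -> P j2 -> P j3 -> forall i, P i.
Proof.
move=> P0 P1 P2 P3 [[|[|[|[|//]]]] h].
- by have -> : Ordinal h = j0 by apply: val_inj.
- by have -> : Ordinal h = j1 by apply: val_inj.
- by have -> : Ordinal h = j2 by apply: val_inj.
- by have -> : Ordinal h = j3 by apply: val_inj.
Qed.

Lemma sum4 (V : nmodType) (f : 'I_4 -> V) : \sum_i f i = f j0 + f j1 + f j2 + f j3.
Proof.
rewrite !big_ord_recl big_ord0 addr0 !addrA.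
by congr (f _ + f _ + f _ + f _); apply: val_inj.
Qed.

(* The four vertices of a regular tetrahedron; [4 = -1] in [k]. *)
Definition vertex (j : 'I_4) : 'cV[k]_3 :=
  nth 0 [:: cv3 1 1 1; cv3 1 (-1) (-1); cv3 (-1) 1 (-1); cv3 (-1) (-1) 1] j.

(** The matrix sending [vertex (s j)] to [vertex j]; the sign is there because the sum of the v v^T
    over the vertices is 4 = -1. This direction makes the map multiplicative for products of
    permutations read from left to right. *)
Definition vertex_mx (s : {perm 'I_4}) : 'M[k]_3 :=
  - \sum_i vertex i *m (vertex (s i))^T.

Lemma vertex_sum : \sum_i vertex i = 0.
Proof. by rewrite sum4; apply: cV3_eq; rewrite !mxE /=; ring. Qed.

Lemma vertex_dot i j : (vertex i)^T *m vertex j = (if i == j then -2 else -1)%:M.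
Proof.
apply/matrixP => a b; rewrite !ord1 mxE sum3 !mxE.
elim/I4P: i; elim/I4P: j; rewrite /= ?mxE /=; try ring;
 by apply/eqP; rewrite -subr_eq0; apply/eqP; apply: etrans (five0 hk 1); ring.
Qed.

Lemma vertex_mx1 : vertex_mx 1%g = 1%:M.
Proof.
rewrite /vertex_mx sum4 !perm1; apply/matrixP; elim/I3P; elim/I3P; rewrite !mxE !big_ord1 !mxE /=;
 try ring; by apply/eqP; rewrite -subr_eq0; apply/eqP; apply: etrans (five0 hk (-1)); ring.
Qed.

Lemma vertex_mx_act s j : vertex_mx s *m vertex j = vertex ((s^-1)%g j).
Proof.
rewrite /vertex_mx mulNmx mulmx_suml.
have E i : vertex i *m (vertex (s i))^T *m vertex j
    = - vertex i - (if s i == j then vertex i else 0).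
  rewrite -mulmxA vertex_dot mul_mx_scalar; case: eqP => _.
    by rewrite -[-2]opprK -scaleN1r; apply: cV3_eq; rewrite !mxE; ring.
  by rewrite scaleN1r subr0.
under eq_bigr do rewrite E.
rewrite sumrB sumrN vertex_sum oppr0 sub0r opprK -big_mkcond /=.
rewrite (big_pred1 ((s^-1)%g j)) // => i; apply/eqP/eqP => [<-|->]; first by rewrite permK.
by rewrite permKV.
Qed.

Lemma vertex_mx_eq N (s : {perm 'I_4}) : (forall j, N *m vertex (s j) = vertex j) -> N = vertex_mx s.
Proof.
move=> Ns; rewrite -[LHS]mulmx1 -vertex_mx1 /vertex_mx mulmxN mulmx_sumr; congr (- _).
rewrite (reindex_inj (@perm_inj _ s)); apply: eq_bigr => i _.
by rewrite mulmxA perm1 Ns.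
Qed.

Lemma vertex_mxM s t : vertex_mx (s * t)%g = vertex_mx s *m vertex_mx t.
Proof.
apply/esym/vertex_mx_eq => j; rewrite -mulmxA vertex_mx_act permM permK.
by rewrite vertex_mx_act permK.
Qed.

Lemma vertex_mxT s : (vertex_mx s)^T = vertex_mx (s^-1)%g.
Proof.
rewrite /vertex_mx linearN /= linear_sum /=; congr (- _).
rewrite (reindex_inj (@perm_inj _ s^-1%g)); apply: eq_bigr => i _.
by rewrite trmx_mul trmxK permKV.
Qed.

Lemma vertex_mx_real s : real_orth hk (vertex_mx s).
Proof.
split; first by rewrite vertex_mxT -vertex_mxM mulVg vertex_mx1.
have vf j : (vertex j)^f = vertex j.
  apply/matrixP => a b; rewrite ord1 mxE pFrobenius_autE; elim/I3P: a;
  by elim/I4P: j; rewrite !mxE /= ?expr1n ?odd_signr5.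
rewrite /vertex_mx map_mxN; congr (- _); rewrite !sum4.
by rewrite !map_mxD !map_mxM -!map_trmx !vf.
Qed.

Lemma vertex_mx_unit s : vertex_mx s \in unitmx.
Proof. exact: unitary_unitmx (real_orth_unitary (vertex_mx_real s)). Qed.

Lemma vertex_inj : injective vertex.
Proof.
move=> i j E; apply/eqP; have := vertex_dot i j; rewrite E vertex_dot eqxx.
case: eqP => // _ /matrixP/(_ 0 0); rewrite !mxE /= !mulr1n => e.
have /eqP : (1 : k) = 0 by transitivity (-1 - (-2) : k); [ring|rewrite e subrr].
by rewrite oner_eq0.
Qed.

(** A scalar [c] taking a vertex to a vertex is 1: coordinates have square 1 and the three
    coordinates of each vertex have product 1, so c^2 = c^3 = 1. *)
Lemma vertex_mx_cl_inj s t : cl (vertex_mx s) = cl (vertex_mx t) -> s = t.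
Proof.
move=> /(cl_eq (vertex_mx_unit s) (vertex_mx_unit t))[c c0 E].
have Ev j : vertex ((s^-1)%g j) = c *: vertex ((t^-1)%g j).
  by rewrite -!vertex_mx_act E -scalemxAl.
have c1 : c = 1.
  have prodv i : vertex i i0 0 * vertex i i1 0 * vertex i i2 0 = 1.
    by elim/I4P: i; rewrite !mxE /=; ring.
  have normv i : (vertex i i0 0) ^+ 2 = 1 by elim/I4P: i; rewrite !mxE /=; ring.
  have := Ev j0; move: ((s^-1)%g j0) ((t^-1)%g j0) => a b Eab.
  apply: one_of_two_three.
    by have := normv a; rewrite Eab mxE exprMn normv mulr1.
  have := prodv a; rewrite Eab !mxE -[c ^+ 3]mulr1 -{2}(prodv b) => <-; ring.
apply: invg_inj; apply/permP => j; apply: vertex_inj.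
by rewrite Ev c1 scale1r.
Qed.

Lemma vertex_klein1 : vertex_mx (klein1 j0 j1 j2 j3) = dg 1 (-1) (-1).
Proof.
by apply/esym/vertex_mx_eq; elim/I4P; rewrite permM !permE /=; apply: cV3_eq;
 rewrite !mxE !sum3 !mxE /=; ring.
Qed.

Lemma vertex_klein2 : vertex_mx (klein2 j0 j1 j2 j3) = dg (-1) 1 (-1).
Proof.
by apply/esym/vertex_mx_eq; elim/I4P; rewrite permM !permE /=; apply: cV3_eq;
 rewrite !mxE !sum3 !mxE /=; ring.
Qed.

Lemma vertex_tri3 : vertex_mx (tri3 j1 j2 j3) = cyc k.
Proof.
apply/esym/vertex_mx_eq; elim/I4P; rewrite permM !permE /=; apply: cV3_eq;
 rewrite !mxE !sum3 !mxE /=; ring.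
Qed.

(** The star generators are products of [klein1] and [tri3], whose matrices multiply [Dw] by 1 and
    by w^2. *)
Lemma vertex_mx_Dw s : s \in ('Alt_('I_4))%g -> im (cl (vertex_mx s)) (conic Dw) = conic Dw.
Proof.
have N1 := sqrN1 k; have I1 : (1 : k) ^+ 2 = 1 by rewrite expr1n.
pose P (s : {perm 'I_4}) := im (cl (vertex_mx s)) (conic Dw) = conic Dw.
have PM s1 t : P s1 -> P t -> P (s1 * t)%g.
  by rewrite /P vertex_mxM clM ?vertex_mx_unit // imM => Ps ->.
have PD (a b c : k) : a ^+ 2 = 1 -> b ^+ 2 = 1 -> c ^+ 2 = 1 ->
    im (cl (dg a b c)) (conic Dw) = conic Dw.
  move=> a2 b2 c2; have R := real_orth_dg hk a2 b2 c2.
  apply: (@conic_fix _ _ _ 1); rewrite ?oner_neq0 ?scale1r ?dgpm //.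
  exact: unitary_unitmx (real_orth_unitary R).
have P1 : P (klein1 j0 j1 j2 j3) by rewrite /P vertex_klein1; apply: PD.
have P3 : P (tri3 j1 j2 j3).
  rewrite /P vertex_tri3; apply: (conic_fix _ _ (cyc_Dw hw)).
    exact: unitary_unitmx (real_orth_unitary (real_orth_cyc hk)).
  by rewrite expf_neq0 ?(w0 hw).
apply: (@Alt_star_ind _ j0 j1 P) => //; first by rewrite /P vertex_mx1 cl1 im1.
elim/I4P => // _ _.
  rewrite (_ : _ * _ = klein1 j0 j1 j2 j3 * tri3 j1 j2 j3)%g; first exact: PM.
  by apply/permP; elim/I4P; rewrite !permM !permE /=; apply: val_inj.
rewrite (_ : _ * _ = klein1 j0 j1 j2 j3 * tri3 j1 j2 j3 * tri3 j1 j2 j3)%g.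
  by apply: (PM) => //; apply: PM.
by apply/permP; elim/I4P; rewrite !permM !permE /=; apply: val_inj.
Qed.

Lemma tetra_iso : totally_tangent_conic (conic Dw) ->
  isomorphic_to ('Alt_('I_4))%G (stab (conic 1%:M) `&` stab (conic Dw)).
Proof.
move=> ttw; exists (fun s => cl (vertex_mx s)); split.
  by move=> s t _ _ /=; rewrite vertex_mxM clM ?vertex_mx_unit.
split.
- move=> s sA; have R := vertex_mx_real s.
  have S1 : stab (conic 1%:M) (cl (vertex_mx s)) by apply/(stab1P hk); exists (vertex_mx s).
  by split=> //; split; [case: S1|apply: vertex_mx_Dw].
- by move=> s t _ _; apply: vertex_mx_cl_inj.
apply: (stab_cap_sub hk hw) => //.
- move=> _ _ [s sA <-] [t tA <-]; exists (s * t)%g; first by rewrite /= groupM.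
  by rewrite vertex_mxM clM ?vertex_mx_unit.
- by exists 1%g; rewrite ?vertex_mx1 ?cl1 //= group1.
- by exists (klein1 j0 j1 j2 j3); rewrite ?vertex_klein1 //=; apply: klein1_Alt.
- by exists (klein2 j0 j1 j2 j3); rewrite ?vertex_klein2 //=; apply: klein2_Alt.
- by exists (tri3 j1 j2 j3); rewrite ?vertex_tri3 //=; apply: (@tri3_Alt _ j0 j1 j2 j3).
Qed.

Lemma NF_iso Q Q' : totally_tangent_conic Q' -> NF hk w Q Q' ->
  isomorphic_to ('Alt_('I_4))%G (stab Q `&` stab Q').
Proof.
move=> ttQ' [A [uA -> Q'E]]; rewrite Q'E !(stab_im _ uA).
apply: (isomorphic_conj _ (tetra_iso _)).
have uV := unitaryV uA; have := tt_im uV ttQ'.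
by rewrite Q'E clV ?unitary_unitmx // imK.
Qed.

End AltFour.

(** * The component of 21 conics *)

(* Elements a + b w of the field with 25 elements, where w is a primitive cube
   root of unity, stored as pairs (a, b) reduced modulo 5. *)
Definition f25 := (nat * nat)%type.
Definition add25 (x y : f25) : f25 := ((x.1 + y.1) %% 5, (x.2 + y.2) %% 5)%N.
(** The reduction uses w^2 = 4 + 4 w; as w^5 = w^2, it also explains the formula of [frob25]. *)
Definition mul25 (x y : f25) : f25 :=
  ((x.1 * y.1 + 4 * x.2 * y.2) %% 5, (x.1 * y.2 + x.2 * y.1 + 4 * x.2 * y.2) %% 5)%N.
Definition frob25 (x : f25) : f25 := ((x.1 + 4 * x.2) %% 5, (4 * x.2) %% 5)%N.
Definition red25 : seq f25 := [seq (a, b) | a <- iota 0 5, b <- iota 0 5].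

Definition mx25 := seq (seq f25).
Definition ent (A : mx25) (i j : nat) : f25 := nth (0, 0)%N (nth [::] A i) j.
Definition tab25 (f : nat -> nat -> f25) : mx25 := mkseq (fun i => mkseq (f i) 3) 3.
Definition mulm (A B : mx25) : mx25 := tab25 (fun i j =>
  add25 (add25 (mul25 (ent A i 0) (ent B 0 j)) (mul25 (ent A i 1) (ent B 1 j)))
        (mul25 (ent A i 2) (ent B 2 j))).
Definition trm (A : mx25) : mx25 := tab25 (fun i j => ent A j i).
Definition frm (A : mx25) : mx25 := tab25 (fun i j => frob25 (ent A i j)).
Definition onem : mx25 := tab25 (fun i j => if i == j then (1, 0) else (0, 0))%N.
Definition units25 : seq f25 := behead red25.
Definition ix3 := [seq (i, j) | i <- iota 0 3, j <- iota 0 3].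
Definition propto (A B : mx25) :=
  has (fun c => all (fun p => ent B p.1 p.2 == mul25 c (ent A p.1 p.2)) ix3) units25.
Definition indep (A B : mx25) := has (fun p => has (fun q =>
  mul25 (ent A p.1 p.2) (ent B q.1 q.2) != mul25 (ent A q.1 q.2) (ent B p.1 p.2)) ix3) ix3.

(* The 21 Gram matrices of a component of the graph, indexed by the pairs of
   elements of a set with 7 elements. *)
Definition gram_table : seq (seq mx25) := [::
  [:: [:: [:: (1, 0); (0, 0); (0, 0)]; [:: (0, 0); (1, 0); (0, 0)]; [:: (0, 0); (0, 0); (1, 0)]];
      [:: [:: (1, 0); (0, 0); (0, 0)]; [:: (0, 0); (0, 1); (0, 0)]; [:: (0, 0); (0, 0); (4, 4)]];
      [:: [:: (1, 0); (0, 2); (3, 3)]; [:: (0, 2); (4, 4); (3, 0)]; [:: (3, 3); (3, 0); (0, 1)]];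
      [:: [:: (1, 0); (0, 3); (3, 3)]; [:: (0, 3); (4, 4); (2, 0)]; [:: (3, 3); (2, 0); (0, 1)]];
      [:: [:: (1, 0); (0, 2); (2, 2)]; [:: (0, 2); (4, 4); (2, 0)]; [:: (2, 2); (2, 0); (0, 1)]];
      [:: [:: (1, 0); (0, 3); (2, 2)]; [:: (0, 3); (4, 4); (3, 0)]; [:: (2, 2); (3, 0); (0, 1)]]];
  [:: [:: [:: (1, 0); (0, 0); (0, 0)]; [:: (0, 0); (4, 4); (0, 0)]; [:: (0, 0); (0, 0); (0, 1)]];
      [:: [:: (1, 0); (3, 3); (0, 2)]; [:: (3, 3); (0, 1); (3, 0)]; [:: (0, 2); (3, 0); (4, 4)]];
      [:: [:: (1, 0); (2, 2); (0, 2)]; [:: (2, 2); (0, 1); (2, 0)]; [:: (0, 2); (2, 0); (4, 4)]];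
      [:: [:: (1, 0); (3, 3); (0, 3)]; [:: (3, 3); (0, 1); (2, 0)]; [:: (0, 3); (2, 0); (4, 4)]];
      [:: [:: (1, 0); (2, 2); (0, 3)]; [:: (2, 2); (0, 1); (3, 0)]; [:: (0, 3); (3, 0); (4, 4)]]];
  [:: [:: [:: (1, 0); (2, 0); (2, 0)]; [:: (2, 0); (1, 0); (3, 0)]; [:: (2, 0); (3, 0); (1, 0)]];
      [:: [:: (1, 0); (3, 0); (2, 0)]; [:: (3, 0); (1, 0); (2, 0)]; [:: (2, 0); (2, 0); (1, 0)]];
      [:: [:: (1, 0); (2, 0); (3, 0)]; [:: (2, 0); (1, 0); (2, 0)]; [:: (3, 0); (2, 0); (1, 0)]];
      [:: [:: (1, 0); (3, 0); (3, 0)]; [:: (3, 0); (1, 0); (3, 0)]; [:: (3, 0); (3, 0); (1, 0)]]];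
  [:: [:: [:: (0, 0); (0, 0); (1, 0)]; [:: (0, 0); (1, 0); (0, 0)]; [:: (1, 0); (0, 0); (0, 0)]];
      [:: [:: (0, 0); (1, 0); (0, 0)]; [:: (1, 0); (0, 0); (0, 0)]; [:: (0, 0); (0, 0); (1, 0)]];
      [:: [:: (1, 0); (0, 0); (0, 0)]; [:: (0, 0); (0, 0); (4, 0)]; [:: (0, 0); (4, 0); (0, 0)]]];
  [:: [:: [:: (1, 0); (0, 0); (0, 0)]; [:: (0, 0); (0, 0); (1, 0)]; [:: (0, 0); (1, 0); (0, 0)]];
      [:: [:: (0, 0); (1, 0); (0, 0)]; [:: (1, 0); (0, 0); (0, 0)]; [:: (0, 0); (0, 0); (4, 0)]]];
  [:: [:: [:: (0, 0); (0, 0); (1, 0)]; [:: (0, 0); (4, 0); (0, 0)]; [:: (1, 0); (0, 0); (0, 0)]]]]%N.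

Definition gram25 (i j : nat) : mx25 :=
  if (i < j)%N then nth [::] (nth [::] gram_table i) (j - i.+1)
  else nth [::] (nth [::] gram_table j) (i - j.+1).

(* Unitary lifts of the 3-cycles [tperm 0 a * tperm 0 1], for [a = 2, .., 6]. *)
Definition lift_table : seq mx25 := [::
  [:: [:: (1, 0); (0, 0); (0, 0)]; [:: (0, 0); (4, 4); (0, 0)]; [:: (0, 0); (0, 0); (0, 1)]];
  [:: [:: (3, 3); (0, 4); (4, 0)]; [:: (0, 4); (2, 0); (4, 4)]; [:: (4, 0); (4, 4); (0, 2)]];
  [:: [:: (0, 3); (4, 0); (4, 4)]; [:: (4, 0); (2, 2); (0, 1)]; [:: (4, 4); (0, 1); (3, 0)]];
  [:: [:: (0, 3); (1, 0); (1, 1)]; [:: (1, 0); (2, 2); (0, 1)]; [:: (1, 1); (0, 1); (3, 0)]];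
  [:: [:: (2, 2); (0, 4); (4, 0)]; [:: (0, 4); (3, 0); (1, 1)]; [:: (4, 0); (1, 1); (0, 3)]]]%N.

(** For a unitary [A] the inverse is the transpose of [A^f], so this is the matrix of the image of
    the conic [B]. *)
Definition cj25 (A B : mx25) := mulm (mulm (frm A) B) (trm (frm A)).
Definition perm_lift (A : mx25) (s : seq nat) :=
  (mulm (trm A) (frm A) == onem) &&
  all (fun i => all (fun j => (i == j) || propto (gram25 i j) (cj25 A (gram25 (nth 0 s i) (nth 0 s j))))
    (iota 0 7)) (iota 0 7).

Definition star_seq (a : nat) : seq nat :=
  [seq if i == 0 then a else if i == a then 1 else if i == 1 then 0 else i | i <- iota 0 7]%N.

Lemma star_lifts : all (fun a => perm_lift (nth [::] lift_table (a - 2)) (star_seq a)) (iota 2 5).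
Proof. by vm_compute. Qed.

(** The tetrahedral group common to the stabilizers of {0, 1} and {0, 2} fixes 0, 1, 2 and permutes
    3, 4, 5, 6 evenly. This lemma and the next two give the action of its generators. *)
Lemma klein1_lift : perm_lift [:: [:: (1, 0); (0, 0); (0, 0)]; [:: (0, 0); (4, 0); (0, 0)];
  [:: (0, 0); (0, 0); (4, 0)]]%N [:: 0; 1; 2; 6; 5; 4; 3]%N.
Proof. by vm_compute. Qed.

Lemma klein2_lift : perm_lift [:: [:: (4, 0); (0, 0); (0, 0)]; [:: (0, 0); (1, 0); (0, 0)];
  [:: (0, 0); (0, 0); (4, 0)]]%N [:: 0; 1; 2; 4; 3; 6; 5]%N.
Proof. by vm_compute. Qed.

Lemma cyc_lift : perm_lift [:: [:: (0, 0); (1, 0); (0, 0)]; [:: (0, 0); (0, 0); (1, 0)];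
  [:: (1, 0); (0, 0); (0, 0)]]%N [:: 0; 1; 2; 5; 3; 4; 6]%N.
Proof. by vm_compute. Qed.

Definition pairs7 := [seq (i, j) | i <- iota 0 7, j <- iota 0 7].

Lemma gram_indep : all (fun p => all (fun q =>
  [|| p.1 >= p.2, q.1 >= q.2, p == q | indep (gram25 p.1 p.2) (gram25 q.1 q.2)]) pairs7)%N pairs7.
Proof. by vm_compute. Qed.

Definition vecs5 : seq (seq f25) :=
  [seq [:: (a, 0)%N; x.1; x.2] | a <- iota 0 5,
     x <- [seq ((b, 0)%N, (c, 0)%N) | b <- iota 0 5, c <- iota 0 5]].
Definition dot25 (u v : seq f25) : f25 :=
  add25 (add25 (mul25 (nth (0, 0) u 0) (nth (0, 0) v 0)) (mul25 (nth (0, 0) u 1) (nth (0, 0) v 1)))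
     (mul25 (nth (0, 0) u 2) (nth (0, 0) v 2))%N.
Definition units5 := [seq u <- vecs5 | dot25 u u == (1, 0)%N].

Definition orth5 u := [seq v <- units5 | dot25 u v == (0, 0)%N].
Definition near_model u v x := has (fun p =>
    propto (gram25 p.1 p.2) (mulm (mulm (trm [:: u; v; x]) (gram25 0 2)) [:: u; v; x]))
  [seq (i, j) | i <- iota 0 2, j <- iota 2 5].

(** An exhaustive check over the orthonormal frames of F_5^3: the orthogonal group carries the conic
    of {0, 2} only to conics of pairs with exactly one element in {0, 1}. This is what closes the
    family under adjacency. *)
Lemma frame_neighbours u v x : u \in units5 -> v \in orth5 u -> x \in orth5 u ->
  dot25 v x = (0, 0)%N -> near_model u v x.
Proof.
have : all (fun u => let ou := orth5 u in
    all (fun v => all (fun x => (dot25 v x == (0, 0)%N) ==> near_model u v x) ou) ou) units5.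
  by vm_compute.
by move=> /allP h /h /allP{}h /h /allP{}h /h /implyP{}h /eqP/h.
Qed.

(** * Unitary lifts of A_7 and the stabilizers of the 21 conics *)

Section Model.
Variable k : closedFieldType.
Hypothesis hk : 5%N \in [pchar k].
Variable w : k.
Hypothesis hw : w ^+ 2 + w + 1 = 0.
Local Notation "A ^f" := (map_mx (pFrobenius_aut hk) A).
Local Notation Dw := (dg 1 w (w ^+ 2)).

Definition ev (x : f25) : k := x.1%:R + x.2%:R * w.
Definition evm (A : mx25) : 'M[k]_3 := \matrix_(i, j) ev (ent A i j).

Lemma evD x y : ev (add25 x y) = ev x + ev y.
Proof. by rewrite /ev /= !(natmod5 hk) !natrD; ring. Qed.

Lemma evM x y : ev (mul25 x y) = ev x * ev y.
Proof.
rewrite /ev /= !(natmod5 hk) !natrD !natrM; apply/eqP; rewrite -subr_eq0; apply/eqP.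
have n5 := n5 hk; set a := x.1%:R; set b := x.2%:R; set c := y.1%:R; set d := y.2%:R.
transitivity (5%:R * b * d * (1 + w) - b * d * (w ^+ 2 + w + 1)); first ring.
by rewrite hw n5 !mul0r mulr0 subrr.
Qed.

Lemma evF x : ev (frob25 x) = ev x ^+ 5.
Proof.
rewrite -(pFrobenius_autE hk) /ev /= rmorphD rmorphM /= !rmorph_nat pFrobenius_autE.
rewrite !(natmod5 hk) !natrD ?natrM; have -> : w ^+ 5 = w ^+ 2 by rewrite (exprD _ 3 2) (w3 hw) mul1r.
have n5 := n5 hk; set a := x.1%:R; set b := x.2%:R; apply/eqP; rewrite -subr_eq0; apply/eqP.
transitivity (5%:R * b * (1 + w) - b * (w ^+ 2 + w + 1)); first ring.
by rewrite hw n5 !mul0r mulr0 subrr.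
Qed.

Lemma ev_unit x : x \in units25 -> ev x != 0.
Proof.
have : all (fun x => has (fun y => mul25 x y == (1, 0)%N) units25) units25 by vm_compute.
move=> /allP h /h /hasP[y _ /eqP e]; apply/eqP => z.
have /eqP := evM x y; rewrite e z mul0r /ev /= mul0r addr0 oner_eq0 //.
Qed.

Lemma ev_eq0 x : x \in red25 -> ev x = 0 -> x = (0, 0)%N.
Proof.
rewrite -[red25]/((0, 0)%N :: units25) in_cons => /predU1P[//|/ev_unit/eqP //].
Qed.

Lemma red25_mod a b : (a %% 5, b %% 5)%N \in red25.
Proof. by apply/allpairsP; exists (a %% 5, b %% 5)%N; rewrite !mem_iota !ltn_mod. Qed.

Lemma ev_inj x y : x \in red25 -> y \in red25 -> ev x = ev y -> x = y.
Proof.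
have : all (fun x => all (fun y => (add25 x (mul25 (4, 0)%N y) == (0, 0)%N) ==> (x == y)) red25) red25.
  by vm_compute.
move=> /allP h xr yr e; have /allP/(_ y yr)/implyP := h x xr; move=> /(_ _)/eqP; apply.
apply/eqP/ev_eq0; first exact: red25_mod.
have n5 := n5 hk; rewrite evD evM e -[LHS]/(ev y + (4%:R + 0 * w) * ev y).
by transitivity (5%:R * ev y); [ring|rewrite n5 mul0r].
Qed.

Lemma ent_tab f (i j : 'I_3) : ent (tab25 f) i j = f i j.
Proof. by elim/I3P: i; elim/I3P: j. Qed.

Lemma evm_mul A B : evm (mulm A B) = evm A *m evm B.
Proof. by apply/matrixP => i j; rewrite !mxE sum3 !mxE ent_tab !evD !evM. Qed.

Lemma evm_tr A : evm (trm A) = (evm A)^T.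
Proof. by apply/matrixP => i j; rewrite !mxE ent_tab. Qed.

Lemma evm_fr A : evm (frm A) = (evm A)^f.
Proof. by apply/matrixP => i j; rewrite !mxE ent_tab evF pFrobenius_autE. Qed.

Lemma evm_one : evm onem = 1%:M.
Proof. by apply/matrixP; elim/I3P; elim/I3P; rewrite !mxE /ev /=; ring. Qed.

Lemma evm_propto A B : propto A B -> exists2 c, c != 0 & evm B = c *: evm A.
Proof.
move=> /hasP[c cu /allP h]; exists (ev c); first exact: ev_unit.
apply/matrixP => i j; rewrite !mxE -evM; congr ev; apply/eqP/(h (_, _)).
by apply/allpairsP; exists (val i, val j); rewrite !mem_iota /= !ltn_ord.
Qed.

Lemma evm_indep A B : indep A B -> forall c d : k, c *: evm A = d *: evm B -> c = 0 /\ d = 0.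
Proof.
move=> /hasP[p p3 /hasP[q q3 ne]] c d E.
have ix (r : nat * nat) : r \in ix3 -> exists i j : 'I_3, (r.1 = i) /\ (r.2 = j).
  move=> /allpairsP[[i j] /=]; rewrite !(mem_iota 0 3) /= => -[i3 j3 ->].
  by exists (Ordinal i3), (Ordinal j3).
have [a [b [p1 p2]]] := ix p p3; have [e [f [q1 q2]]] := ix q q3.
rewrite p1 p2 q1 q2 in ne.
have ne' : ev (ent A a b) * ev (ent B e f) - ev (ent A e f) * ev (ent B a b) != 0.
  rewrite subr_eq0 -!evM; apply: contra ne => /eqP/ev_inj -> //; exact: red25_mod.
have /matrixP E' := E; have := E' a b; have := E' e f; rewrite !mxE => Ef Eb.
have c0 : c = 0.
  apply: (mulIf ne'); rewrite mul0r mulrBr !mulrA Eb Ef; ring.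
split=> //; apply: (mulIf ne'); rewrite mul0r mulrBr.
transitivity (ev (ent A a b) * (d * ev (ent B e f)) - ev (ent A e f) * (d * ev (ent B a b))); first ring.
by rewrite -Eb -Ef c0; ring.
Qed.

Definition gram (i j : nat) : 'M[k]_3 := evm (gram25 i j).

Lemma gram01 : gram 0 1 = 1%:M.
Proof. exact: evm_one. Qed.

Lemma gram02 : gram 0 2 = Dw.
Proof.
have w2 : w ^+ 2 = 4%:R + 4%:R * w.
  have n5 := n5 hk; apply/eqP; rewrite -subr_eq0; apply/eqP.
  transitivity (w ^+ 2 + w + 1 - 5%:R * (1 + w)); first ring.
  by rewrite hw n5 mul0r subrr.
by rewrite w2; apply/matrixP; elim/I3P; elim/I3P; rewrite !mxE /ev /=; ring.
Qed.

(* The class of [A] maps the conic of the pair {s i, s j} to that of {i, j}, the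
   direction that makes lifting multiplicative for [(s * t) i = t (s i)]. *)
Definition lifts (A : 'M[k]_3) (s : 'I_7 -> 'I_7) := unitary hk A /\
  forall i j : 'I_7, i != j -> exists2 c, c != 0 & A^f *m gram (s i) (s j) *m A^f^T = c *: gram i j.

Lemma perm_liftP A s (t : {perm 'I_7}) : perm_lift A s -> (forall i, t i = nth 0%N s i :> nat) ->
  lifts (evm A) t.
Proof.
move=> /andP[/eqP uA /allP h] ts; split; first by rewrite /unitary -evm_fr -evm_tr -evm_mul uA evm_one.
move=> i j ij; rewrite !ts; have i7 (l : 'I_7) : val l \in iota 0 7 by rewrite mem_iota /=.
have /allP/(_ _ (i7 j)) := h _ (i7 i); rewrite (_ : (val i == val j) = false) /=; last exact/negbTE.
by move=> /evm_propto; rewrite /cj25 !evm_mul evm_tr evm_fr.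
Qed.

Lemma lifts1 : lifts 1%:M (1 : {perm 'I_7})%g.
Proof.
split; first exact: unitary1.
by move=> i j _; exists 1; rewrite ?oner_neq0 // !perm1 mxF1 trmx1 mul1mx mulmx1 scale1r.
Qed.

Lemma liftsM A B (s t : {perm 'I_7}) : lifts A s -> lifts B t -> lifts (A *m B) (s * t)%g.
Proof.
move=> [uA hA] [uB hB]; split; first exact: unitaryM.
move=> i j ij; have sij : s i != s j by rewrite (inj_eq perm_inj).
have [c c0 cE] := hA i j ij; have [d d0 dE] := hB _ _ sij.
exists (d * c); first exact: mulf_neq0.
rewrite !permM mxFM trmx_mul -scalerA -cE -!mulmxA (mulmxA B^f) (mulmxA (B^f *m _)) dE.
by rewrite -scalemxAl -scalemxAr !mulmxA.
Qed.

Lemma lifts_ex s : s \in ('Alt_('I_7))%g -> exists A, lifts A s.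
Proof.
pose P (s : {perm 'I_7}) := exists A, lifts A s.
apply: (@Alt_star_ind _ ord0 (inord 1) P).
- by rewrite -val_eqE /= inordK.
- by exists 1%:M; apply: lifts1.
- by move=> t u [A hA] [B hB]; exists (A *m B); apply: liftsM.
move=> a a0 a1; exists (evm (nth [::] lift_table (a - 2))).
have a2 : (a - 2 < 5)%N by have := ltn_ord a; case: (val a) => [|[|n]] //=; rewrite subn2.
have a2' : (1 < a)%N.
  move: a0 a1; rewrite -!val_eqE /= inordK //; by case: (val a) => [|[|]].
apply: (perm_liftP (s := star_seq a)).
  by have /allP := star_lifts; apply; rewrite mem_iota a2' /= ltn_ord.
move=> i; have i7 : (i < 7)%N := ltn_ord i.
rewrite /star_seq (nth_map 0%N) ?size_iota // nth_iota // add0n permM.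
rewrite -[i == 0%N :> nat]/(i == ord0) -[_ == a :> nat]/(i == a).
have -> : (i == 1%N :> nat) = (i == inord 1) by rewrite -val_eqE /= inordK.
case: (tpermP ord0 a i) => [->|->|/eqP i0 /eqP ia].
- by rewrite tpermD // eq_sym.
- by rewrite (negPf a0) eqxx tpermL inordK.
- rewrite (negPf i0) (negPf ia); case: eqP => [->|/eqP i1]; first by rewrite tpermR.
  by rewrite tpermD // eq_sym.
Qed.

Lemma liftsV A (s : {perm 'I_7}) : lifts A s -> lifts (invmx A) (s^-1)%g.
Proof.
move=> [uA hA]; split; first exact: unitaryV.
have uA' := unitary_unitmx uA; have uAf : A^f \in unitmx by rewrite map_unitmx.
move=> i j ij; have sij : (s^-1)%g i != (s^-1)%g j by rewrite (inj_eq perm_inj).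
have [c c0] := hA _ _ sij; rewrite !permKV => cE; exists c^-1; first by rewrite invr_eq0.
rewrite map_invmx trmx_inv; apply: (scalerI c0); rewrite scalerA divff // scale1r.
by rewrite scalemxAl scalemxAr -cE !mulmxA mulVmx // mul1mx mulmxK ?unitmx_tr.
Qed.

Local Notation o n := (@Ordinal 7 n isT).

(** Since [gram 0 1] is the identity, [A^f] is orthogonal up to a scalar, so fixing a conic of the
    family means commuting with its Gram matrix up to a scalar. Three signed permutation matrices
    among them already force [A^f] to be scalar. *)
Lemma lifts_scalar A : lifts A (1 : {perm 'I_7})%g -> exists2 c, c != 0 & A = c%:M.
Proof.
move=> [uA hA]; have uA' := unitary_unitmx uA; have uAf : A^f \in unitmx by rewrite map_unitmx.
have [e e0] := hA (o 0) (o 1) isT; rewrite !perm1 gram01 mulmx1 => eE.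
have eE' : A^f^T *m A^f = e%:M.
  have : (e^-1 *: A^f^T) *m A^f = 1%:M.
    by apply: mulmx1C; rewrite -scalemxAr eE scalerA mulVf ?scale1r.
  move/(congr1 (fun X => e *: X)); rewrite -scalemxAl scalerA divff // scale1r scalemx1 //.
(* Conjugation preserves the trace, so a nonzero trace forces the multiplier of this Gram matrix to
   equal that of [gram 0 1]. *)
have com (i j : 'I_7) : i != j -> \tr (gram i j) != 0 -> A^f *m gram i j = gram i j *m A^f.
  move=> ij tr0; have [c c0] := hA i j ij; rewrite !perm1 => cE.
  have E : A^f *m gram i j = (c / e) *: (gram i j *m A^f).
    apply: (scalerI e0); rewrite scalerA mulrCA divff // mulr1 [in RHS]scalemxAl -cE -(mulmxA _ A^f^T) eE'.
    by rewrite mul_mx_scalar.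
  suff d1 : c / e = 1 by rewrite E d1 scale1r.
  apply: (mulIf tr0); rewrite mul1r -mxtraceZ.
  have := congr1 (fun X => \tr (invmx A^f *m X)) E; rewrite mulKmx // => ->.
  by rewrite -scalemxAr !mxtraceZ [\tr (invmx _ *m _)]mxtrace_mulC mulmxK.
have n5 := n5 hk; have two0 := two0 hk.
have C35 := com (o 3) (o 5) isT; have C46 := com (o 4) (o 6) isT; have C45 := com (o 4) (o 5) isT.
have four : (4%:R : k) = -1 by apply/eqP; rewrite -subr_eq0 opprK -(natrD _ 4 1) n5.
have {}C35 := C35 _; have {}C46 := C46 _; have {}C45 := C45 _.
have tr35 : \tr (gram 3 5) != 0.
  by rewrite /mxtrace sum3 !mxE /ev /= !mul0r !addr0 add0r oner_neq0.
have tr45 : \tr (gram 4 5) != 0.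
  by rewrite /mxtrace sum3 !mxE /ev /= !mul0r !addr0 oner_neq0.
have tr46 : \tr (gram 4 6) != 0.
  by rewrite /mxtrace sum3 !mxE /ev /= !mul0r !addr0 add0r natr_neq0.
have /matrixP E35 := C35 tr35; have /matrixP E46 := C46 tr46; have /matrixP E45 := C45 tr45.
move: E35 E46 E45; have [U UA] : exists U, U = A^f by exists A^f.
rewrite -UA => E35 E46 E45.
have half (x y : k) : x = y -> - x = y -> x = 0.
  move=> <- e'; apply: (mulfI two0); rewrite mulr0 -[RHS](subrr x) e'; ring.
have u02 : U i0 i2 = 0.
  have := E35 i0 i2; have := E46 i0 i2; rewrite !mxE !sum3 !mxE /ev /= four.
  rewrite !(mul0r, mulr0, addr0, add0r, mulr1, mul1r, mulrN1) => e1 e2.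
  exact: half e2 e1.
have u20 : U i2 i0 = 0.
  have := E35 i2 i0; have := E46 i2 i0; rewrite !mxE !sum3 !mxE /ev /= four.
  rewrite !(mul0r, mulr0, addr0, add0r, mulr1, mul1r, mulN1r) => e1 e2.
  by apply: half (esym e2) (esym e1).
have ee := (mul0r, mulr0, addr0, add0r, mulr1, mul1r).
have u12 : U i1 i2 = 0 by have := E35 i0 i2; rewrite !mxE !sum3 !mxE /ev /= !ee u02.
have u21 : U i2 i1 = 0 by have := E35 i2 i0; rewrite !mxE !sum3 !mxE /ev /= !ee u20.
have u01 : U i0 i1 = 0 by have := E45 i0 i1; rewrite !mxE !sum3 !mxE /ev /= !ee u02 => <-.
have u10 : U i1 i0 = 0 by have := E45 i1 i0; rewrite !mxE !sum3 !mxE /ev /= !ee u20.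
have u11 : U i1 i1 = U i0 i0 by have := E35 i1 i0; rewrite !mxE !sum3 !mxE /ev /= !ee.
have u22 : U i2 i2 = U i1 i1 by have := E45 i2 i1; rewrite !mxE !sum3 !mxE /ev /= !ee.
have UE : U = (U i0 i0)%:M.
  by rewrite {1}(mx3E U) u01 u02 u10 u12 u20 u21 u22 u11; apply/matrixP; elim/I3P; elim/I3P; rewrite !mxE.
have AE : A = (U i0 i0 ^+ 5)%:M.
  by rewrite -(unitary_FF uA) -UA {1}UE map_scalar_mx /= pFrobenius_autE.
exists (U i0 i0 ^+ 5); last exact: AE.
by apply: contraTneq uA' => z; rewrite AE z unitmxE det_scalar expr0n unitr0.
Qed.

Lemma lifts_uniq A B (s : {perm 'I_7}) : lifts A s -> lifts B s -> cl A = cl B.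
Proof.
move=> hA hB; have uA := unitary_unitmx (proj1 hA); have uB := unitary_unitmx (proj1 hB).
have := liftsM (liftsV hB) hA; rewrite mulVg => /lifts_scalar[c c0 E].
by apply/(cl_eq uA uB); exists c => //; rewrite -mul_mx_scalar -E mulKVmx.
Qed.

Lemma gramC (i j : 'I_7) : i != j -> gram i j = gram j i.
Proof. by rewrite /gram /gram25 -val_eqE /=; case: ltngtP. Qed.

Lemma gram_prop (i j p q : 'I_7) (c d : k) : i != j -> p != q -> c != 0 ->
  c *: gram i j = d *: gram p q -> (i == p) && (j == q) || (i == q) && (j == p).
Proof.
have wlogC (i' j' : 'I_7) : i' != j' -> (i' < j')%N || (j' < i')%N by rewrite -val_eqE neq_ltn.
have main (a b e f : 'I_7) (x y : k) : (a < b)%N -> (e < f)%N -> x != 0 ->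
    x *: gram a b = y *: gram e f -> (a == e) && (b == f).
  move=> ab ef x0 E; have i7 (l m : 'I_7) : (val l, val m) \in pairs7.
    by apply/allpairsP; exists (val l, val m); rewrite !(mem_iota 0 7) !ltn_ord.
  have /allP/(_ _ (i7 a b))/allP/(_ _ (i7 e f)) := gram_indep.
  rewrite /= leqNgt ab leqNgt ef /= => /orP[/eqP[ae bf]|/evm_indep h].
    by rewrite -!val_eqE /= ae bf !eqxx.
  by have [/eqP] := h _ _ E; rewrite (negPf x0).
move=> ij pq c0; case/orP: (wlogC _ _ ij) => ij'; case/orP: (wlogC _ _ pq) => pq' E.
- by rewrite (main _ _ _ _ _ _ ij' pq' c0 E).
- by move: E; rewrite (gramC pq) => /(main _ _ _ _ _ _ ij' pq' c0) ->; rewrite orbT.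
- by move: E; rewrite (gramC ij) => /(main _ _ _ _ _ _ ij' pq' c0)/andP[-> ->]; rewrite orbT.
- by move: E; rewrite (gramC ij) (gramC pq) => /(main _ _ _ _ _ _ ij' pq' c0)/andP[-> ->].
Qed.

(** Equal classes move the 21 conics alike, so [s] and [t] agree on unordered pairs; two pairs
    through [i] then determine the image of [i]. *)
Lemma lifts_inj A B (s t : {perm 'I_7}) : lifts A s -> lifts B t -> cl A = cl B -> s = t.
Proof.
move=> [uA hA] [uB hB] AB; have uA' := unitary_unitmx uA; have uB' := unitary_unitmx uB.
have uBf : B^f \in unitmx by rewrite map_unitmx.
have [c c0 cE] := (cl_eq uA' uB').1 AB.
have st (i j : 'I_7) : i != j -> (s i == t i) && (s j == t j) || (s i == t j) && (s j == t i).
  move=> ij; have [d d0] := hA i j ij; have [e e0 eE] := hB i j ij.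
  rewrite cE mxFZ [(_ *: _)^T]linearZ /= -!scalemxAl -scalemxAr scalerA => E.
  have /(congr1 (fun X => invmx B^f *m X *m invmx B^f^T)) :
      (e * (c ^+ 5 * c ^+ 5)) *: (B^f *m gram (s i) (s j) *m B^f^T)
      = d *: (e *: gram i j) by rewrite -scalerA E !scalerA mulrC.
  rewrite -eE -!(scalemxAl, scalemxAr) !mulmxA !mulVmx // !mul1mx !mulmxK ?unitmx_tr //.
  by apply: gram_prop; rewrite ?(inj_eq perm_inj) ?mulf_neq0 ?expf_neq0.
apply/permP => i; apply/eqP/negPn/negP => ne.
have [j [l [ij il jl]]] : exists j l : 'I_7, [/\ i != j, i != l & j != l].
  case: i {ne} => [[|[|m]] h]; [exists (o 1), (o 2)|exists (o 0), (o 2)|exists (o 0), (o 1)] => //.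
have := st i j ij; have := st i l il; rewrite (negPf ne) /= => /andP[/eqP -> _] /andP[/eqP/perm_inj lj _].
by rewrite lj eqxx in jl.
Qed.

Lemma lifts_conic A (s : {perm 'I_7}) (i j : 'I_7) : lifts A s -> i != j ->
  im (cl A) (conic (gram (s i) (s j))) = conic (gram i j).
Proof.
move=> [uA hA] ij; have [c c0 cE] := hA i j ij; rewrite im_conic ?unitary_unitmx //.
by rewrite (unitary_inv uA) trmxK cE conicZ.
Qed.

Definition model_group : set (PGL3 k) :=
  [set g | exists s A, [/\ s \in ('Alt_('I_7))%g, lifts A s & g = cl A]].

Lemma model_groupM g h : model_group g -> model_group h -> model_group (g * h)%g.
Proof.
move=> [s [A [sA hA ->]]] [t [B [tA hB ->]]]; exists (s * t)%g, (A *m B).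
split; [exact: groupM|exact: liftsM|].
by rewrite clM // (unitary_unitmx (proj1 hA), unitary_unitmx (proj1 hB)).
Qed.

Lemma model_groupV g : model_group g -> model_group (g^-1)%g.
Proof.
move=> [s [A [sA hA ->]]]; exists (s^-1)%g, (invmx A).
split; [by rewrite groupV|exact: liftsV|].
by rewrite clV // (unitary_unitmx (proj1 hA)).
Qed.

Lemma model_group1 : model_group 1%g.
Proof. by exists 1%g, 1%:M; split; [exact: group1|exact: lifts1|rewrite cl1]. Qed.

Lemma F5_nat (x : k) : x ^+ 5 = x -> exists2 n, (n < 5)%N & x = n%:R.
Proof.
(* The product of the x - n for n in F_5 equals x^5 - x up to a multiple of 5. *)
move=> x5; have n5 := n5 hk; have /eqP : x * (x - 1) * (x - 2%:R) * (x - 3%:R) * (x - 4%:R) = 0.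
  transitivity ((x ^+ 5 - x) + 5%:R * (- 2%:R * x ^+ 4 + 7%:R * x ^+ 3 - 10%:R * x ^+ 2 + 5%:R * x)); first ring.
  by rewrite x5 n5 mul0r subrr addr0.
rewrite !mulf_eq0 !subr_eq0 => /orP[/orP[/orP[/orP[]|]|]|] /eqP ->;
 [by exists 0%N|by exists 1%N|by exists 2%N|by exists 3%N|by exists 4%N].
Qed.

Lemma real_orth_frame A : real_orth hk A ->
  exists i j : 'I_7, exists2 c, c != 0 & [/\ (i < 2)%N, (2 <= j)%N & A *m Dw *m A^T = c *: gram i j].
Proof.
move=> [AA Af]; have ent5 i j : {n : nat | (n < 5)%N & A i j = n%:R}.
  apply/cid2/F5_nat; move/matrixP/(_ i j): Af; by rewrite mxE pFrobenius_autE.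
pose n i j := s2val (ent5 i j); have n5 i j : (n i j < 5)%N by rewrite /n; case: (ent5 i j).
have nE i j : A i j = ev (n i j, 0)%N.
  by rewrite /ev /= mul0r addr0 /n; case: (ent5 i j).
pose r j : seq f25 := [:: (n i0 j, 0); (n i1 j, 0); (n i2 j, 0)]%N.
have rvec j : r j \in vecs5.
  apply/allpairsP; exists (n i0 j, ((n i1 j, 0), (n i2 j, 0)))%N; split; [by rewrite (mem_iota 0 5) /= n5| |by []].
  by apply/allpairsP; exists (n i1 j, n i2 j); rewrite !(mem_iota 0 5) /= !n5.
have rdot j l : ev (dot25 (r j) (r l)) = (1%:M : 'M[k]_3) j l.
  by rewrite -AA !mxE sum3 !mxE /dot25 !evD !evM /= !nE.
have dred u v : dot25 u v \in red25 by exact: red25_mod.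
have d1 j : dot25 (r j) (r j) = (1, 0)%N.
  apply: ev_inj => //; rewrite rdot mxE eqxx /ev /= mul0r addr0 //.
have d0 j l : j != l -> dot25 (r j) (r l) = (0, 0)%N.
  by move=> jl; apply: ev_inj => //; rewrite rdot mxE (negPf jl) /ev /= mul0r addr0.
have ru j : r j \in units5 by rewrite mem_filter d1 eqxx rvec.
have ro j l : j != l -> r l \in orth5 (r j) by move=> jl; rewrite mem_filter d0 // eqxx ru.
have := frame_neighbours (ru i0) (ro i0 i1 isT) (ro i0 i2 isT) (d0 i1 i2 isT).
move=> /hasP[[a b]].
have AT : evm [:: r i0; r i1; r i2] = A^T.
  by apply/matrixP; elim/I3P; elim/I3P; rewrite !mxE -nE.
move=> /allpairsP[[a' b'] [a2 b2 [-> ->]]] /evm_propto.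
rewrite !evm_mul evm_tr AT trmxK -/(gram 0 2) gram02 => -[c c0 cE].
rewrite (mem_iota 0 2) /= in a2; rewrite (mem_iota 2 5) /= in b2; case/andP: b2 => b2 b7.
have a7 : (a' < 7)%N by apply: leq_trans a2 _.
by exists (Ordinal a7), (Ordinal b7), c.
Qed.

Lemma stabM (Q : set (P2 k)) g h : stab Q g -> stab Q h -> stab Q (g * h)%g.
Proof.
move=> [gG gQ] [hG hQ]; split; rewrite /aut_Gamma /= -/(im _ _) imM.
  by rewrite (hG : im h _ = _).
by rewrite (hQ : im h _ = _).
Qed.

Lemma stabV (Q : set (P2 k)) g : stab Q g -> stab Q (g^-1)%g.
Proof.
move=> [gG gQ]; split; rewrite /aut_Gamma /= -/(im _ _).
  by rewrite -[in LHS](gG : im g _ = _) imK.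
by rewrite -[in LHS](gQ : im g _ = _) imK.
Qed.

Lemma stab1 (Q : set (P2 k)) : stab Q 1%g.
Proof. by split; rewrite /aut_Gamma /= -/(im _ _) im1. Qed.

Lemma four_N1 : (4%:R : k) = -1.
Proof. by apply/eqP; rewrite -subr_eq0 opprK -(natrD _ 4 1) (n5 hk). Qed.

Ltac perm7 := move=> [[|[|[|[|[|[|[|//]]]]]]] ?]; rewrite permM !permE.

Lemma tetra_model : [/\ model_group (cl (dg 1 (-1) (-1))), model_group (cl (dg (-1) 1 (-1)))
  & model_group (cl (cyc k))].
Proof.
have f := four_N1; split.
- exists (klein1 (o 3) (o 6) (o 4) (o 5)); eexists; split; first exact: klein1_Alt.
    by apply: (perm_liftP klein1_lift); perm7.
  by congr cl; apply/matrixP; elim/I3P; elim/I3P; rewrite !mxE /ev /= ?f; ring.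
- exists (klein1 (o 3) (o 4) (o 5) (o 6)); eexists; split; first exact: klein1_Alt.
    by apply: (perm_liftP klein2_lift); perm7.
  by congr cl; apply/matrixP; elim/I3P; elim/I3P; rewrite !mxE /ev /= ?f; ring.
exists (tri3 (o 3) (o 5) (o 4)); eexists; split; first exact: (@tri3_Alt _ (o 6)).
  by apply: (perm_liftP cyc_lift); perm7.
by congr cl; apply/matrixP; elim/I3P; elim/I3P; rewrite !mxE /ev /=; ring.
Qed.

Lemma Alt7_map (u v : seq 'I_7) : size u = size v -> (size u <= 5)%N -> uniq u -> uniq v ->
  exists2 s : {perm 'I_7}, s \in ('Alt_('I_7))%g & [seq s i | i <- u] = v.
Proof.
move=> uv u5 Uu Uv; have uv' : size v == size u by rewrite uv.
have [|s sA sE] := @Alt_mapP _ _ (in_tuple u) (Tuple uv') Uu Uv; first by rewrite card_ord.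
by exists s.
Qed.

Hypothesis ttw : totally_tangent_conic (conic Dw).

(** By the exhaustive check [A] moves the conic of {0, 2} to that of a pair {i, j} with [i] in {0,
    1}. A lift [B] of an even permutation does the same while fixing the conic of {0, 1}. So B^-1 A
    lies in the tetrahedral intersection, which is in the model group by [tetra_model]. *)
Lemma frame_model A : real_orth hk A -> model_group (cl A).
Proof.
move=> RA; have [i [j [c c0 [i2 j2 cE]]]] := real_orth_frame RA.
have uA := real_orth_unitary RA; have uA' := unitary_unitmx uA.
have AQ : im (cl A) (conic Dw) = conic (gram i j).
  by rewrite im_conic // (unitary_inv uA) trmxK; case: RA => _ ->; rewrite cE conicZ.
(* The other element of {0, 1}; the permutation takes {i, i'} back to {0, 1}, so that [B] fixes the
   standard conic. *)
pose i' : 'I_7 := if val i == 0%N then o 1 else o 0.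
have ii' : i != i' by rewrite -val_eqE /i' /=; case: (val i) i2 => [|[|]].
have ji : i != j by rewrite -val_eqE /=; apply: contraTneq j2 => <-; rewrite -ltnNge.
have ji' : i' != j by rewrite -val_eqE /i' (fun_if val) /=; case: (val j) j2 => [|[|]] // n _; case: ifP.
have [||||s sA [si si' sj]] := @Alt7_map [:: i; i'; j] [:: o 0; o 1; o 2] => //.
  by rewrite /= !inE negb_or ii' ji ji'.
have [B hB] := lifts_ex sA; have [uB _] := hB; have uB' := unitary_unitmx uB.
have BQw : im (cl B) (conic Dw) = conic (gram i j).
  by rewrite -gram02 -(lifts_conic hB ji) si sj.
have BQ1 : im (cl B) (conic 1%:M) = conic 1%:M.
  have E := lifts_conic hB ii'; rewrite si si' gram01 in E; rewrite E -gram01.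
  have [iE|iE] : i = o 0 \/ i = o 1.
    by case: (i) i2 => [[|[|m]] h] // _; [left|right]; apply: val_inj.
  - by rewrite /i' iE.
  by rewrite /i' iE gramC.
have stB : stab (conic 1%:M) (cl B) by split=> //; apply: unitary_aut.
have stA : stab (conic 1%:M) (cl A) by apply/(stab1P hk); exists A.
have mB : model_group (cl B) by exists s, B.
rewrite -[cl A](mulKVg (cl B)); apply: model_groupM => //.
have [D1 D2 D3] := tetra_model.
apply: (stab_cap_sub hk hw ttw model_groupM model_group1 D1 D2 D3).
have stBA := stabM (stabV stB) stA; split=> //; split; first by case: stBA.
by rewrite /= -/(im _ _) imM AQ -BQw imK.
Qed.

Lemma gram_lift (i j : 'I_7) : i != j -> exists s B, [/\ s \in ('Alt_('I_7))%g,
  lifts B s, s i = o 0, s j = o 1 & im (cl B) (conic 1%:M) = conic (gram i j)].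
Proof.
move=> ij; have [||||s sA [si sj]] := @Alt7_map [:: i; j] [:: o 0; o 1] => //.
  by rewrite /= inE ij.
have [B hB] := lifts_ex sA; exists s, B; split=> //.
by rewrite -(lifts_conic hB ij) si sj gram01.
Qed.

Lemma conic_gram_inj (a b p q : 'I_7) : a != b -> p != q ->
  conic (gram a b) = conic (gram p q) -> (a == p) && (b == q) || (a == q) && (b == p).
Proof.
move=> ab pq E; have form_of (x y : 'I_7) : x != y -> (gram x y)^T = gram x y /\ gram x y \in unitmx.
  move=> xy; have [s [B [_ [uB hB] sx sy _]]] := gram_lift xy.
  have uBf : B^f \in unitmx by rewrite map_unitmx unitary_unitmx.
  have [c c0] := hB x y xy; rewrite sx sy gram01 mulmx1 => cE.
  have -> : gram x y = c^-1 *: (B^f *m B^f^T) by rewrite cE scalerA mulVf ?scale1r.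
  by rewrite [(_ *: _)^T]linearZ /= trmx_mul trmxK unitmxZ ?unitfE ?invr_eq0 // unitmx_mul unitmx_tr uBf.
have [s [B [_ [uB _] _ _ BQ]]] := gram_lift ab; have uB' := unitary_unitmx uB.
have [Tab Uab] := form_of _ _ ab; have [Tpq Upq] := form_of _ _ pq.
have [c c0 cE] := conic_im1 hk uB' Tab Uab BQ.
have [d d0 dE] := conic_im1 hk uB' Tpq Upq (etrans BQ E).
apply: (@gram_prop _ _ _ _ d c) => //.
have : B^T *m (d *: gram a b) *m B = B^T *m (c *: gram p q) *m B.
  by rewrite -!scalemxAr -!scalemxAl cE dE !scale_scalar_mx mulrC.
move/(congr1 (fun X => invmx B^T *m X *m invmx B)).
by rewrite !mulmxA !mulVmx ?unitmx_tr // !mul1mx !mulmxK.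
Qed.

(** Moved to {0, 1}, the stabilizer is the orthogonal group over F_5, contained in the model group
    by [frame_model]. Distinct pairs give distinct conics, so the underlying permutation preserves
    {i, j}. *)
Lemma stab_gram (i j : 'I_7) g : i != j -> stab (conic (gram i j)) g <->
  exists s A, [/\ s \in stab2 i j, lifts A s & g = cl A].
Proof.
move=> ij; have [t [B [tA hB ti tj BQ]]] := gram_lift ij.
have uB := unitary_unitmx (proj1 hB).
split=> [|[s [A [sij [uA hA] ->]]]].
  move=> st; have mB : model_group (cl B) by exists t, B.
  have mg : model_group g.
    move: st; rewrite -BQ (stab_im _ (proj1 hB)) /= => /(stab1P hk)[C /frame_model mC gC].
    have -> : g = (cl B * cl C * (cl B)^-1)%g by rewrite -gC !mulgA mulgV mul1g mulgK.
    by apply: model_groupM (model_groupV mB); apply: model_groupM.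
  have [s [A [sA hA gA]]] := mg; exists s, A; split=> //; rewrite stab2E // sA /=.
  apply: conic_gram_inj; rewrite ?(inj_eq perm_inj) //.
  apply: (@im_inj _ g); rewrite {1}gA (lifts_conic hA ij); case: st => _.
  by rewrite /= -/(im _ _) => ->.
have sA : s \in ('Alt_('I_7))%g by move: sij; rewrite stab2E // => /andP[].
split; first exact: unitary_aut.
rewrite /= -/(im _ _) -{2}(lifts_conic (conj uA hA) ij); congr im.
move: sij; rewrite stab2E // => /andP[_ /orP[]/andP[/eqP -> /eqP ->]] //.
by rewrite gramC.
Qed.

(** The normalizing matrix of the pair and a lift [B] both carry the standard conic to that of {i,
    j}, so they differ by an element of its stabilizer. The normalizing class is therefore in the
    model group and keeps the conic of {0, 2} in the family. *)
Lemma gram_neighbour (i j : 'I_7) Q : i != j -> NF hk w (conic (gram i j)) Q ->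
  exists a b : 'I_7, a != b /\ Q = conic (gram a b).
Proof.
move=> ij [A [uA QA ->]]; have [t [B [tA hB ti tj BQ]]] := gram_lift ij.
have uA' := unitary_unitmx uA; have mB : model_group (cl B) by exists t, B.
have uB' := unitary_unitmx (proj1 hB).
have : stab (conic 1%:M) ((cl B)^-1 * cl A)%g.
  rewrite -clV // -clM ?unitmx_inv //; split.
    by apply: unitary_aut; apply: unitaryM => //; apply: unitaryV; case: hB.
  by rewrite /= -/(im _ _) clM ?unitmx_inv // clV // imM -QA -BQ imK.
move=> /(stab1P hk)[C /frame_model mC BC].
have [s [D [sA hD AD]]] : model_group (cl A).
  by rewrite -[cl A](mulKVg (cl B)) BC; apply: model_groupM.
exists ((s^-1)%g (o 0)), ((s^-1)%g (o 2)); rewrite (inj_eq perm_inj); split=> //.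
by rewrite AD -gram02 -(lifts_conic hD) ?permKV // (inj_eq perm_inj).
Qed.

End Model.

(** * Stabilizers generating an alternating group *)

Section Generated.
Variable G : groupType.
Implicit Types (A H : set G).

Lemma is_subgroupP H : is_subgroup H <-> H 1%g /\ forall u v, H u -> H v -> H (u * v^-1)%g.
Proof.
split=> [[/set_mem H1 HV]|[H1 HV]].
  by split=> // u v Hu Hv; apply: set_mem; apply: (HV); apply: mem_set.
by split=> [|u v /set_mem Hu /set_mem Hv]; apply: mem_set => //; apply: HV.
Qed.

Lemma subgroup_generatedP A g : subgroup_generated A g <->
  forall H, is_subgroup H -> A `<=` H -> H g.
Proof. by split=> [Ag H gH AH|h H [gH AH]]; [apply: Ag|apply: h]. Qed.

Lemma sub_generated A : A `<=` subgroup_generated A.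
Proof. by move=> g Ag; apply/subgroup_generatedP => H _; apply. Qed.

End Generated.

Section Components.
Variable k : closedFieldType.
Hypothesis hk : 5%N \in [pchar k].
Variable w : k.
Hypothesis hw : w ^+ 2 + w + 1 = 0.
Local Notation "A ^f" := (map_mx (pFrobenius_aut hk) A).
Local Notation Dw := (dg 1 w (w ^+ 2)).
Local Notation o n := (@Ordinal 7 n isT).
Implicit Types (Q X Y : set (P2 k)).
Hypothesis tt1 : totally_tangent_conic (conic 1%:M : set (P2 k)).

Lemma tt_gram (i j : 'I_7) : i != j -> totally_tangent_conic (conic (gram w i j)).
Proof. by move=> /(gram_lift hk hw)[s [B [_ [uB _] _ _ <-]]]; apply: (tt_im uB). Qed.

Lemma tt_Dw : totally_tangent_conic (conic Dw).
Proof. by rewrite -(gram02 hk hw); apply: (@tt_gram (o 0) (o 2)). Qed.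

Lemma NF_im A X Y : unitary hk A -> NF hk w X Y -> NF hk w (im (cl A) X) (im (cl A) Y).
Proof.
move=> uA [B [uB -> ->]]; exists (A *m B).
by rewrite clM ?unitary_unitmx ?imM //; split=> //; apply: unitaryM.
Qed.

Lemma adjacent_NF X Y : adjacent X Y -> NF hk w X Y.
Proof. by case=> ttX ttY XY XY4 XY3; apply: adj_NF. Qed.

Lemma adjacent_sym X Y : adjacent X Y -> adjacent Y X.
Proof. by case=> ttX ttY XY XY4 XY3; split; rewrite 1?setIC //; apply/nesym. Qed.

(** Membership in the translated family passes along adjacency in both directions, hence along the
    equivalence relation it generates. *)
Lemma component_gram U X : unitary hk U -> same_component (im (cl U) (conic 1%:M)) X ->
  exists i j : 'I_7, i != j /\ X = im (cl U) (conic (gram w i j)).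
Proof.
move=> uU; pose P X := exists i j : 'I_7, i != j /\ X = im (cl U) (conic (gram w i j)).
have uV := unitaryV uU; have uU' := unitary_unitmx uU.
have step Y Z : adjacent Y Z -> P Y -> P Z.
  move=> /adjacent_NF/(NF_im uV) YZ [i [j [ij YE]]]; move: YZ.
  rewrite YE clV // imK => /(gram_neighbour hw tt_Dw ij)[a [b [ab ZE]]].
  by exists a, b; rewrite -ZE imKV.
have iffP Y Z : clos_refl_sym_trans (set (P2 k)) (@adjacent k) Y Z -> P Y <-> P Z.
  elim=> [x y xy|x|x y _ [? ?]|x y z _ [? ?] _ [? ?]]; split=> //; try by auto.
  - exact: step.
  - by apply: step; apply: adjacent_sym.
move=> /iffP[+ _]; apply; exists (o 0), (o 1); split=> //.
by rewrite (gram01 w).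
Qed.

(** Lifts are chosen arbitrarily; their classes multiply correctly because a lift is unique up to a
    scalar. *)
Lemma model_iso : isomorphic_to ('Alt_('I_7))%G (model_group hk w).
Proof.
have [A hA] : {A : {perm 'I_7} -> 'M[k]_3 & forall s, s \in ('Alt_('I_7))%g -> lifts hk w (A s) s}.
  apply: (@choice _ _ (fun s B => s \in ('Alt_('I_7))%g -> lifts hk w B s)) => s.
  have [/(lifts_ex hk hw)[B hB]|sA] := boolP (s \in ('Alt_('I_7))%g); first by exists B.
  by exists 1%:M.
have clA s : s \in ('Alt_('I_7))%g -> A s \in unitmx by move=> /hA[/unitary_unitmx].
exists (fun s => cl (A s)); split=> [s t sA tA /=|].
  rewrite -clM ?clA //; have stA : (s * t)%g \in ('Alt_('I_7))%g by apply: groupM.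
  exact: (lifts_uniq (hA _ stA) (liftsM (hA _ sA) (hA _ tA))).
split=> [s sA|s t /set_mem sA /set_mem tA E|_ [s [B [sA hB ->]]]].
- by exists s, (A s); split=> //; apply: hA.
- exact: (lifts_inj hw (hA _ sA) (hA _ tA) E).
- by exists s => //; apply: (lifts_uniq (hA _ sA) hB).
Qed.

Lemma generated_model U (i j : 'I_7) : unitary hk U -> i != j ->
  conic (gram w i j) <> conic 1%:M ->
  subgroup_generated (stab (im (cl U) (conic 1%:M)) `|` stab (im (cl U) (conic (gram w i j))))
  = [set g | model_group hk w ((cl U)^-1 * g * cl U)%g].
Proof.
move=> uU ij Qij; set u := cl U.
have mg g : model_group hk w g -> model_group hk w (g^-1)%g by apply: model_groupV.
have sub_model (a b : 'I_7) : a != b -> stab (conic (gram w a b)) `<=` model_group hk w.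
  move=> ab g /(stab_gram hk hw tt_Dw _ ab)[s [A [sab hA gA]]]; exists s, A; split=> //.
  by move: sab; rewrite stab2E // => /andP[].
apply/seteqP; split=> g.
  move/subgroup_generatedP; apply.
    apply/is_subgroupP; split; first by rewrite /= mulg1 mulVg; apply: model_group1.
    move=> x y /= mx my; have -> : (u^-1 * (x * y^-1) * u = u^-1 * x * u * (u^-1 * y * u)^-1)%g.
      by rewrite !invMg invgK !mulgA mulgK.
    by apply: model_groupM => //; apply: mg.
  rewrite !(stab_im _ uU) => x [|] /=; last exact: sub_model.
  by rewrite -(gram01 w); apply: (sub_model (o 0) (o 1)).
move=> [s [A [sA hA gA]]]; apply/subgroup_generatedP => K /is_subgroupP[K1 KV] stK.
have KM x y : K x -> K y -> K (x * y)%g.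
  by move=> Kx Ky; rewrite -[y]invgK; apply: (KV) => //; rewrite -[(y^-1)%g]mul1g; apply: KV.
(* The permutations whose lifts, conjugated by [u], lie in the subgroup [K]. They form a group
   containing two distinct pair stabilizers, hence all of A_7. *)
pose R := finset (fun t : {perm 'I_7} => (t \in ('Alt_('I_7))%g) &&
  `[< forall B, lifts hk w B t -> K (u * cl B * u^-1)%g >]).
have RP t : t \in R <-> t \in ('Alt_('I_7))%g /\ forall B, lifts hk w B t -> K (u * cl B * u^-1)%g.
  by rewrite finset.in_set; split=> [/andP[tA /asboolP]|[-> ?]]; last exact/asboolP.
have gR : group_set R.
  apply/group_setP; split=> [|t v].
    apply/RP; split=> [|B /(lifts_uniq (lifts1 hk w)) <-]; first exact: group1.
    by rewrite cl1 mulg1 mulgV.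
  move=> /RP[tA Kt] /RP[vA Kv]; apply/RP; split=> [|B hB]; first exact: groupM.
  have [At hAt] := lifts_ex hk hw tA; have [Av hAv] := lifts_ex hk hw vA.
  rewrite -(lifts_uniq (liftsM hAt hAv) hB) clM ?(unitary_unitmx (proj1 hAt)) //; last first.
    exact: unitary_unitmx (proj1 hAv).
  have -> : (u * (cl At * cl Av) * u^-1 = u * cl At * u^-1 * (u * cl Av * u^-1))%g.
    by rewrite !mulgA mulgKV.
  by apply: KM; [apply: Kt|apply: Kv].
have RS (a b : 'I_7) : a != b -> stab (im u (conic (gram w a b))) `<=` K -> stab2 a b \subset R.
  move=> ab stab_K; apply/fintype.subsetP => t tab; apply/RP; split=> [|B hB].
    by move: tab; rewrite stab2E // => /andP[].
  apply: stab_K; rewrite (stab_im _ uU) /= !mulgA mulVg mul1g mulgKV.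
  by apply/(stab_gram hk hw tt_Dw _ ab); exists t, B.
have c7 : #|'I_7| = 7%N by rewrite card_ord.
have AR : ('Alt_('I_7) \subset Group gR)%g.
  apply: (Alt7_gen_stab2 c7 (x := o 0) (y := o 1) _ ij) => //; first last.
  - by apply: RS => // h sh; apply: stK; right.
  - by apply: RS => // h sh; apply: stK; left; rewrite -(gram01 w).
  rewrite set2_eq //; apply/negP => /orP ij'; apply: Qij; case: ij' => /andP[/eqP <- /eqP <-].
    by rewrite (gram01 w).
  by rewrite (gramC w) // (gram01 w).
have /RP[_ /(_ _ hA)] := fintype.subsetP AR _ sA.
by rewrite -gA !mulgA mulgV mul1g mulgK.
Qed.

Lemma alt4_NF X Y : totally_tangent_conic X -> totally_tangent_conic Y -> X <> Y ->
  isomorphic_to ('Alt_('I_4))%G (stab X `&` stab Y) -> NF hk w X Y.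
Proof.
move=> ttX ttY XY [f [fM' [fS fI _]]].
have fM (x y : {perm 'I_4}) : x \in ('Alt_('I_4))%g -> y \in ('Alt_('I_4))%g ->
  f (x * y)%g = (f x * f y)%g :> PGL3 k := fM' x y.
pose p := @Ordinal 4 0 isT; pose q := @Ordinal 4 1 isT.
pose r := @Ordinal 4 2 isT; pose s := @Ordinal 4 3 isT.
have U : uniq [:: p; q; r; s] by [].
have A1 := klein1_Alt U; have A2 := klein2_Alt U; have A3 := tri3_Alt U.
have A33 := groupM A3 A3; have A12 := groupM A1 A2.
have f1 : f 1%g = 1%g.
  by apply: (mulgI (f 1%g)); rewrite -fM ?group1 // !mulg1.
apply: (tetra_NF hk hw ttX ttY XY (g1 := f (klein1 p q r s)) (g2 := f (klein2 p q r s)) (t := f (tri3 q r s))).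
- by move=> g [|[]] ->; apply: fS.
- by rewrite -fM // klein1_sq.
- move=> e; case/eqP: (klein1_neq1 U); apply: fI; rewrite ?f1 //; apply: mem_set; [exact: A1|exact: group1].
- by rewrite -!fM // klein12 // klein21.
- by rewrite -!fM // (@tri3_cube _ p).
- by rewrite -!fM // klein1_tri3.
- by rewrite -!fM // klein2_tri3 // klein12.
Qed.

Section AltSeven.
Variables (K : set (PGL3 k)) (f : {perm 'I_7} -> PGL3 k).
Hypothesis KG : K `<=` aut_Gamma k.
Hypothesis fM : {in ('Alt_('I_7))%G &, {morph f : x y / (x * y)%g}}.
Hypothesis fB : set_bij [set` ('Alt_('I_7))%G] K f.
Let c7 : #|'I_7| = 7%N. Proof. exact: card_ord. Qed.

Lemma iso1 : f 1%g = 1%g.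
Proof. by apply: (mulgI (f 1%g)); rewrite -fM ?group1 // !mulg1. Qed.

Lemma isoV s : s \in ('Alt_('I_7))%g -> f (s^-1)%g = (f s)^-1%g.
Proof.
move=> sA; have vA : (s^-1)%g \in ('Alt_('I_7))%g by rewrite groupV.
by apply: (mulgI (f s)); rewrite -fM // !mulgV iso1.
Qed.

Definition acts_as X (a b : 'I_7) := forall s, s \in stab2 a b -> stab X (f s).

(** By the normal form, the stabilizer of any totally tangent conic is in bijection with a pair
    stabilizer, so its preimage under [f] is a subgroup of order 120 of A_7. The pair it defines
    depends on [f] and need not be the one indexing the conic in the explicit family. *)
Lemma acts_as_stab2 X : totally_tangent_conic X -> stab X `<=` K ->
  exists a b : 'I_7, a != b /\ acts_as X a b.
Proof.
move=> ttX XK; have [U uU XE] := tt_normal hk ttX; set u := cl U.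
have [fK fI fS] := fB.
have stX g : stab X g <-> exists s A, [/\ s \in stab2 (o 0) (o 1), lifts hk w A s & g = (u * cl A * u^-1)%g].
  have G h : stab (conic 1%:M) h <-> exists s A, [/\ s \in stab2 (o 0) (o 1), lifts hk w A s & h = cl A].
    by rewrite -(gram01 w); exact: (stab_gram hk hw tt_Dw h (isT : o 0 != o 1)).
  rewrite XE (stab_im _ uU) /= G.
  split=> -[s [A [sab hA gA]]]; exists s, A; split=> //.
    by rewrite -gA !mulgA mulgV mul1g mulgK.
  by rewrite gA !mulgA mulVg mul1g mulgKV.
pose R := finset (fun t : {perm 'I_7} => (t \in ('Alt_('I_7))%g) && `[< stab X (f t) >]).
have RP t : t \in R <-> t \in ('Alt_('I_7))%g /\ stab X (f t).
  by rewrite finset.in_set; split=> [/andP[tA /asboolP]|[-> ?]]; last exact/asboolP.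
have gR : group_set R.
  apply/group_setP; split=> [|t v].
    by apply/RP; split; [exact: group1|rewrite iso1; apply: stab1].
  move=> /RP[tA Kt] /RP[vA Kv]; apply/RP; split; first exact: groupM.
  by rewrite fM //; apply: stabM.
(* [h] transfers the model stabilizer of {0, 1} into A_7 through [f]; it serves only to count
   [R]. *)
have [h hP] : {h : {perm 'I_7} -> {perm 'I_7} & forall s, s \in stab2 (o 0) (o 1) ->
    h s \in ('Alt_('I_7))%g /\ exists2 A, lifts hk w A s & f (h s) = (u * cl A * u^-1)%g}.
  apply: (@choice _ _ (fun s t => s \in stab2 (o 0) (o 1) -> t \in ('Alt_('I_7))%g /\
     exists2 A, lifts hk w A s & f t = (u * cl A * u^-1)%g)) => s.
  have [sab|nsab] := boolP (s \in stab2 (o 0) (o 1)); last by exists 1%g.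
  have sA : s \in ('Alt_('I_7))%g by move: sab; rewrite stab2E // => /andP[].
  have [A hA] := lifts_ex hk hw sA.
  have [t [tA tE]] : exists t, t \in ('Alt_('I_7))%g /\ f t = (u * cl A * u^-1)%g.
    have [|t tA tE] := fS (u * cl A * u^-1)%g; last by exists t.
    by apply: XK; apply/stX; exists s, A.
  by exists t => _; split=> //; exists A.
have oR : #|R| = 120%N.
  have hI : {in stab2 (o 0) (o 1) &, injective h}.
    move=> s t sab tab E; have [_ [A hA hE]] := hP s sab; have [_ [B hB hE']] := hP t tab.
    apply: (lifts_inj hw hA hB); apply: (mulgI u); apply: (mulIg u^-1%g).
    by rewrite -hE -hE' E.
  rewrite -(card_stab2 c7 (isT : o 0 != o 1)) -[RHS](card_in_imset hI).
  apply: eq_card => t; apply/idP/finset.imsetP => [/RP[tA /stX[s [A [sab hA tE]]]]|[s sab ->]].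
    exists s => //; have [hsA [B hB hE]] := hP s sab.
    apply: fI; rewrite ?mem_set // tE hE; congr (_ * _ * _)%g.
    exact: lifts_uniq hA hB.
  by have [hsA [B hB hE]] := hP s sab; apply/RP; split=> //; apply/stX; exists s, B.
have [|[a b] ab RE] := @Alt7_card120 _ c7 (Group gR) _ oR.
  by apply/fintype.subsetP => t /RP[].
exists a, b; split=> // s; rewrite -RE => sR.
by have /RP[] := (sR : s \in R).
Qed.

Lemma acts_as_adjacent X Y (a b c : 'I_7) : totally_tangent_conic X -> totally_tangent_conic Y ->
  a != b -> a != c -> acts_as X a b -> acts_as Y a c -> same_component X Y.
Proof.
move=> ttX ttY ab ac aX aY; have [->|XY] := pselect (X = Y); first exact: rst_refl.
have [p] := exists_notin c7 (l := [:: a; b; c]) isT; rewrite !inE !negb_or => /and3P[pa pb pc].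
have [q] := exists_notin c7 (l := [:: a; b; c; p]) isT; rewrite !inE !negb_or => /and4P[qa qb qc qp].
have [r] := exists_notin c7 (l := [:: a; b; c; p; q]) isT.
rewrite !inE !negb_or => /and5P[ra rb rc rp rq].
have [s] := exists_notin c7 (l := [:: a; b; c; p; q; r]) isT.
rewrite !inE !negb_or => /and4P[sa sb sc /and3P[sp sq sr]].
have U : uniq [:: p; q; r; s].
  by rewrite /= !inE !negb_or (eq_sym p) qp (eq_sym p) rp (eq_sym p) sp (eq_sym q) rq (eq_sym q) sq (eq_sym r) sr.
have A1 := klein1_Alt U; have A2 := klein2_Alt U; have A3 := tri3_Alt U.
have A33 := groupM A3 A3; have A12 := groupM A1 A2.
have fixes v : v \in ('Alt_('I_7))%g -> v a = a -> v b = b -> v c = c -> (stab X `&` stab Y) (f v).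
  by move=> vA va vb vc; split; [apply: aX|apply: aY]; rewrite stab2E // vA va ?vb ?vc !eqxx.
have T (x : 'I_7) : p != x -> q != x -> r != x -> s != x -> [/\ klein1 p q r s x = x, klein2 p q r s x = x & tri3 q r s x = x].
  by move=> px qx rx sx; rewrite !permM; split; rewrite !tpermD.
have [Ta1 Ta2 Ta3] := T a pa qa ra sa; have [Tb1 Tb2 Tb3] := T b pb qb rb sb.
have [Tc1 Tc2 Tc3] := T c pc qc rc sc.
apply: rst_step; apply: (NF_adj hw ttX ttY).
apply: (tetra_NF hk hw ttX ttY XY (g1 := f (klein1 p q r s)) (g2 := f (klein2 p q r s)) (t := f (tri3 q r s))).
- by move=> g [->|[->|->]]; apply: fixes.
- by rewrite -fM // klein1_sq // iso1.
- have [_ fI _] := fB.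
  move=> e; case/eqP: (klein1_neq1 U); apply: fI; rewrite ?iso1 //; apply: mem_set; [exact: A1|exact: group1].
- by rewrite -!fM // klein12 // klein21.
- by rewrite -!fM // (@tri3_cube _ p) // iso1.
- by rewrite -!fM // klein1_tri3.
- by rewrite -!fM // klein2_tri3 // klein12.
Qed.

Lemma alt7_component X Y : totally_tangent_conic X -> totally_tangent_conic Y ->
  stab X `<=` K -> stab Y `<=` K -> same_component X Y.
Proof.
move=> ttX ttY XK YK; have [a [b [ab aX]]] := acts_as_stab2 ttX XK.
have [c [d [cd cY]]] := acts_as_stab2 ttY YK.
have [ac|ac] := eqVneq a c.
  by apply: (acts_as_adjacent ttX ttY ab _ aX); rewrite ac; [exact: cd|exact: cY].
have Uac : uniq [:: a; c] by rewrite /= inE ac.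
have Uab : uniq [:: a; b] by rewrite /= inE ab.
(* [t] fixes [a] and sends [c] to [b], so conjugation by it takes the stabilizer of {a, b} to that
   of {a, c}. The image of [X] under [f t] then belongs to {a, c}, which meets both {a, b} and {c,
   d}. *)
have [t tA [ta tc]] := @Alt7_map [:: a; c] [:: a; b] erefl isT Uac Uab.
have [fK _ _] := fB; have Kt : K (f t) := fK t tA.
have [T uT TE] := aut_unitary hk (KG Kt).
pose Z := im (f t) X; have ttZ : totally_tangent_conic Z by rewrite /Z TE; apply: tt_im.
have aZ : acts_as Z a c.
  move=> s; rewrite stab2E // => /andP[sA sac].
  have vA : (t^-1 * s * t)%g \in ('Alt_('I_7))%g by rewrite !groupM ?groupV.
  have : (t^-1 * s * t)%g \in stab2 a b.
    have ta' : (t^-1)%g a = a by rewrite -[in LHS]ta permK.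
    have tb' : (t^-1)%g b = c by rewrite -tc permK.
    rewrite stab2E // vA !permM ta' tb' /=; case/orP: sac => /andP[/eqP -> /eqP ->].
      by rewrite ta tc !eqxx.
    by rewrite ta tc !eqxx orbT.
  move=> /aX; rewrite /Z TE (stab_im _ uT) /= -TE -isoV // -!fM ?groupM ?groupV //.
have caZ : acts_as Z c a by move=> s; rewrite stab2C; apply: aZ.
apply: (rst_trans _ _ _ Z).
  exact: (acts_as_adjacent ttX ttZ ab ac aX aZ).
by apply: (acts_as_adjacent ttZ ttY _ cd caZ cY); rewrite eq_sym.
Qed.

End AltSeven.

End Components.

Theorem theorem1p14 (k : closedFieldType) (hk : 5%N \in [pchar k]%R)
    (Q Q' : set (P2 k))
    (hQ : totally_tangent_conic Q) (hQ' : totally_tangent_conic Q')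
    (hQQ' : Q <> Q') :
  (adjacent Q Q' <->
     isomorphic_to ('Alt_('I_4))%G (stab Q `&` stab Q')) /\
  (same_component Q Q' <->
     isomorphic_to ('Alt_('I_7))%G (subgroup_generated (stab Q `|` stab Q'))).
Proof.
have [w hw] := cube_root_unity k.
have [U uU QE] := tt_normal hk hQ.
(* The standard conic inherits total tangency from [Q] through the inverse of the normalizing
   unitary matrix. *)
have tt1 : totally_tangent_conic (conic 1%:M : set (P2 k)).
  by have := tt_im (unitaryV uU) hQ; rewrite QE clV ?unitary_unitmx // imK.
split; split.
- by move=> /(adjacent_NF hk hw); apply: NF_iso.
- by move=> /(alt4_NF hk hw hQ hQ' hQQ')/(NF_adj hw hQ hQ').
- rewrite QE => /(component_gram hw tt1 uU)[i [j [ij Q'E]]].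
  rewrite Q'E (generated_model hw tt1 uU ij).
    by apply: isomorphic_conj; apply: model_iso.
  by move=> E; apply: hQQ'; rewrite QE Q'E E.
set K := subgroup_generated _; move=> [f [fM fB]].
(* Elements of the generated group are automorphisms of the curve, hence unitary classes, so they
   move totally tangent conics to totally tangent conics. *)
have KG : K `<=` aut_Gamma k.
  move=> g /subgroup_generatedP; apply; last by move=> h [[]|[]].
  apply/is_subgroupP; split=> [|g1 g2 gG hG]; first by rewrite /aut_Gamma /= -/(im _ _) im1.
  rewrite /aut_Gamma /= -/(im _ _) imM -[in im g2^-1%g _](hG : im g2 _ = _) imK.
  exact: gG.
apply: (@alt7_component k hk w hw tt1 K f KG fM fB) => // g sg; apply: sub_generated; [left|right]; exact: sg.
Qed.
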